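(* Let $p\in[1,\infty)$, let $\Omega\subset\mathbb{R}^{2d}$ be measurable with $0<|\Omega|<\infty$, and let $S$ be a bounded operator on $L^2(\mathbb{R}^d)$. Then $$\sup_{T\in\mathcal{D}}\left(\int_\Omega|T\star\check{S}(z)|^p\,dz\right)^{1/p}=\sup_{f\in L^2(\mathbb{R}^d)\setminus\{0\}}\frac{\left(\int_\Omega|Q_Sf(z)|^p\,dz\right)^{1/p}}{\|f\|_{L^2}^2}.$$ If the right-hand supremum is attained (e.g., if $S$ is compact), then the supremum over $\mathcal{D}$ on the left is attained at a rank-one operator $f\otimes f$.
   Context: $L^2(\mathbb{R}^d)$ is a complex Hilbert space with inner product linear in the first entry. $\mathcal{D}=\{T \text{ trace class on } L^2(\mathbb{R}^d): T\ge0,\ \operatorname{tr}(T)=1\}$ is the set of density operators. For $z=(x,\xi)\in\mathbb{R}^{2d}$, $\pi(z)f(y)=e^{2\pi i\xi\cdot y}f(y-x)$, and $\alpha_z(A)=\pi(z)A\pi(z)^*$. With $Pf(y)=f(-y)$, $\check{A}=PAP$. The operator convolution is $T\star S(z)=\operatorname{tr}(T\alpha_z(\check{S}))$, so $T\star\check{S}(z)=\operatorname{tr}(T\alpha_z(S))$ for $T$ trace class and $S$ bounded. The rank-one operator $f\otimes f$ is $h\mapsto\langle h,f\rangle f$. The Cohen-class distribution with window $S$ is $Q_Sf(z)=\langle\alpha_z(S)f,f\rangle=(f\otimes f)\star\check{S}(z)$. *)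

(* Defs.v *)
From HB Require Import structures.
From mathcomp Require Import all_boot all_order all_algebra.
From mathcomp Require Import all_classical all_reals all_analysis.
From mathcomp Require Import measurable_realfun complex ring lra.
Set Implicit Arguments. Unset Strict Implicit. Unset Printing Implicit Defensive.
Import Order.TTheory GRing.Theory Num.Theory.
Import numFieldNormedType.Exports.
Local Open Scope classical_set_scope.
Local Open Scope ring_scope.

Section lebesgue_tuple_step.
Context (R : realType) (d : nat).
Variable mu : {sigma_finite_measure set (d.-tuple R) -> \bar R}.

(* [tcons] and [tsplit] identify R x R^d and R^(d+1). *)
Definition tcons (p : measurableTypeR R * d.-tuple R) : d.+1.-tuple R :=
  [the d.+1.-tuple R of (p.1 : R) :: p.2].

Lemma measurable_tcons : measurable_fun setT tcons.
Proof.
apply: measurable_cons; last exact: measurable_snd.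
exact: (@measurable_fst _ _ (measurableTypeR R) (d.-tuple R)).
Qed.

Definition lebesgue_step : set (d.+1.-tuple R) -> \bar R :=
  pushforward (lebesgue_measure \x mu)%E tcons.

Let lebesgue_step0 : lebesgue_step set0 = 0%E.
Proof. by rewrite /lebesgue_step /pushforward preimage_set0 measure0. Qed.

Let lebesgue_step_ge0 A : (0 <= lebesgue_step A)%E.
Proof. by rewrite /lebesgue_step /pushforward measure_ge0. Qed.

Let lebesgue_step_sigma_additive : semi_sigma_additive lebesgue_step.
Proof.
move=> F mF tF mUF; rewrite /lebesgue_step /pushforward preimage_bigcup.
apply: measure_semi_sigma_additive.
- by move=> n; rewrite -[X in measurable X]setTI; exact: measurable_tcons.
- apply/trivIsetP => /= i j _ _ ij; rewrite -preimage_setI.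
  by move/trivIsetP : tF => /(_ _ _ _ _ ij) ->//; rewrite preimage_set0.
- by rewrite -preimage_bigcup -[X in measurable X]setTI; exact: measurable_tcons.
Qed.

HB.instance Definition _ := isMeasure.Build _ _ _ lebesgue_step
  lebesgue_step0 lebesgue_step_ge0 lebesgue_step_sigma_additive.

Definition tsplit (v : d.+1.-tuple R) : measurableTypeR R * d.-tuple R :=
  (thead v, [tuple of behead v]).

Lemma tconsK : cancel tcons tsplit.
Proof.
by case=> x v; rewrite /tsplit /= theadE; congr pair; apply: val_inj.
Qed.

Lemma tsplitK : cancel tsplit tcons.
Proof. by move=> v; rewrite /tcons /tsplit/= [RHS]tuple_eta; apply: val_inj. Qed.

Lemma measurable_tsplit : measurable_fun setT tsplit.
Proof.
apply: measurable_fun_pair; last exact: measurable_behead.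
by have := @measurable_tnth _ R d.+1 ord0.
Qed.

Let lebesgue_step_sigma_finite : sigma_finite setT lebesgue_step.
Proof.
have /sigma_finiteP[F [TF ndF Foo]] :=
  sigma_finiteT (lebesgue_measure : {sigma_finite_measure set (measurableTypeR R) -> \bar R}).
have /sigma_finiteP[G [TG ndG Goo]] := sigma_finiteT mu.
exists (fun n => tsplit @^-1` (F n `*` G n)).
  rewrite -preimage_bigcup (_ : \bigcup_i (F i `*` G i) = setT) ?preimage_setT//.
  rewrite -setXTT TF TG predeqE => -[x y]; split; last first.
    by move=> [/= [n _ Fnx] [k _ Gky]]; exists (maxn n k) => //; split;
      [move: x Fnx; exact/subsetPset/ndF/leq_maxl
      |move: y Gky; exact/subsetPset/ndG/leq_maxr].
  by move=> [n _ []/= ? ?]; split; exists n.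
move=> k; have [? ?] := Foo k; have [? ?] := Goo k; split.
  rewrite -[X in measurable X]setTI; apply: measurable_tsplit => //.
  exact: measurableX.
rewrite /lebesgue_step /pushforward -comp_preimage.
rewrite (_ : tsplit \o tcons = id) ?preimage_id; last exact/funext/tconsK.
by rewrite product_measure1E// lte_mul_pinfty// ge0_fin_numE.
Qed.

HB.instance Definition _ := Measure_isSigmaFinite.Build _ _ _ lebesgue_step
  lebesgue_step_sigma_finite.

End lebesgue_tuple_step.

Fixpoint lebesgue_tuple (R : realType) (d : nat) :
    {sigma_finite_measure set (d.-tuple R) -> \bar R} :=
  match d with
  | 0 => \d_[tuple]
  | d'.+1 => lebesgue_step (lebesgue_tuple R d')
  end.

Section coordinatewise_maps.
Context (R : realType).

Definition tmap d (u : 'I_d -> R -> R) (y : d.-tuple R) : d.-tuple R :=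
  [tuple u i (tnth y i) | i < d].

Lemma measurable_tmap d (u : 'I_d -> R -> R) :
  (forall i, measurable_fun setT (u i)) -> measurable_fun setT (tmap u).
Proof.
move=> mu; apply/measurable_fun_tnthP => i.
rewrite (_ : _ \o _ = u i \o (fun y => tnth y i)).
  by apply: measurableT_comp => //; exact: measurable_tnth.
by apply/funext => y /=; rewrite tnth_mktuple.
Qed.

Lemma lebesgue_tmap d (u : 'I_d -> R -> R) :
  (forall i, measurable_fun setT (u i)) ->
  (forall i (A : set R), measurable A ->
     lebesgue_measure (u i @^-1` A) = lebesgue_measure A) ->
  forall A, measurable A -> lebesgue_tuple R d (tmap u @^-1` A) = lebesgue_tuple R d A.
Proof.
elim: d u => [|d IH] u mu uE A mA.
  suff -> : tmap u @^-1` A = A by [].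
  by apply/seteqP; split=> y; rewrite /preimage/= (tuple0 (tmap u y)) (tuple0 y).
pose v (i : 'I_d) := u (lift ord0 i).
have mv : measurable_fun setT (tmap v) by apply: measurable_tmap => i; exact: mu.
pose h (q : measurableTypeR R * d.-tuple R) : measurableTypeR R * d.-tuple R :=
  (u ord0 q.1, tmap v q.2).
have mh : measurable_fun setT h.
  apply: measurable_fun_pair.
    apply: (@measurableT_comp _ _ _ _ _ (measurableTypeR R) (u ord0)) => //.
    exact: mu.
  exact: measurableT_comp.
rewrite /= /lebesgue_step /pushforward.
have -> : (@tcons R d) @^-1` (tmap u @^-1` A) = h @^-1` (@tcons R d @^-1` A).
  apply/seteqP; split => -[x y] /=; rewrite /h /=;
  (suff -> : tmap u (tcons (x, y)) = tcons (u ord0 x, tmap v y) by []);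
  apply: eq_from_tnth => i; rewrite tnth_mktuple;
  by have [j ->|->] := unliftP ord0 i; rewrite ?tnth0 ?tnthS ?tnth_mktuple.
have mA' : measurable (@tcons R d @^-1` A).
  by rewrite -[X in measurable X]setTI; exact: measurable_tcons.
pose m' := pushforward (lebesgue_measure \x lebesgue_tuple R d)%E h.
pose M' : {measure set (measurableTypeR R * d.-tuple R)%type -> \bar R} :=
  measure_function_pushforward__canonical__measure_function_Measure
     (lebesgue_measure \x lebesgue_tuple R d)%E mh.
rewrite -[LHS]/(M' (@tcons R d @^-1` A)).
apply/esym/product_measure_unique => // B C mB mC.
rewrite /M' /= /pushforward /=.
have -> : h @^-1` (B `*` C) = (u ord0 @^-1` B) `*` (tmap v @^-1` C) by [].
rewrite product_measure1E//.
- congr (_ * _)%E; first exact: uE.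
  by apply: (IH v) => // i; [exact: mu|exact: uE].
- by rewrite -[X in measurable X]setTI; exact: mu.
- by rewrite -[X in measurable X]setTI; exact: mv.
Qed.

Lemma lebesgue_measureB (a : R) (A : set R) : measurable A ->
  lebesgue_measure ((fun t => t - a) @^-1` A) = lebesgue_measure A.
Proof.
move=> mA.
have mf : measurable_fun setT ((fun t => t - a) : measurableTypeR R -> measurableTypeR R).
  exact: measurable_funB.
pose M : {measure set (measurableTypeR R) -> \bar R} :=
  measure_function_pushforward__canonical__measure_function_Measure
     (@lebesgue_measure R) mf.
apply/esym/(@lebesgue_measure_unique _ M) => // _ [[x y]] _ <-.
rewrite /M /= /pushforward /=.
have -> : (fun t => t - a) @^-1` `]x, y]%classic = `]x + a, y + a]%classic.
  by apply/seteqP; split => t /=; rewrite !in_itv/= lerBlDr ltrBrDr.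
rewrite !lebesgue_measure_itv/= !lte_fin ltrD2r.
by case: ifPn => // _; congr (_%:E); rewrite opprD addrACA subrr addr0.
Qed.

(* y |-> y - x and y |-> - y *)
Definition tshift d (x : d.-tuple R) : d.-tuple R -> d.-tuple R :=
  tmap (fun i t => t - tnth x i).
Definition topp d : d.-tuple R -> d.-tuple R := tmap (fun _ t => - t).

Lemma measurable_tshift d (x : d.-tuple R) : measurable_fun setT (tshift x).
Proof. by apply: measurable_tmap => i; exact: measurable_funB. Qed.

Lemma measurable_topp d : measurable_fun setT (@topp d).
Proof. by apply: measurable_tmap => i; exact: oppr_measurable. Qed.

Lemma lebesgue_tshift d (x : d.-tuple R) A : measurable A ->
  lebesgue_tuple R d (tshift x @^-1` A) = lebesgue_tuple R d A.
Proof.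
by apply: lebesgue_tmap => i; [exact: measurable_funB|exact: lebesgue_measureB].
Qed.

Lemma lebesgue_topp d A : measurable A ->
  lebesgue_tuple R d (@topp d @^-1` A) = lebesgue_tuple R d A.
Proof.
by apply: lebesgue_tmap => i; [exact: oppr_measurable|exact: lebesgue_measureN].
Qed.

End coordinatewise_maps.

Section square_integrable.
Context (R : realType) (d : nat).
Local Notation C := R[i].
Local Notation Rd := (d.-tuple R).
Local Notation leb := (lebesgue_tuple R d).
Local Notation normc := ComplexField.Normc.normc.
Implicit Types f g : Rd -> C^o.

Definition cmeasurable f :=
  measurable_fun setT (fun y => complex.Re (f y)) /\
  measurable_fun setT (fun y => complex.Im (f y)).

Lemma normc2E (z : C) : normc z ^+ 2 = complex.Re z ^+ 2 + complex.Im z ^+ 2.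
Proof. by case: z => a b /=; rewrite sqr_sqrtr// addr_ge0// sqr_ge0. Qed.

Lemma normc_ge0 (z : C) : 0 <= normc z.
Proof. by case: z => a b /=; exact: sqrtr_ge0. Qed.

Lemma cmeasurable_normc2 f : cmeasurable f ->
  measurable_fun setT (fun y => normc (f y) ^+ 2).
Proof.
move=> [mr mi]; under eq_fun do rewrite normc2E.
by apply: measurable_funD; exact: measurable_funX.
Qed.

Lemma cmeasurableM f g : cmeasurable f -> cmeasurable g ->
  cmeasurable (fun y => (f y : C) * (g y : C)).
Proof.
move=> [fr fi] [gr gi]; split.
  rewrite (_ : (fun y => _) = fun y => complex.Re (f y) * complex.Re (g y) -
      complex.Im (f y) * complex.Im (g y)).
    by apply: measurable_funB; exact: measurable_funM.
  by apply/funext => y; case: (f y); case: (g y).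
rewrite (_ : (fun y => _) = fun y => complex.Re (f y) * complex.Im (g y) +
    complex.Im (f y) * complex.Re (g y)).
  by apply: measurable_funD; exact: measurable_funM.
by apply/funext => y; case: (f y) => a b; case: (g y).
Qed.

Lemma cmeasurable_comp f (phi : Rd -> Rd) : measurable_fun setT phi ->
  cmeasurable f -> cmeasurable (f \o phi).
Proof.
by move=> mphi [fr fi]; split;
  [exact: (measurableT_comp fr)|exact: (measurableT_comp fi)].
Qed.

Definition sqint : {pred Rd -> C^o} := fun f =>
  `[< cmeasurable f /\ (\int[leb]_y (normc (f y) ^+ 2)%:E < +oo)%E >].

Lemma sqintP f : reflect
  (cmeasurable f /\ (\int[leb]_y (normc (f y) ^+ 2)%:E < +oo)%E) (f \in sqint).
Proof. exact: asboolP. Qed.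

Lemma sqint_submod_closed : submod_closed sqint.
Proof.
split.
  apply/sqintP; split; first by split; exact: measurable_cst.
  under eq_integral do rewrite normc2E /= expr0n/= addr0.
  by rewrite integral0.
move=> a f g /sqintP[mf fi] /sqintP[mg gi]; apply/sqintP.
have m : cmeasurable (a *: f + g).
  have [hr hi] : cmeasurable (a *: f).
    by apply: (@cmeasurableM (fun=> a)) => //; split; exact: measurable_cst.
  case: mg => gr gi'; split.
    rewrite (_ : (fun y => _) = fun y => complex.Re ((a *: f) y) + complex.Re (g y)).
      exact: measurable_funD.
    by apply/funext => y /=; rewrite [LHS]raddfD.
  rewrite (_ : (fun y => _) = fun y => complex.Im ((a *: f) y) + complex.Im (g y)).
    exact: measurable_funD.
  by apply/funext => y /=; rewrite [LHS]raddfD.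
split => //.
set F := fun y => normc (f y) ^+ 2; set G := fun y => normc (g y) ^+ 2.
have F0 y : 0 <= F y by exact: sqr_ge0.
have G0 y : 0 <= G y by exact: sqr_ge0.
have mF : measurable_fun setT F by exact: cmeasurable_normc2.
have mG : measurable_fun setT G by exact: cmeasurable_normc2.
have k0 : 0 <= 2 * normc a ^+ 2 by rewrite mulr_ge0// sqr_ge0.
apply: (@le_lt_trans _ _ (\int[leb]_y ((2 * normc a ^+ 2)%R%:E * (F y)%:E + 2%:E * (G y)%:E))%E).
  apply: ge0_le_integral => //.
  - by move=> y _; rewrite lee_fin sqr_ge0.
  - exact: (measurable_EFinP _ _).2 (cmeasurable_normc2 m).
  - apply: emeasurable_funD; apply: emeasurable_funM => //; exact/measurable_EFinP.
  move=> y _; rewrite -!EFinM -EFinD lee_fin /F /G.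
  have h : normc (a * f y + g y) <= normc a * normc (f y) + normc (g y).
    by rewrite -ComplexField.Normc.normcM; exact: le_normcD.
  apply: (@le_trans _ _ ((normc a * normc (f y) + normc (g y)) ^+ 2)).
    by rewrite lerXn2r// ?nnegrE ?addr_ge0 ?mulr_ge0 ?normc_ge0.
  rewrite -mulrA -exprMn -subr_ge0; set u := normc a * _; set v := normc (g y).
  rewrite (_ : _ - _ = (u - v) ^+ 2) ?sqr_ge0//; ring.
rewrite ge0_integralD//;
  try (by move=> y _; rewrite mule_ge0// lee_fin);
  try (by apply: emeasurable_funM => //; exact/measurable_EFinP).
rewrite !ge0_integralZl//; try exact/measurable_EFinP;
  try (by move=> y _; rewrite lee_fin).
by rewrite lte_add_pinfty// lte_mul_pinfty.
Qed.

HB.instance Definition _ := GRing.isSubmodClosed.Build _ _ sqint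
  sqint_submod_closed.

(* Representatives are Borel measurable; every class of Lebesgue measurable
   functions modulo null sets contains one, so that [L2] below is the usual
   L^2(R^d; C). *)
Record sqfun := SqFun { sqfun_val :> Rd -> C^o; _ : sqfun_val \in sqint }.

HB.instance Definition _ := [isSub for sqfun_val].
HB.instance Definition _ := [Choice of sqfun by <:].
HB.instance Definition _ := [SubChoice_isSubLmodule of sqfun by <:].

Lemma sqfunP (f : sqfun) : sqfun_val f \in sqint. Proof. by case: f. Qed.

End square_integrable.

Section L2.
Context (R : realType) (d : nat).
Local Open Scope complex_scope.
Local Notation normc := ComplexField.Normc.normc.
Local Notation C := R[i].
Local Notation Rd := (d.-tuple R).
Local Notation leb := (lebesgue_tuple R d).
Local Open Scope quotient_scope.

Definition sqfun_ae_eq (f g : sqfun R d) : bool :=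
  `[< {ae leb, forall y, f y = g y} >].

Fact sqfun_ae_eq_refl : reflexive sqfun_ae_eq.
Proof. by move=> f; apply/asboolP; exact: nearW. Qed.

Fact sqfun_ae_eq_sym : symmetric sqfun_ae_eq.
Proof.
by move=> f g; apply/asboolP/asboolP; apply: filterS => y ->.
Qed.

Fact sqfun_ae_eq_trans : transitive sqfun_ae_eq.
Proof.
move=> g f h /asboolP fg /asboolP gh; apply/asboolP.
by apply: filterS2 fg gh => y -> ->.
Qed.

Canonical sqfun_ae_eq_canonical := EquivRel sqfun_ae_eq
  sqfun_ae_eq_refl sqfun_ae_eq_sym sqfun_ae_eq_trans.

Definition L2 : Type := {eq_quot sqfun_ae_eq}.
HB.instance Definition _ := Choice.on L2.
HB.instance Definition _ := EqQuotient.on L2.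

Implicit Types f g h : sqfun R d.
Implicit Types u v w : L2.

Lemma L2_eqP f g : reflect {ae leb, forall y, f y = g y} (\pi_L2 f == \pi_L2 g).
Proof. by rewrite eqmodE; exact: asboolP. Qed.

Lemma L2_reprP f : {ae leb, forall y, repr (\pi_L2 f) y = f y}.
Proof. by apply/L2_eqP; rewrite reprK. Qed.

Definition L2_zero : L2 := \pi_L2 0.
Definition L2_opp u : L2 := \pi_L2 (- repr u).
Definition L2_add u v : L2 := \pi_L2 (repr u + repr v).
Definition L2_scale (a : C) u : L2 := \pi_L2 (a *: repr u).

Lemma pi_L2_opp f : L2_opp (\pi_L2 f) = \pi_L2 (- f).
Proof.
apply/eqP/L2_eqP; apply: filterS (L2_reprP f) => y e.
by rewrite [LHS]/= [RHS]/= /GRing.opp/= e.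
Qed.

Lemma pi_L2_add f g : L2_add (\pi_L2 f) (\pi_L2 g) = \pi_L2 (f + g).
Proof.
apply/eqP/L2_eqP; apply: filterS2 (L2_reprP f) (L2_reprP g) => y e e'.
by rewrite /GRing.add/= /GRing.add/= e e'.
Qed.

Lemma pi_L2_scale a f : L2_scale a (\pi_L2 f) = \pi_L2 (a *: f).
Proof.
apply/eqP/L2_eqP; apply: filterS (L2_reprP f) => y e.
by rewrite /GRing.scale/= /GRing.scale/= e.
Qed.
Fact L2_addA : associative L2_add.
Proof.
move=> u v w; rewrite -[u]reprK -[v]reprK -[w]reprK.
move: (repr u) (repr v) (repr w) => f g h.
by rewrite (pi_L2_add g h) (pi_L2_add f g) !pi_L2_add addrA.
Qed.

Fact L2_addC : commutative L2_add.
Proof. by move=> u v; rewrite /L2_add addrC. Qed.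

Fact L2_add0 : left_id L2_zero L2_add.
Proof.
by move=> u; rewrite -[u]reprK; move: (repr u) => f; rewrite pi_L2_add add0r.
Qed.

Fact L2_addN : left_inverse L2_zero L2_opp L2_add.
Proof.
move=> u; rewrite -[u]reprK; move: (repr u) => f.
by rewrite (pi_L2_opp f) pi_L2_add addNr.
Qed.

HB.instance Definition _ := GRing.isZmodule.Build L2
  L2_addA L2_addC L2_add0 L2_addN.

Fact L2_scaleA a b u : L2_scale a (L2_scale b u) = L2_scale (a * b) u.
Proof.
rewrite -[u]reprK; move: (repr u) => f.
by rewrite (pi_L2_scale b f) !pi_L2_scale scalerA.
Qed.

Fact L2_scale1 : left_id 1 L2_scale.
Proof. by move=> u; rewrite /L2_scale scale1r reprK. Qed.

Fact L2_scaleDr : right_distributive L2_scale +%R.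
Proof.
move=> a u v; rewrite -[u]reprK -[v]reprK.
move: (repr u) (repr v) => f g.
rewrite -[_ + _]/(L2_add _ _) -[RHS]/(L2_add _ _).
by rewrite (pi_L2_add f g) !pi_L2_scale pi_L2_add scalerDr.
Qed.

Fact L2_scaleDl u : {morph L2_scale^~ u : a b / a + b}.
Proof.
move=> a b; rewrite -[u]reprK; move: (repr u) => f.
by rewrite -[RHS]/(L2_add _ _) !pi_L2_scale pi_L2_add scalerDl.
Qed.

HB.instance Definition _ := GRing.Zmodule_isLmodule.Build C L2
  L2_scaleA L2_scale1 L2_scaleDr L2_scaleDl.

Definition cintegral (f : Rd -> C) : C :=
  (\int[leb]_y complex.Re (f y)) +i* (\int[leb]_y complex.Im (f y)).

Definition inner u v : C := cintegral (fun y => repr u y * (repr v y)^*%C).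

Definition norm2 u : R := Num.sqrt (\int[leb]_y (normc (repr u y) ^+ 2)).

End L2.

Section time_frequency.
Context (R : realType) (d : nat).
Local Open Scope complex_scope.
Local Open Scope quotient_scope.
Local Notation normc := ComplexField.Normc.normc.
Local Notation C := R[i].
Local Notation Rd := (d.-tuple R).
Local Notation leb := (lebesgue_tuple R d).
Local Notation L2 := (L2 R d).

Section measure_preserving.
Variable phi : Rd -> Rd.
Hypothesis mphi : measurable_fun setT phi.
Hypothesis lebphi : forall A, measurable A -> leb (phi @^-1` A) = leb A.

Lemma ge0_integral_preserving (g : Rd -> \bar R) : measurable_fun setT g ->
  (forall y, 0 <= g y)%E -> (\int[leb]_y g (phi y) = \int[leb]_y g y)%E.
Proof.
move=> mg g0.
pose P : {measure set Rd -> \bar R} :=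
  measure_function_pushforward__canonical__measure_function_Measure leb mphi.
transitivity (\int[P]_y g y)%E.
  by rewrite ge0_integral_pushforward// => y _; exact: g0.
by apply: eq_measure_integral => A mA _; exact: lebphi.
Qed.

Lemma integral_preserving (g : Rd -> \bar R) : measurable_fun setT g ->
  (\int[leb]_y g (phi y) = \int[leb]_y g y)%E.
Proof.
move=> mg; rewrite integralE [RHS]integralE.
congr (_ - _)%E.
  rewrite (funepos_comp g phi).
  by apply: (ge0_integral_preserving (measurable_funepos mg)) => y; exact: funepos_ge0.
rewrite (funeneg_comp g phi).
by apply: (ge0_integral_preserving (measurable_funeneg mg)) => y; exact: funeneg_ge0.
Qed.

Lemma sqint_preserving (m : Rd -> C) (f : Rd -> C^o) : cmeasurable m ->
  (forall y, normc (m y) = 1) -> f \in @sqint R d ->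
  (fun y => m y * f (phi y) : C^o) \in @sqint R d.
Proof.
move=> mm m1 /sqintP[mf fi]; apply/sqintP; split.
  exact: (cmeasurableM mm (cmeasurable_comp mphi mf)).
under eq_integral do rewrite ComplexField.Normc.normcM m1 mul1r.
rewrite (ge0_integral_preserving (g := fun y => (normc (f y) ^+ 2)%:E))//.
- exact: (measurable_EFinP _ _).2 (cmeasurable_normc2 mf).
- by move=> y; rewrite lee_fin sqr_ge0.
Qed.
End measure_preserving.

Definition dot (x y : Rd) : R := \sum_(i < d) tnth x i * tnth y i.

Definition expi (t : R) : C := cos t +i* sin t.

Lemma normc_expi t : normc (expi t) = 1.
Proof. by rewrite /= cos2Dsin2 sqrtr1. Qed.

Lemma cmeasurable_expi (g : Rd -> R) : measurable_fun setT g ->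
  cmeasurable (fun y => expi (g y)).
Proof.
move=> mg; split.
  apply: (measurableT_comp _ mg); apply: continuous_measurable_fun.
  exact: continuous_cos.
apply: (measurableT_comp _ mg); apply: continuous_measurable_fun.
exact: continuous_sin.
Qed.

Lemma measurable_dot x : measurable_fun setT (dot x).
Proof.
apply: measurable_sum => i; apply: measurable_funM => //.
exact: measurable_tnth.
Qed.

Implicit Types (z : Rd * Rd) (f : sqfun R d) (u v : L2).

Lemma sqint_tfshift z f :
  (fun y => expi (2 * pi * dot z.2 y) * f (tshift z.1 y) : C^o) \in @sqint R d.
Proof.
apply: (sqint_preserving (measurable_tshift _) (lebesgue_tshift _)) => //.
- apply: cmeasurable_expi; apply: measurable_funM => //; exact: measurable_dot.
- by move=> y; exact: normc_expi.
- exact: sqfunP.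
Qed.

Lemma sqint_tfshift_adj z f :
  (fun y => expi (- (2 * pi * dot z.2 (tshift (topp z.1) y))) *
            f (tshift (topp z.1) y) : C^o) \in @sqint R d.
Proof.
apply: (sqint_preserving (measurable_tshift _) (lebesgue_tshift _)) => //.
- apply: cmeasurable_expi; apply: measurable_funN; apply: measurable_funM => //.
  by apply: (measurableT_comp (measurable_dot _)); exact: measurable_tshift.
- by move=> y; exact: normc_expi.
- exact: sqfunP.
Qed.

Lemma sqint_parity f : (fun y => f (topp y) : C^o) \in @sqint R d.
Proof.
rewrite (_ : (fun y => _) = (fun y => (1 : C) * f (topp y) : C^o)).
  apply: (sqint_preserving (@measurable_topp _ _) (@lebesgue_topp _ _)) => //.
  - by move=> y; rewrite /= expr1n expr0n addr0 sqrtr1.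
  - exact: sqfunP.
by apply/funext => y; rewrite mul1r.
Qed.

(* pi(z), its adjoint (see [tfshift_adjP]) and the parity operator; being
   compatible with almost everywhere equality, they do not depend on the
   representative that is chosen. *)
Definition tfshift z u : L2 := \pi_L2 (SqFun (sqint_tfshift z (repr u))).
Definition tfshift_adj z u : L2 := \pi_L2 (SqFun (sqint_tfshift_adj z (repr u))).
Definition parity u : L2 := \pi_L2 (SqFun (sqint_parity (repr u))).

Lemma eq_cintegral_ae (g h : Rd -> C) : cmeasurable g -> cmeasurable h ->
  {ae leb, forall y, g y = h y} -> cintegral g = cintegral h.
Proof.
move=> [gr gi] [hr hi] gh; rewrite /cintegral /Rintegral.
congr (fine _ +i* fine _); apply: ae_eq_integral => //;
  try exact/measurable_EFinP; by apply: filterS gh => y -> _.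
Qed.

Lemma cmeasurable_conj (g : Rd -> C) :
  cmeasurable g -> cmeasurable (fun y => (g y)^*%C).
Proof.
move=> [gr gi]; split.
  by rewrite (_ : (fun y => _) = fun y => complex.Re (g y))//;
    apply/funext => y; case: (g y).
rewrite (_ : (fun y => _) = fun y => - complex.Im (g y)).
  exact: measurable_funN.
by apply/funext => y; case: (g y).
Qed.

Lemma cintegral_shift (x : Rd) (g : Rd -> C) : cmeasurable g ->
  cintegral (fun y => g (tshift x y)) = cintegral g.
Proof.
move=> [gr gi]; rewrite /cintegral /Rintegral; congr (fine _ +i* fine _).
- exact: (integral_preserving (measurable_tshift x) (@lebesgue_tshift _ _ x)
    ((measurable_EFinP _ _).2 gr)).
- exact: (integral_preserving (measurable_tshift x) (@lebesgue_tshift _ _ x)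
    ((measurable_EFinP _ _).2 gi)).
Qed.

Lemma tshiftK (x y : Rd) : tshift x (tshift (topp x) y) = y.
Proof.
by apply: eq_from_tnth => i; rewrite !tnth_mktuple opprK addrK.
Qed.

Lemma tfshift_adjP z u v : inner (tfshift z u) v = inner u (tfshift_adj z v).
Proof.
pose H y := (expi (2 * pi * dot z.2 y) * repr u (tshift z.1 y)) * (repr v y)^*%C.
have cm f : cmeasurable (f : Rd -> C^o) by case/sqintP: (sqfunP f).
have mH : cmeasurable H.
  apply: cmeasurableM; last exact/cmeasurable_conj/cm.
  exact: (cm (SqFun (sqint_tfshift z (repr u)))).
transitivity (cintegral H).
  apply: eq_cintegral_ae => //.
    by apply: cmeasurableM; [exact: cm|exact/cmeasurable_conj/cm].
  by apply: filterS (L2_reprP (SqFun (sqint_tfshift z (repr u)))) => y ->.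
rewrite -(cintegral_shift (topp z.1) mH); apply/esym/eq_cintegral_ae.
- by apply: cmeasurableM; [exact: cm|exact/cmeasurable_conj/cm].
- exact: (cmeasurable_comp (measurable_tshift _) mH).
apply: filterS (L2_reprP (SqFun (sqint_tfshift_adj z (repr v)))) => y -> /=.
rewrite /H tshiftK rmorphM /= /expi cosN sinN /= opprK.
by rewrite mulrCA mulrA.
Qed.

End time_frequency.

Section operators.
Context (R : realType) (d : nat).
Local Open Scope complex_scope.
Local Notation C := R[i].
Local Notation Rd := (d.-tuple R).
Local Notation L2 := (L2 R d).
Local Notation normc := ComplexField.Normc.normc.
Implicit Types (T S A : L2 -> L2) (u v f : L2) (z : Rd * Rd).

Definition bounded_op T :=
  linear T /\ exists M : R, forall u, norm2 (T u) <= M * norm2 u.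

(* The order of [R[i]] makes [0 <= w] mean that [w] is real and nonnegative. *)
Definition positive_op T := forall u, 0 <= inner (T u) u.

(* Sequential compactness: bounded sequences are mapped to sequences that have
   a norm-convergent subsequence. *)
Definition compact_op T := linear T /\
  forall u_ : nat -> L2, (exists M : R, forall n, norm2 (u_ n) <= M) ->
  exists2 k : nat -> nat, {homo k : m n / (m < n)%N} &
    exists v, (fun n => norm2 (T (u_ (k n)) - v)) @ \oo --> (0 : R).

(* Orthonormal bases indexed by [nat]: they exist only for [0 < d], since
   L^2(R^0) is one-dimensional. *)
Definition onb (e : nat -> L2) :=
  (forall m n, inner (e m) (e n) = (m == n)%:R) /\
  forall u, (fun n => norm2 (u - \sum_(k < n) inner u (e k) *: e k)) @ \oo
    --> (0 : R).

(* [is_abs T A] says that [A] is the operator |T|, i.e., the positive [A] with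
   A^* A = T^* T; the equation is written without adjoints. *)
Definition is_abs T A := [/\ bounded_op A, positive_op A &
  forall u v, inner (A u) (A v) = inner (T u) (T v)].

Definition trace_class T := bounded_op T /\ exists2 A, is_abs T A &
  exists2 e, onb e &
    (\sum_(0 <= n <oo) (complex.Re (inner (A (e n)) (e n)))%:E < +oo)%E.

(* The trace is the common value of the series of the <T e_n, e_n> over all
   orthonormal bases; the default value 0 is irrelevant for trace class T. *)
Definition is_trace T (t : C) := forall e, onb e ->
  (series (fun n => inner (T (e n)) (e n)) : nat -> C^o) @ \oo --> (t : C^o).
Definition trace T : C := xget 0 [set t | is_trace T t].

Definition density_op : set (L2 -> L2) :=
  [set T | [/\ trace_class T, positive_op T & trace T = 1]].

(* alpha_z(A) = pi(z) A pi(z)^* and PAP *)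
Definition alpha z A : L2 -> L2 := tfshift z \o A \o tfshift_adj z.
Definition check_op A : L2 -> L2 := @parity R d \o A \o @parity R d.
Definition rank_one f : L2 -> L2 := fun h => inner h f *: f.

Definition op_conv T S z : C := trace (T \o alpha z (check_op S)).
Definition cohen S f z : C := inner (alpha z S f) f.

(* The Borel Lebesgue measure of phase space R^d x R^d. *)
Definition borel_phase : {measure set (Rd * Rd) -> \bar R} :=
  (lebesgue_tuple R d \x lebesgue_tuple R d)%E.

(* Phase space with the sigma-algebra of its Lebesgue measurable sets. *)
Definition phase_space := caratheodory_type (borel_phase^*)%mu.
HB.instance Definition _ := Measurable.on phase_space.
Definition lebesgue_phase : {measure set phase_space -> \bar R} :=
  @completed_measure_extension _ _ _ borel_phase.

Definition Lp_on (p : R) (Omega : set phase_space) (F : Rd * Rd -> C) : \bar R :=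
  ((\int[lebesgue_phase]_(z in Omega) (normc (F z) `^ p)%:E) `^ p^-1)%E.

Definition cohen_quotient (p : R) (Omega : set phase_space) S f : \bar R :=
  (Lp_on p Omega (cohen S f) / (norm2 f ^+ 2)%:E)%E.

End operators.

(* Main.v *)
(** A density operator [T] is a sum of rank-one operators [g_n (x) g_n] with
    [sum |g_n|^2 <= 1].  Such a decomposition needs no spectral theorem: an infinite
    Cholesky factorization along an orthonormal basis provides it, positivity being
    preserved at each step by the Cauchy-Schwarz inequality for the form <T u, v>.
    Hence [tr (T alpha_z(S)) = sum_n Q_S g_n (z)] is a subconvex combination, with
    weights [|g_n|^2], of Cohen distributions of unit vectors, and Jensen's inequality
    for [t |-> t^p] bounds its L^p norm over [Omega] by the supremum over [f]; rank-one
    operators give the converse and the attainment.  If [S] is compact, a maximizing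
    sequence of unit vectors has a weakly convergent subsequence, along which [Q_S]
    converges pointwise and, by dominated convergence, in the mean; the weak limit
    is a maximizer because its norm is at most 1.

    That traces are well defined rests on the existence of an orthonormal basis of
    L^2(R^d), obtained by Gram-Schmidt from the indicators of rational boxes: they are
    total because measures that are finite on boxes are determined by their values
    there. *)
From HB Require Import structures.
Require Import Defs.
From mathcomp Require Import all_boot all_order all_algebra.
From mathcomp Require Import all_classical all_reals all_analysis.
From mathcomp Require Import complex ring lra measurable_realfun.
Set Implicit Arguments. Unset Strict Implicit. Unset Printing Implicit Defensive.
Import Order.TTheory GRing.Theory Num.Theory.
Import numFieldNormedType.Exports.
Local Open Scope classical_set_scope.
Local Open Scope ring_scope.

(** [trace] is 0 when the diagonal series have no common limit over all orthonormal bases, so each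
    trace has to be shown to exist before it can be computed. For a density operator existence is
    read off from [trace T = 1], as 1 is not the default. For [T \o alpha z S] it is obtained along
    an arbitrary basis from the decomposition of [T]; square-summability of the norms |g_n| suffices
    for this, and the g_n need not be orthogonal, which is why Cholesky factors can replace
    eigenvectors. Weights of total mass below 1 do no harm in Jensen's inequality, since t^p
    vanishes at 0. For compact [S], convergence of Q_S along weakly convergent sequences rests on S
    (1 - P_N) -> 0 in norm, P_N being the projections of a basis; compactness being given by
    sequences, this is proved by contradiction and needs the adjoint of [S], which is built from its
    coefficients. *)

Local Notation normc := ComplexField.Normc.normc.
Local Notation Re := complex.Re.
Local Notation Im := complex.Im.

(** * Moduli and limits of complex numbers *)

Section complex_modulus.
Context (R : realType).
Local Open Scope complex_scope.
Implicit Types x y z : R[i].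

Lemma ReD x y : Re (x + y) = Re x + Re y. Proof. by case: x y => [? ?] []. Qed.
Lemma ImD x y : Im (x + y) = Im x + Im y. Proof. by case: x y => [? ?] []. Qed.
Lemma ReN x : Re (- x) = - Re x. Proof. by case: x. Qed.
Lemma ImN x : Im (- x) = - Im x. Proof. by case: x. Qed.
Lemma ReJ x : Re x^*%C = Re x. Proof. by case: x. Qed.
Lemma ImJ x : Im x^*%C = - Im x. Proof. by case: x. Qed.
Lemma ReM x y : Re (x * y) = Re x * Re y - Im x * Im y.
Proof. by case: x y => [? ?] []. Qed.
Lemma ImM x y : Im (x * y) = Re x * Im y + Im x * Re y.
Proof. by case: x y => [? ?] []. Qed.

Lemma Re_sum I (r : seq I) (P : pred I) (F : I -> R[i]) :
  Re (\sum_(i <- r | P i) F i) = \sum_(i <- r | P i) Re (F i).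
Proof. exact: (big_morph _ ReD erefl). Qed.

Lemma eq_ReIm x y : Re x = Re y -> Im x = Im y -> x = y.
Proof. by case: x y => [? ?] [? ?] /= -> ->. Qed.

Lemma ge0_complex x : 0 <= x -> [/\ x = (Re x)%:C, Im x = 0 & 0 <= Re x].
Proof.
by case: x => a b; rewrite lecE /= => /andP[/eqP -> ?]; split.
Qed.

Lemma normc_conj x : normc x^*%C = normc x.
Proof. by case: x => a b /=; rewrite sqrrN. Qed.

Lemma normc_real (a : R) : normc a%:C = `|a|.
Proof. by rewrite /= expr0n /= addr0 sqrtr_sqr. Qed.

Lemma mulJc x : x * x^*%C = (normc x ^+ 2)%:C.
Proof.
by rewrite normc2E; case: x => a b; apply: eq_ReIm; rewrite ?ReM ?ImM/=; ring.
Qed.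

Lemma ler_normRe x : `|Re x| <= normc x.
Proof.
rewrite -(@ler_pXn2r _ 2)// ?nnegrE ?normc_ge0// normc2E real_normK ?num_real//.
by rewrite lerDl sqr_ge0.
Qed.

Lemma ler_normIm x : `|Im x| <= normc x.
Proof.
rewrite -(@ler_pXn2r _ 2)// ?nnegrE ?normc_ge0// normc2E real_normK ?num_real//.
by rewrite lerDr sqr_ge0.
Qed.

Lemma ler_normc_ReIm x : normc x <= `|Re x| + `|Im x|.
Proof.
rewrite -(@ler_pXn2r _ 2)// ?nnegrE ?normc_ge0 ?addr_ge0// normc2E sqrrD.
rewrite !real_normK ?num_real// addrAC lerDl.
by rewrite mulrn_wge0 ?mulr_ge0.
Qed.

Lemma ler_normc_sum I (r : seq I) (P : pred I) (F : I -> R[i]) :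
  normc (\sum_(i <- r | P i) F i) <= \sum_(i <- r | P i) normc (F i).
Proof.
elim/big_ind2 : _ => [|x a y b xa yb|//]; first by rewrite ComplexField.Normc.normc0.
exact: le_trans (le_normcD _ _) (lerD xa yb).
Qed.

Lemma conjC_real (a : R) : (a%:C)^*%C = a%:C.
Proof. by apply: eq_ReIm; rewrite /= ?oppr0. Qed.

Lemma normc_normr x : `|x| = (normc x)%:C.
Proof. by case: x => a b; rewrite normc_def. Qed.

Lemma normc_distrC x y : normc (x - y) = normc (y - x).
Proof. by rewrite -normcN opprB. Qed.

End complex_modulus.

Section complex_sequences.
Context (R : realType).
Local Open Scope complex_scope.
Implicit Types (u : nat -> R[i]) (l : R[i]).

(** Only [is_trace] speaks of the topology of [R[i]^o]; everywhere else a complex limit is stated as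
    a real limit of moduli. This is the passage between the two. *)
Lemma cvg_normcP u l : ((u : nat -> R[i]^o) @ \oo --> (l : R[i]^o)) <->
  ((fun n => normc (u n - l)) @ \oo --> (0 : R)).
Proof.
split=> [/cvgrPdist_lt h|/cvgr0Pnorm_lt h].
  apply/cvgr0Pnorm_lt => e e0; have := h e%:C; rewrite ltcR => /(_ e0).
  apply: filterS => n; rewrite normc_distrC (ger0_norm (normc_ge0 _)).
  by rewrite -[X in (X < _)%R]/(`|l - u n : R[i]|) normc_normr ltcR.
apply/cvgrPdist_lt => e e0.
(* The radius [e] is a complex number; being positive, it is real. *)
have [-> _ Re0] := ge0_complex (ltW e0).
have {Re0} e0' : 0 < Re e by move: e0; rewrite ltcE => /andP[].
apply: filterS (h _ e0') => n; rewrite normc_distrC (ger0_norm (normc_ge0 _)).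
by move=> hn; rewrite -[X in (X < _)%R]/(`|l - u n : R[i]|) normc_normr ltcR.
Qed.

Lemma cvg_normc0_unique u l l' : (fun n => normc (u n - l)) @ \oo --> (0 : R) ->
  (fun n => normc (u n - l')) @ \oo --> (0 : R) -> l = l'.
Proof.
move=> ul ul'.
suff : normc (l - l') = 0 by move/ComplexField.Normc.eq0_normc/eqP; rewrite subr_eq0 => /eqP.
apply/eqP; rewrite eq_le normc_ge0 andbT.
have h : (fun n => normc (u n - l) + normc (u n - l')) @ \oo --> (0 : R).
  by rewrite -[0]addr0; exact: cvgD.
apply: (cvgr_to_ge h); apply: nearW => n.
rewrite (_ : l - l' = - (u n - l) + (u n - l')); last by rewrite opprB addrA subrK.
by rewrite -[X in _ <= X + _]normcN; exact: le_normcD.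
Qed.

Lemma cvg_Re u l : (fun n => normc (u n - l)) @ \oo --> (0 : R) ->
  (fun n => Re (u n)) @ \oo --> Re l.
Proof.
move=> ul; apply/subr_cvg0/norm_cvg0P; apply: squeeze_cvgr ul; last exact: cvg_cst.
by apply: nearW => n; rewrite normr_ge0 -ReN -ReD ler_normRe.
Qed.

Lemma cvg_Im u l : (fun n => normc (u n - l)) @ \oo --> (0 : R) ->
  (fun n => Im (u n)) @ \oo --> Im l.
Proof.
move=> ul; apply/subr_cvg0/norm_cvg0P; apply: squeeze_cvgr ul; last exact: cvg_cst.
by apply: nearW => n; rewrite normr_ge0 -ImN -ImD ler_normIm.
Qed.

Lemma cvg_normc u l : (fun n => normc (u n - l)) @ \oo --> (0 : R) ->
  (fun n => normc (u n)) @ \oo --> normc l.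
Proof.
move=> ul; apply/subr_cvg0/norm_cvg0P; apply: squeeze_cvgr ul; last exact: cvg_cst.
apply: nearW => n; rewrite normr_ge0 /= ler_norml lerNl opprB !lerBlDl.
apply/andP; split.
  by rewrite normc_distrC (le_trans _ (le_normcD _ _))// addrC subrK.
by rewrite (le_trans _ (le_normcD _ _))// addrC subrK.
Qed.

Lemma cvg_ReIm u l : (fun n => Re (u n)) @ \oo --> Re l ->
  (fun n => Im (u n)) @ \oo --> Im l ->
  (fun n => normc (u n - l)) @ \oo --> (0 : R).
Proof.
move=> ur ui.
have h : (fun n => `|Re (u n) - Re l| + `|Im (u n) - Im l|) @ \oo --> (0 : R).
  by rewrite -[0]addr0; apply: cvgD; apply/norm_cvg0P/subr_cvg0.
apply: squeeze_cvgr h; last exact: cvg_cst.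
apply: nearW => n; rewrite normc_ge0 /=.
by rewrite (le_trans (ler_normc_ReIm _))// ReD ImD ReN ImN.
Qed.

End complex_sequences.

(** * Inner product spaces *)

Section psd_form.
Context (R : realType) (V : lmodType R[i]).
Local Open Scope complex_scope.
Implicit Types (B : V -> V -> R[i]) (u v w : V) (a : R[i]).

(** Besides [inner], this covers the possibly degenerate form <T u, v> of a positive operator, to
    which Cauchy-Schwarz is applied as well. Hence definiteness is kept apart, as [ip_eq0];
    Hermitian symmetry follows from positivity. *)
Record psd_form B : Prop := PsdForm {
  form_linearl : forall a u v w, B (a *: u + v) w = a * B u w + B v w;
  form_linearr : forall a u v w, B w (a *: u + v) = a^*%C * B w u + B w v;
  form_ge0 : forall u, 0 <= B u u }.

Variable B : V -> V -> R[i].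
Hypothesis BP : psd_form B.

Lemma form0l w : B 0 w = 0.
Proof.
by have := form_linearl BP (-1) 0 0 w; rewrite scaler0 addr0 mulN1r addNr.
Qed.

Lemma form0r w : B w 0 = 0.
Proof.
have := form_linearr BP (-1) 0 0 w.
by rewrite scaler0 addr0 rmorphN1 mulN1r addNr.
Qed.

Lemma formDl u v w : B (u + v) w = B u w + B v w.
Proof. by have := form_linearl BP 1 u v w; rewrite scale1r mul1r. Qed.

Lemma formDr u v w : B w (u + v) = B w u + B w v.
Proof. by have := form_linearr BP 1 u v w; rewrite scale1r rmorph1 mul1r. Qed.

Lemma formZl a u w : B (a *: u) w = a * B u w.
Proof. by have := form_linearl BP a u 0 w; rewrite form0l !addr0. Qed.

Lemma formZr a u w : B w (a *: u) = a^*%C * B w u.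
Proof. by have := form_linearr BP a u 0 w; rewrite form0r !addr0. Qed.

Lemma formNl u w : B (- u) w = - B u w.
Proof. by rewrite -scaleN1r formZl mulN1r. Qed.

Lemma formNr u w : B w (- u) = - B w u.
Proof. by rewrite -scaleN1r formZr rmorphN1 mulN1r. Qed.

Lemma formBl u v w : B (u - v) w = B u w - B v w.
Proof. by rewrite formDl formNl. Qed.

Lemma formBr u v w : B w (u - v) = B w u - B w v.
Proof. by rewrite formDr formNr. Qed.

Lemma form_suml I (r : seq I) (P : pred I) (F : I -> V) w :
  B (\sum_(i <- r | P i) F i) w = \sum_(i <- r | P i) B (F i) w.
Proof. exact: (big_morph (B^~ w) (fun u v => formDl u v w) (form0l w)). Qed.

Lemma form_sumr I (r : seq I) (P : pred I) (F : I -> V) w :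
  B w (\sum_(i <- r | P i) F i) = \sum_(i <- r | P i) B w (F i).
Proof. exact: (big_morph (B w) (fun u v => formDr u v w) (form0r w)). Qed.

Lemma form_diag u : B u u = (Re (B u u))%:C.
Proof. by case/ge0_complex: (form_ge0 BP u). Qed.

Lemma Re_form_ge0 u : 0 <= Re (B u u).
Proof. by case/ge0_complex: (form_ge0 BP u). Qed.

(** Polarization: the values of the form at [u + v] and at ['i *: u + v] are real, which settles the
    imaginary and the real part, respectively. *)
Lemma formC u v : B v u = (B u v)^*%C.
Proof.
have Im0 w : Im (B w w) = 0 by case/ge0_complex: (form_ge0 BP w).
have := Im0 (u + v); rewrite formDl !formDr !ImD !Im0 addr0 add0r => h1.
have := Im0 ('i *: u + v).
rewrite formDl !formDr !formZl !formZr !ImD !ImM !ReM !Im0 /= => h2.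
by apply: eq_ReIm; rewrite ?ReJ ?ImJ; lra.
Qed.

(* The discriminant of [t |-> B (u - t (B u v) v) (u - t (B u v) v)]. *)
Lemma form_CauchySchwarz u v : normc (B u v) ^+ 2 <= Re (B u u) * Re (B v v).
Proof.
set m := normc (B u v) ^+ 2; set a := Re (B u u); set b := Re (B v v).
have m0 : 0 <= m by exact: sqr_ge0.
have h t : 0 <= a - 2 * t * m + t ^+ 2 * m * b.
  have := Re_form_ge0 ((- t)%:C * B u v *: v + u).
  rewrite formDl !formDr !formZl !formZr (formC u v) (form_diag u) (form_diag v).
  rewrite -/a -/b /m normc2E !(ReD, ReM, ImM, ReJ, ImJ)/=.
  set x := Re _; set y := Im _ => H; apply: le_trans H _.
  by rewrite le_eqVlt; apply/orP; left; apply/eqP; ring.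
have a0 : 0 <= a by exact: Re_form_ge0.
have b0 : 0 <= b by exact: Re_form_ge0.
have [b_gt0|b_le0] := ltP 0 b.
  have := h b^-1.
  rewrite (_ : _ - _ + _ = (a * b - m) / b); last by field; rewrite gt_eqF.
  by rewrite pmulr_lge0 ?invr_gt0// subr_ge0.
have b_eq0 : b = 0 by apply/eqP; rewrite eq_le b_le0.
rewrite b_eq0 mulr0 leNgt; apply/negP => m_gt0.
(* For [b = 0] the quadratic is affine in [t]; here it takes the value -1. *)
have := h ((a + 1) / m / 2); rewrite b_eq0 mulr0 addr0 => H.
have : a - 2 * ((a + 1) / m / 2) * m = -1 by field; rewrite gt_eqF.
by move=> E; move: H; rewrite E ler0N1.
Qed.

End psd_form.

Section inner_product.
Context (R : realType) (V : lmodType R[i]) (ip : V -> V -> R[i]).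
Local Open Scope complex_scope.
Implicit Types (u v w : V) (a : R[i]).

Definition ip_norm u := Num.sqrt (Re (ip u u)).

Hypothesis ipP : psd_form ip.
Hypothesis ip_eq0 : forall u, ip u u = 0 -> u = 0.

Local Notation "'N u" := (ip_norm u) (at level 10, u at level 8).

Lemma ip_norm_ge0 u : 0 <= 'N u. Proof. exact: sqrtr_ge0. Qed.
Hint Resolve ip_norm_ge0 : core.

Lemma ip_norm2 u : 'N u ^+ 2 = Re (ip u u).
Proof. by rewrite sqr_sqrtr// Re_form_ge0. Qed.

Lemma ip_normE u : ip u u = ('N u ^+ 2)%:C.
Proof. by rewrite ip_norm2 -form_diag. Qed.

Lemma ip_norm_eq0 u : 'N u = 0 -> u = 0.
Proof. by move=> u0; apply: ip_eq0; rewrite ip_normE u0 expr0n. Qed.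

Lemma ip_norm_gt0 u : u != 0 -> 0 < 'N u.
Proof.
by move=> u0; rewrite lt0r ip_norm_ge0 andbT; apply: contra_neq u0 => /ip_norm_eq0.
Qed.

Lemma ip_norm0 : 'N 0 = 0.
Proof. by rewrite /ip_norm (form0l ipP) sqrtr0. Qed.

Lemma ip_CauchySchwarz u v : normc (ip u v) <= 'N u * 'N v.
Proof.
rewrite -(@ler_pXn2r _ 2)// ?nnegrE ?normc_ge0 ?mulr_ge0// exprMn !ip_norm2.
exact: form_CauchySchwarz.
Qed.

Lemma ip_normZ a u : 'N (a *: u) = normc a * 'N u.
Proof.
apply/eqP; rewrite -(@eqrXn2 _ 2)// ?mulr_ge0 ?normc_ge0// exprMn !ip_norm2.
by rewrite (formZl ipP) (formZr ipP) mulrA mulJc ReM/= mul0r subr0.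
Qed.

Lemma ip_normN u : 'N (- u) = 'N u.
Proof. by rewrite /ip_norm (formNl ipP) (formNr ipP) opprK. Qed.

Lemma ip_norm_distrC u v : 'N (u - v) = 'N (v - u).
Proof. by rewrite -ip_normN opprB. Qed.

Lemma ip_norm_sqrD u v :
  'N (u + v) ^+ 2 = 'N u ^+ 2 + 2 * Re (ip u v) + 'N v ^+ 2.
Proof.
rewrite !ip_norm2 (formDl ipP) !(formDr ipP) (formC ipP u v) !ReD ReJ.
by rewrite mulr_natl mulr2n !addrA.
Qed.

Lemma ler_ip_normD u v : 'N (u + v) <= 'N u + 'N v.
Proof.
rewrite -(@ler_pXn2r _ 2)// ?nnegrE ?addr_ge0// ip_norm_sqrD sqrrD lerD2r lerD2l.
rewrite -[leRHS]mulr_natl ler_pM2l// (le_trans _ (ip_CauchySchwarz u v))//.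
exact: le_trans (ler_norm _) (ler_normRe _).
Qed.

Lemma ler_ip_normB u v : 'N (u - v) <= 'N u + 'N v.
Proof. by rewrite -(ip_normN v) ler_ip_normD. Qed.

Lemma ip_norm_pythagoras u v : ip u v = 0 -> 'N (u + v) ^+ 2 = 'N u ^+ 2 + 'N v ^+ 2.
Proof. by move=> uv; rewrite ip_norm_sqrD uv/= mulr0 addr0. Qed.

Lemma eq_ipP u v : (forall w, ip u w = ip v w) -> u = v.
Proof.
by move=> h; apply/eqP; rewrite -subr_eq0; apply/eqP/ip_eq0; rewrite (formBl ipP) h subrr.
Qed.

Lemma cvg_ipl (u_ : nat -> V) u w : (fun n => 'N (u_ n - u)) @ \oo --> (0 : R) ->
  (fun n => normc (ip (u_ n) w - ip u w)) @ \oo --> (0 : R).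
Proof.
move=> h.
have h' : (fun n => 'N (u_ n - u) * 'N w) @ \oo --> (0 : R).
  by rewrite -[0](mul0r ('N w)); apply: cvgM h _; exact: cvg_cst.
apply: squeeze_cvgr h'; last exact: cvg_cst.
by apply: nearW => n; rewrite normc_ge0 -(formBl ipP) ip_CauchySchwarz.
Qed.

Definition linear_map (T : V -> V) := forall a u v, T (a *: u + v) = a *: T u + T v.

Lemma linear_mapD T u v : linear_map T -> T (u + v) = T u + T v.
Proof. by move=> lT; have := lT 1 u v; rewrite !scale1r. Qed.

Lemma linear_map0 T : linear_map T -> T 0 = 0.
Proof. by move=> lT; have := lT (-1) 0 0; rewrite scaler0 addr0 scaleN1r addNr. Qed.

Lemma linear_mapZ T a u : linear_map T -> T (a *: u) = a *: T u.
Proof. by move=> lT; have := lT a u 0; rewrite (linear_map0 lT) !addr0. Qed.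

Lemma linear_mapB T u v : linear_map T -> T (u - v) = T u - T v.
Proof. by move=> lT; rewrite addrC -scaleN1r lT scaleN1r addrC. Qed.

Lemma linear_map_sum T I (r : seq I) (P : pred I) (F : I -> V) : linear_map T ->
  T (\sum_(i <- r | P i) F i) = \sum_(i <- r | P i) T (F i).
Proof.
move=> lT; exact: (big_morph T (fun u v => linear_mapD u v lT) (linear_map0 lT)).
Qed.

Lemma psd_form_op T : linear_map T -> (forall u, 0 <= ip (T u) u) ->
  psd_form (fun u v => ip (T u) v).
Proof.
move=> lT T0; split => // a u v w; first by rewrite lT (form_linearl ipP).
by rewrite (form_linearr ipP).
Qed.

End inner_product.

(** * Orthonormal systems, Riesz-Fischer and Gram-Schmidt *)

Section orthonormal_systems.
Context (R : realType) (V : lmodType R[i]) (ip : V -> V -> R[i]).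
Local Open Scope complex_scope.
Implicit Types (u v w : V) (a : R[i]) (e : nat -> V) (c : nat -> R[i]).

Hypothesis ipP : psd_form ip.
Hypothesis ip_eq0 : forall u, ip u u = 0 -> u = 0.

Local Notation "'N u" := (ip_norm ip u) (at level 10, u at level 8).

Definition orthonormal e := forall m n, ip (e m) (e n) = (m == n)%:R.

Definition ip_proj e n u := \sum_(k < n) ip u (e k) *: e k.

Lemma orthonormal_sumE e c N j : orthonormal e ->
  ip (\sum_(k < N) c k *: e k) (e j) = if (j < N)%N then c j else 0.
Proof.
move=> oe; rewrite (form_suml ipP).
under eq_bigr do rewrite (formZl ipP) oe.
case: ifPn => jN.
  rewrite (bigD1 (Ordinal jN))//= eqxx mulr1 big1 ?addr0// => k.
  by rewrite -val_eqE/= => /negbTE ->; rewrite mulr0.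
rewrite big1// => k _; rewrite (_ : (_ == _) = false) ?mulr0//.
by apply: contraNF jN => /eqP <-.
Qed.

Lemma ip_norm_orthonormal_sum e c N : orthonormal e ->
  'N (\sum_(k < N) c k *: e k) ^+ 2 = \sum_(k < N) normc (c k) ^+ 2.
Proof.
move=> oe; rewrite (ip_norm2 ipP) (form_sumr ipP) Re_sum; apply: eq_bigr => k _.
by rewrite (formZr ipP) orthonormal_sumE// ltn_ord mulrC mulJc.
Qed.

Lemma ip_norm_orthonormal_sumB e c m n : orthonormal e -> (m <= n)%N ->
  'N (\sum_(k < n) c k *: e k - \sum_(k < m) c k *: e k) ^+ 2 =
  \sum_(k < n) normc (c k) ^+ 2 - \sum_(k < m) normc (c k) ^+ 2.
Proof.
move=> oe mn; pose c' k := if (k < m)%N then 0 else c k.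
have -> : \sum_(k < n) c k *: e k - \sum_(k < m) c k *: e k = \sum_(k < n) c' k *: e k.
  apply/eqP; rewrite subr_eq; apply/eqP.
  rewrite (big_ord_widen n (fun k => c k *: e k) mn) [X in _ + X]big_mkcond -big_split/=.
  apply: eq_bigr => k _; rewrite /c'.
  by case: ifP; rewrite ?scale0r ?add0r ?addr0.
rewrite ip_norm_orthonormal_sum//; apply/eqP; rewrite eq_sym subr_eq; apply/eqP.
rewrite (big_ord_widen n (fun k => normc (c k) ^+ 2) mn) [X in _ + X]big_mkcond -big_split/=.
apply: eq_bigr => k _; rewrite /c'.
by case: ifP; rewrite ?ComplexField.Normc.normc0 ?expr0n/= ?add0r ?addr0.
Qed.

Lemma ip_norm_sub_proj e N u : orthonormal e ->
  'N (u - ip_proj e N u) ^+ 2 = 'N u ^+ 2 - \sum_(k < N) normc (ip u (e k)) ^+ 2.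
Proof.
move=> oe; apply/eqP; rewrite eq_sym subr_eq; apply/eqP.
rewrite -(ip_norm_orthonormal_sum (fun k => ip u (e k)) N oe) -/(ip_proj e N u).
rewrite -(ip_norm_pythagoras ipP) ?subrK//.
rewrite {2}/ip_proj (form_sumr ipP) big1// => k _.
rewrite (formZr ipP) (formBl ipP) (orthonormal_sumE (fun k => ip u (e k)))//.
by rewrite ltn_ord subrr mulr0.
Qed.

Lemma bessel e N u : orthonormal e ->
  \sum_(k < N) normc (ip u (e k)) ^+ 2 <= 'N u ^+ 2.
Proof. by move=> oe; rewrite -subr_ge0 -ip_norm_sub_proj// sqr_ge0. Qed.

Lemma ler_ip_norm_sub_proj e N u : orthonormal e -> 'N (u - ip_proj e N u) <= 'N u.
Proof.
move=> oe; rewrite -(@ler_pXn2r _ 2) ?nnegrE ?ip_norm_ge0// ip_norm_sub_proj//.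
by rewrite gerBl sumr_ge0// => k _; exact: sqr_ge0.
Qed.

Lemma ip_projC e N u v : ip (ip_proj e N u) v = ip u (ip_proj e N v).
Proof.
rewrite /ip_proj (form_suml ipP) (form_sumr ipP); apply: eq_bigr => k _.
by rewrite (formZl ipP) (formZr ipP) mulrC (formC ipP v).
Qed.

Definition orthonormal_basis e := orthonormal e /\
  forall u, (fun n => 'N (u - ip_proj e n u)) @ \oo --> (0 : R).

Lemma parseval e u : orthonormal_basis e ->
  (fun N => \sum_(k < N) normc (ip u (e k)) ^+ 2) @ \oo --> 'N u ^+ 2.
Proof.
move=> [oe he].
have h : (fun n => 'N (u - ip_proj e n u) * 'N (u - ip_proj e n u)) @ \oo --> (0 : R).
  by rewrite -[0](mulr0 0); apply: cvgM; exact: he.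
rewrite -[X in _ --> X]subr0.
apply: cvg_trans (cvgB (cvg_cst ('N u ^+ 2)) h); apply: near_eq_cvg; apply: nearW => n.
by rewrite /GRing.add/= /GRing.opp/= -expr2 ip_norm_sub_proj// subKr.
Qed.

Hypothesis ip_complete : forall u_ : nat -> V,
  (forall eps : R, 0 < eps -> exists N, forall m n,
    (N <= m)%N -> (N <= n)%N -> 'N (u_ m - u_ n) < eps) ->
  exists u, (fun n => 'N (u_ n - u)) @ \oo --> (0 : R).

(** The squared distance of two partial sums is a difference of partial sums of a bounded
    nondecreasing series, so they form a Cauchy sequence. All later uses of completeness pass
    through this lemma: bases from total systems, adjoints, weak limits. *)
Lemma riesz_fischer e c (M : R) : orthonormal e ->
  (forall N, \sum_(k < N) normc (c k) ^+ 2 <= M) ->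
  exists2 u, (fun n => 'N (\sum_(k < n) c k *: e k - u)) @ \oo --> (0 : R) &
    forall k, ip u (e k) = c k.
Proof.
move=> oe cM; pose s n := \sum_(k < n) c k *: e k.
pose S n := \sum_(k < n) normc (c k) ^+ 2.
have ndS : nondecreasing_seq S.
  apply/nondecreasing_seqP => n; rewrite /S big_ord_recr/= lerDl; exact: sqr_ge0.
have cS : cvgn S by apply: nondecreasing_is_cvgn => //; exists M => _ [n _ <-]; exact: cM.
have [|u su] := @ip_complete s.
  move=> eps eps0.
  have /cvgrPdist_lt /(_ (eps ^+ 2 / 2)) := cS.
  rewrite divr_gt0 ?exprn_gt0// => /(_ isT)[N _ HN]; exists N.
  have key m n : (N <= m)%N -> (m <= n)%N -> 'N (s n - s m) < eps.
    move=> Nm mn.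
    rewrite -(@ltr_pXn2r _ 2) ?nnegrE ?ip_norm_ge0 ?ltW// /s ip_norm_orthonormal_sumB//.
    rewrite -/(S n) -/(S m).
    have := HN m Nm; have := HN n (leq_trans Nm mn); rewrite /= !ltr_norml.
    by move=> /andP[? ?] /andP[? ?]; lra.
  move=> m n Nm Nn; have [mn|/ltnW nm] := leqP m n; last exact: key.
  by rewrite (ip_norm_distrC ipP); exact: key.
exists u => // k; apply: (@cvg_normc0_unique _ (fun n => ip (s n) (e k))).
  exact: cvg_ipl.
apply: (@cvg_near_cst _ _ (0:R)).
exists k.+1 => // n /= kn.
by rewrite orthonormal_sumE// kn subrr ComplexField.Normc.normc0.
Qed.

(** By Bessel and Riesz-Fischer the Fourier series of [u] converges to a vector with the same
    coefficients as [u]; totality identifies the two. *)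
Lemma total_orthonormal_basis e : orthonormal e ->
  (forall u, (forall k, ip u (e k) = 0) -> u = 0) -> orthonormal_basis e.
Proof.
move=> oe te; split=> // u.
have [v uv vE] := @riesz_fischer e (fun k => ip u (e k)) _ oe (fun N => bessel N u oe).
have -> : (fun n => 'N (u - ip_proj e n u)) = (fun n => 'N (ip_proj e n u - v)).
  apply/funext => n; rewrite (ip_norm_distrC ipP); congr ('N (_ - _)).
  apply/eqP; rewrite -subr_eq0; apply/eqP/te => k.
  by rewrite (formBl ipP) vE subrr.
exact: uv.
Qed.

Definition normalize u := ('N u)^-1%:C *: u.

(** Each vector depends on all the previous ones, so the recursion runs over the list of the vectors
    found so far. *)
Lemma gram_schmidt_rec (D : nat -> V) : exists g : nat -> V, forall n,
  g n = normalize (D n - \sum_(k < n) ip (D n) (g k) *: g k).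
Proof.
pose next (s : seq V) u :=
  normalize (u - \sum_(v <- s) ip u v *: v).
pose gs := fix gs n := if n is m.+1 then rcons (gs m) (next (gs m) (D m)) else [::].
pose g n := next (gs n) (D n).

have gsE n : gs n = mkseq g n.
  elim: n => // n IH; rewrite /= {1}IH /mkseq -[in RHS]addn1 iotaD map_cat/=.
  by rewrite cats1 add0n.
exists g => n.
rewrite {1}/g /next gsE /mkseq big_map -(big_mkord xpredT (fun k => ip (D n) (g k) *: g k)).
by rewrite /index_iota subn0.
Qed.

(* Vectors of [D] in the span of their predecessors yield zeros in the sequence
   [g]; these are then removed. *)
Lemma gram_schmidt (D b : nat -> V) : (forall u, (forall k, ip u (D k) = 0) -> u = 0) ->
  orthonormal b -> exists e, orthonormal_basis e.
Proof.
move=> tD ob; have [g gE'] := gram_schmidt_rec D.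
pose r n := D n - \sum_(k < n) ip (D n) (g k) *: g k.
have gE n : g n = ('N (r n))^-1%:C *: r n by exact: gE'.
have rE n : r n = ('N (r n))%:C *: g n.
  rewrite gE scalerA -rmorphM/=; have [r0|r0] := eqVneq ('N (r n)) 0.
    by rewrite r0 mul0r scale0r (ip_norm_eq0 ipP ip_eq0 r0).
  by rewrite divff// scale1r.
have gg n : g n != 0 -> ip (g n) (g n) = 1.
  rewrite gE scaler_eq0 negb_or => /andP[_ /(ip_norm_gt0 ipP ip_eq0) r0].
  rewrite (ip_normE ipP) (ip_normZ ipP) normc_real ger0_norm ?invr_ge0 ?ip_norm_ge0//.
  by rewrite mulVf ?expr1n// gt_eqF.
(* Induction on a bound [k] for the larger index; the other order of the two vectors is reached by
   conjugation. *)
have g_orth m n : m != n -> ip (g m) (g n) = 0.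
  suff h k : forall i j, (j < i <= k)%N -> ip (g i) (g j) = 0.
    case: ltngtP => // mn _; last by apply: (h m); rewrite mn leqnn.
    by rewrite (formC ipP) (h n) ?conjc0// mn leqnn.
  elim: k => [|k IH] i j /andP[ji]; first by rewrite leqn0 => /eqP i0; rewrite i0 in ji.
  rewrite leq_eqVlt => /predU1P[ik|ik]; last by apply: IH; rewrite ji.
  subst i.
  rewrite gE (formZl ipP); apply/eqP; rewrite mulf_eq0; apply/orP; right; apply/eqP.
  rewrite /r (formBl ipP) (form_suml ipP) (bigD1 (Ordinal ji))//=.
  rewrite (formZl ipP) big1 ?addr0 => [|i]; last first.
    rewrite -val_eqE/= (formZl ipP) => ij.
    suff -> : ip (g i) (g j) = 0 by rewrite mulr0.
    have ik := ltn_ord i; rewrite ltnS in ik.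
    case: ltngtP ij => // ij _; last by apply: IH; rewrite ij.
    by rewrite (formC ipP) IH ?conjc0// ij.
  have [->|gj] := eqVneq (g j) 0; first by rewrite !(form0r ipP) mulr0 subrr.
  by rewrite gg// mulr1 subrr.
have tg u : (forall k, ip u (g k) = 0) -> u = 0.
  move=> ug; apply: tD => k.
  have -> : D k = r k + \sum_(j < k) ip (D k) (g j) *: g j by rewrite subrK.
  rewrite rE (formDr ipP) (formZr ipP) ug mulr0 add0r (form_sumr ipP) big1// => j _.
  by rewrite (formZr ipP) ug mulr0.
have g1 k : Re (ip (g k) (g k)) <= 1.
  have [->|/gg -> //] := eqVneq (g k) 0; by rewrite (form0l ipP)/= ler01.
pose A := [set k | g k != 0].
(* If only the first [N] vectors [g k] could be nonzero, they would span the space. The sum of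
   |<g_k, b_j>|^2 over k < N and j <= N would then be N + 1, as each b_j is a unit vector, but at
   most N by Bessel's inequality for [b]. *)
have Ainf : infinite_set A.
  move=> /finite_seqP[F AF].
  pose N := (\max_(k <- F) k).+1.
  have gN k : (N <= k)%N -> g k = 0.
    move=> Nk; apply/eqP; apply: contraTT Nk => gk; rewrite -ltnNge /N ltnS.
    have : [set` F] k by rewrite -AF.
    by move=> /= kF; rewrite (big_rem k kF)/= leq_maxl.
  have uE u : u = \sum_(k < N) ip u (g k) *: g k.
    apply/eqP; rewrite -subr_eq0; apply/eqP/tg => k.
    have [Nk|kN] := leqP N k; first by rewrite gN// (form0r ipP).
    rewrite (formBl ipP) (form_suml ipP) (bigD1 (Ordinal kN))//= big1 ?addr0.
      rewrite (formZl ipP); have [->|gk] := eqVneq (g k) 0.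
        by rewrite !(form0r ipP) mulr0 subrr.
      by rewrite gg// mulr1 subrr.
    by move=> j; rewrite -val_eqE/= => jk; rewrite (formZl ipP) g_orth ?mulr0.
  have b1 j : \sum_(k < N) normc (ip (g k) (b j)) ^+ 2 = 1.
    have : Re (ip (b j) (b j)) = 1 by rewrite ob eqxx.
    rewrite {2}(uE (b j)) (form_sumr ipP) Re_sum => <-; apply: eq_bigr => k _.
    by rewrite (formZr ipP) mulrC mulJc/= (formC ipP) normc_conj.
  have : \sum_(j < N.+1) \sum_(k < N) normc (ip (g k) (b j)) ^+ 2 = N.+1%:R.
    by rewrite (eq_bigr (fun=> 1)) ?sumr_const ?card_ord// => j _; rewrite b1.
  rewrite exchange_big/= => H.
  have : \sum_(k < N) \sum_(j < N.+1) normc (ip (g k) (b j)) ^+ 2 <= \sum_(k < N) (1 : R).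
    apply: ler_sum => k _; apply: le_trans (bessel _ _ ob) _.
    by rewrite (ip_norm2 ipP).
  by rewrite H sumr_const card_ord ler_nat ltnn.
have /card_set_bijP[f [fA finj fsurj]] : ([set: nat] #= A)%card.
  by rewrite card_eq_sym; apply: eq_card_nat => //; exact: countableP.
exists (g \o f); apply: total_orthonormal_basis => [m n|u ug].
  have [->|mn] := eqVneq m n; first by rewrite /= gg//; exact: fA.
  by rewrite /= g_orth//; apply: contra_neq mn => /finj; apply; rewrite inE.
apply: tg => k; have [->|gk] := eqVneq (g k) 0; first by rewrite (form0r ipP).
by have [n _ <-] := fsurj k gk; exact: ug.
Qed.

End orthonormal_systems.

(** * Bounded operators and their adjoints *)

Section bounded_operators.
Context (R : realType) (V : lmodType R[i]) (ip : V -> V -> R[i]).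
Local Open Scope complex_scope.
Implicit Types (u v w : V) (a : R[i]) (e g : nat -> V) (T A : V -> V).

Hypothesis ipP : psd_form ip.
Hypothesis ip_eq0 : forall u, ip u u = 0 -> u = 0.

Local Notation "'N u" := (ip_norm ip u) (at level 10, u at level 8).
Local Notation orthonormal := (orthonormal ip).
Local Notation orthonormal_basis := (orthonormal_basis ip).
Local Notation proj := (ip_proj ip).
Let ip_norm_ge0 u : 0 <= 'N u. Proof. exact: ip_norm_ge0. Qed.
Hint Resolve ip_norm_ge0 : core.

Definition bounded_by T (M : R) := [/\ linear_map T, 0 <= M & forall u, 'N (T u) <= M * 'N u].

Lemma bounded_by_exists T : linear_map T ->
  (exists M, forall u, 'N (T u) <= M * 'N u) -> exists M, bounded_by T M.
Proof.
move=> lT [M TM]; exists `|M|; split=> // u.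
by rewrite (le_trans (TM u))// ler_wpM2r// ler_norm.
Qed.

Lemma cvg_bounded_by T M (u_ : nat -> V) u : bounded_by T M ->
  (fun n => 'N (u_ n - u)) @ \oo --> (0 : R) ->
  (fun n => 'N (T (u_ n) - T u)) @ \oo --> (0 : R).
Proof.
move=> [lT M0 TM] h.
have h' : (fun n => M * 'N (u_ n - u)) @ \oo --> (0 : R).
  by rewrite -[0](mulr0 M); apply: cvgM h; exact: cvg_cst.
apply: squeeze_cvgr h'; last exact: cvg_cst.
by apply: nearW => n; rewrite ip_norm_ge0 -linear_mapB// TM.
Qed.

Lemma cvg_ip (u_ v_ : nat -> V) u v : (fun n => 'N (u_ n - u)) @ \oo --> (0 : R) ->
  (fun n => 'N (v_ n - v)) @ \oo --> (0 : R) ->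
  (fun n => normc (ip (u_ n) (v_ n) - ip u v)) @ \oo --> (0 : R).
Proof.
move=> hu hv.
have h : (fun n => 'N (u_ n - u) * 'N (v_ n - v) + 'N (u_ n - u) * 'N v +
    'N u * 'N (v_ n - v)) @ \oo --> (0 : R).
  rewrite -[0]addr0; apply: cvgD; first rewrite -[0]addr0; first apply: cvgD.
  - by rewrite -[0](mulr0 0); apply: cvgM.
  - by rewrite -[0](mul0r ('N v)); apply: cvgM hu _; exact: cvg_cst.
  - by rewrite -[0](mulr0 ('N u)); apply: cvgM hv; exact: cvg_cst.
apply: squeeze_cvgr h; last exact: cvg_cst.
apply: nearW => n; rewrite normc_ge0/=.
have -> : ip (u_ n) (v_ n) - ip u v =
    ip (u_ n - u) (v_ n - v) + ip (u_ n - u) v + ip u (v_ n - v).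
  by rewrite !(formBl ipP) !(formBr ipP); ring.
by rewrite (le_trans (le_normcD _ _))// lerD ?ip_CauchySchwarz//
  (le_trans (le_normcD _ _))// lerD ?ip_CauchySchwarz.
Qed.

Lemma cvg_proj e u : orthonormal_basis e ->
  (fun n => 'N (proj e n u - u)) @ \oo --> (0 : R).
Proof.
move=> [_ /(_ u)]; apply: cvg_trans; apply: near_eq_cvg; apply: nearW => n.
by rewrite (ip_norm_distrC ipP).
Qed.

(* The summands are the coefficients of the adjoint of [T] at [v], whose existence
   follows from this bound. *)
Lemma ler_sum_adjoint_coef e T M v N : orthonormal e -> bounded_by T M ->
  \sum_(k < N) normc (ip v (T (e k))) ^+ 2 <= (M * 'N v) ^+ 2.
Proof.
move=> oe [lT M0 TM]; pose c k := ip v (T (e k)).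
(* Testing [T] on the combination of the [e k] with the coefficients to be bounded gives |w|^2 = <T
   w, v> <= M |w| |v|. *)
pose w := \sum_(k < N) c k *: e k.
have ww : ip (T w) v = ('N w ^+ 2)%:C.
  rewrite (ip_norm_orthonormal_sum ipP c N oe) linear_map_sum// (form_suml ipP) rmorph_sum.
  apply: eq_bigr => k _; rewrite /= linear_mapZ// (formZl ipP) -mulJc.
  by rewrite (formC ipP v).
rewrite -(ip_norm_orthonormal_sum ipP c N oe) -/w.
rewrite ler_pXn2r ?nnegrE ?mulr_ge0//.
have [w0|w0] := eqVneq ('N w) 0; first by rewrite w0 mulr_ge0.
have w_gt0 : 0 < 'N w by rewrite lt0r w0 ip_norm_ge0.
rewrite -(ler_pM2r w_gt0) -expr2.
have -> : 'N w ^+ 2 = normc (ip (T w) v) by rewrite ww normc_real ger0_norm ?sqr_ge0.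
rewrite (le_trans (ip_CauchySchwarz ipP _ _))// mulrAC ler_wpM2r//.
Qed.

(** The vector sought has the coefficients <v, T e_k>, which are square-summable by the preceding
    bound. The identity is exact when [u] and the series are both cut off at n, and passes to the
    limit. *)
Lemma adjoint_exists e T M : orthonormal_basis e -> bounded_by T M ->
  (forall u_ : nat -> V,
    (forall eps : R, 0 < eps -> exists N, forall m n,
      (N <= m)%N -> (N <= n)%N -> 'N (u_ m - u_ n) < eps) ->
    exists u, (fun n => 'N (u_ n - u)) @ \oo --> (0 : R)) ->
  forall v, exists w, forall u, ip (T u) v = ip u w.
Proof.
move=> be bT cpl v; have [oe he] := be.
have [w hw _] := riesz_fischer ipP cpl (c := fun k => ip v (T (e k))) oe
  (fun N => ler_sum_adjoint_coef v N oe bT).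
exists w => u.
apply: (@cvg_normc0_unique _ (fun n => ip (T (proj e n u)) v)).
  by apply: cvg_ipl => //; apply: (cvg_bounded_by bT); exact: cvg_proj.
have lT : linear_map T by case: bT.
have h := cvg_ip (cvg_proj u be) hw.
apply: cvg_trans h; apply: near_eq_cvg; apply: nearW => n; congr (normc (_ - _)).
rewrite {1}/ip_proj linear_map_sum// (form_suml ipP) (form_sumr ipP); apply: eq_bigr => k _.
rewrite linear_mapZ// (formZl ipP) (formZr ipP) (orthonormal_sumE ipP (fun k => ip u (e k)))//.
by rewrite ltn_ord mulrC (formC ipP v).
Qed.

End bounded_operators.

(** * Cholesky decomposition of positive operators *)

Section positive_operators.
Context (R : realType) (V : lmodType R[i]) (ip : V -> V -> R[i]).
Local Open Scope complex_scope.
Implicit Types (u v w : V) (a : R[i]) (e g : nat -> V) (T A : V -> V).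

Hypothesis ipP : psd_form ip.
Hypothesis ip_eq0 : forall u, ip u u = 0 -> u = 0.

Local Notation "'N u" := (ip_norm ip u) (at level 10, u at level 8).
Local Notation orthonormal := (orthonormal ip).
Local Notation orthonormal_basis := (orthonormal_basis ip).
Local Notation proj := (ip_proj ip).
Local Notation bounded_by := (bounded_by ip).
Let ip_norm_ge0 u : 0 <= 'N u. Proof. exact: ip_norm_ge0. Qed.
Hint Resolve ip_norm_ge0 : core.

Section cholesky.
Variables (T : V -> V) (M : R) (e : nat -> V).
Hypotheses (bT : bounded_by T M) (T_ge0 : forall u, 0 <= ip (T u) u).
Hypothesis be : orthonormal_basis e.

Let pivot A u := (Num.sqrt (Re (ip (A u) u)))^-1%:C *: A u.

(** The remainders of Gaussian elimination: with A the current remainder, a step subtracts g_n (x)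
    g_n for g_n = A e_n / sqrt <A e_n, e_n>, which makes the next remainder vanish at e_n. If the
    pivot <A e_n, e_n> is 0, then g_n = 0, because 0 is its own inverse, and the step changes
    nothing. *)
Fixpoint cholesky n : V -> V := if n is m.+1 then
  fun u => cholesky m u - ip u (pivot (cholesky m) (e m)) *: pivot (cholesky m) (e m)
  else T.

Definition cholesky_vec n := pivot (cholesky n) (e n).
Local Notation g := cholesky_vec.

Lemma choleskyS n u : cholesky n.+1 u = cholesky n u - ip u (g n) *: g n.
Proof. by []. Qed.

Lemma cholesky_sum n u : cholesky n u = T u - \sum_(k < n) ip u (g k) *: g k.
Proof.
elim: n => [|n IH]; first by rewrite big_ord0 subr0.
by rewrite choleskyS IH big_ord_recr/= opprD addrA.
Qed.

Lemma linear_cholesky n : linear_map (cholesky n).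
Proof.
have [lT _ _] := bT; elim: n => [//|n IH] a u v.
 rewrite !choleskyS IH (form_linearl ipP).
by rewrite scalerDl -scalerA scalerBr opprD addrACA.
Qed.

(** Positivity of the next remainder says that |<A u, e_n>|^2 / <A e_n, e_n> <= <A u, u>, which is
    Cauchy-Schwarz for the form of the current remainder A. *)
Lemma cholesky_step n : (forall u, 0 <= ip (cholesky n u) u) ->
  (forall u, 0 <= ip (cholesky n.+1 u) u) /\ cholesky n.+1 (e n) = 0.
Proof.
move=> pos.
pose B u v := ip (cholesky n u) v.
have BP : psd_form B by apply: psd_form_op => //; exact: linear_cholesky.
set b := Re (B (e n) (e n)).
have b0 : 0 <= b by exact: (Re_form_ge0 BP).
have gE : g n = (Num.sqrt b)^-1%:C *: cholesky n (e n) by [].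
have ugE u : ip u (g n) = (Num.sqrt b)^-1%:C * B u (e n).
  rewrite gE (formZr ipP) conjC_real; congr (_ * _).
  by rewrite (formC BP (e n)) (formC ipP (cholesky n (e n))).
have b2 : (Num.sqrt b)^-1 * (Num.sqrt b)^-1 = b^-1.
  by rewrite -invfM -expr2 sqr_sqrtr.
split=> [u|].
  rewrite choleskyS (formBl ipP) (formZl ipP) (formC ipP u (g n)) mulJc ugE.
  rewrite -/(B u u) (form_diag BP) -rmorphB/= ler0c ComplexField.Normc.normcM exprMn.
  rewrite normc_real real_normK ?num_real// expr2 b2 subr_ge0.
  have [->|b_neq0] := eqVneq b 0; first by rewrite invr0 mul0r Re_form_ge0.
  rewrite mulrC ler_pdivrMr ?lt0r ?b_neq0//; exact: form_CauchySchwarz.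
rewrite choleskyS ugE gE scalerA mulrAC -rmorphM/= b2 (form_diag BP) -/b -rmorphM/=.
have [b_eq0|b_neq0] := eqVneq b 0; last by rewrite mulVf// scale1r subrr.
rewrite b_eq0 mulr0 scale0r subr0; apply: ip_eq0.
(* With a zero pivot, pairing e_n with A e_n in the form of A shows that A e_n = 0, so e_n is
   already in the kernel. *)
have := form_CauchySchwarz BP (e n) (cholesky n (e n)).
rewrite -/b b_eq0 mul0r /B => h.
apply: ComplexField.Normc.eq0_normc; apply/eqP.
by rewrite -sqrf_eq0 eq_le h sqr_ge0.
Qed.

Lemma cholesky_ge0 n u : 0 <= ip (cholesky n u) u.
Proof. by elim: n u => // n IH u; case: (cholesky_step IH). Qed.

Lemma cholesky_form n : psd_form (fun u v => ip (cholesky n u) v).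
Proof. by apply: psd_form_op => //; [exact: linear_cholesky|exact: cholesky_ge0]. Qed.

(** Later steps keep [e k] in the kernel: [g n] lies in the range of a symmetric remainder, hence is
    orthogonal to its kernel. *)
Lemma cholesky_basis n k : (k < n)%N -> cholesky n (e k) = 0.
Proof.
elim: n => // n IH; rewrite ltnS leq_eqVlt => /predU1P[->|kn].
  by case: (cholesky_step (cholesky_ge0 n)).
rewrite choleskyS IH// sub0r.
have -> : ip (e k) (g n) = 0.
  rewrite (formZr ipP) (formC ipP (cholesky n (e n))) (formC (cholesky_form n) (e k) (e n)).
  by rewrite IH// (form0l ipP) !conjc0 mulr0.
by rewrite scale0r oppr0.
Qed.

Lemma cholesky_diagE n u : Re (ip (cholesky n u) u) =
  Re (ip (T u) u) - \sum_(k < n) normc (ip u (g k)) ^+ 2.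
Proof.
rewrite cholesky_sum (formBl ipP) ReD ReN (form_suml ipP) Re_sum; congr (_ - _).
by apply: eq_bigr => k _; rewrite (formZl ipP) (formC ipP u) mulJc.
Qed.

(** The n-th remainder kills e_0, ..., e_(n-1), so its form at [u] equals its form at the tail
    [u - proj e n u]. There it is dominated by the form of [T], which is bounded. *)
Lemma cvg_cholesky u : (fun n => Re (ip (cholesky n u) u)) @ \oo --> (0 : R).
Proof.
case: (bT) => lT M0 TM.
have h : (fun n => M * ('N (u - proj e n u) * 'N (u - proj e n u))) @ \oo --> (0 : R).
  rewrite -[0](mulr0 M) -[X in M * X](mulr0 0).
  by apply: cvgM; [exact: cvg_cst|apply: cvgM; exact: be.2].
apply: squeeze_cvgr h; last exact: cvg_cst.
apply: nearW => n; rewrite (Re_form_ge0 (cholesky_form n))/=.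
set r := u - proj e n u.
have P0 : cholesky n (proj e n u) = 0.
  rewrite /ip_proj (linear_map_sum _ _ _ (linear_cholesky n)) big1// => k _.
  by rewrite (linear_mapZ _ _ (linear_cholesky n)) cholesky_basis// scaler0.
have Cr : cholesky n u = cholesky n r.
  by rewrite /r (linear_mapB _ _ (linear_cholesky n)) P0 subr0.
have -> : ip (cholesky n u) u = ip (cholesky n r) r.
  rewrite {2}/r (formBr ipP) -Cr (formC (cholesky_form n) (proj e n u) u).
  by rewrite P0 (form0l ipP) conjc0 subr0.
rewrite cholesky_diagE (le_trans (y := Re (ip (T r) r)))//.
  by rewrite gerBl sumr_ge0// => k _; exact: sqr_ge0.
rewrite (le_trans (ler_norm _))// (le_trans (ler_normRe _))//.
by rewrite (le_trans (ip_CauchySchwarz ipP _ _))// mulrA ler_wpM2r.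
Qed.

(** The error is the form of the n-th remainder at [u] and [v]; Cauchy-Schwarz reduces it to the
    diagonal. *)
Lemma cholesky_expansion u v :
  (fun n => normc (\sum_(k < n) ip u (g k) * ip (g k) v - ip (T u) v)) @ \oo --> (0 : R).
Proof.
have h : (fun n => Num.sqrt (Re (ip (cholesky n u) u) * Re (ip (cholesky n v) v)))
    @ \oo --> (0 : R).
  rewrite -[X in _ --> X]sqrtr0; apply: continuous_cvg; first exact: sqrt_continuous.
  by rewrite -[0](mulr0 0); apply: cvgM; exact: cvg_cholesky.
apply: squeeze_cvgr h; last exact: cvg_cst.
apply: nearW => n; rewrite normc_ge0/= normc_distrC.
have -> : ip (T u) v - \sum_(k < n) ip u (g k) * ip (g k) v = ip (cholesky n u) v.
  rewrite cholesky_sum (formBl ipP) (form_suml ipP); congr (_ - _).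
  by apply: eq_bigr => k _; rewrite [RHS](formZl ipP).
rewrite -[leLHS]ger0_norm ?normc_ge0// -sqrtr_sqr ler_wsqrtr//.
exact: (form_CauchySchwarz (cholesky_form n)).
Qed.

(** By Parseval, the left side is the limit of double sums of |<g_k, e_m>|^2. For fixed m the sum
    over k is at most <T e_m, e_m>, since the remainder is positive at e_m; summing over m gives the
    trace. *)
Lemma cholesky_vec_summable (t : R) N :
  (fun n => \sum_(k < n) Re (ip (T (e k)) (e k))) @ \oo --> t ->
  \sum_(k < N) 'N (g k) ^+ 2 <= t.
Proof.
move=> ht; pose F n := \sum_(k < N) \sum_(m < n) normc (ip (g k) (e m)) ^+ 2.
have hF : F @ \oo --> \sum_(k < N) 'N (g k) ^+ 2.
  by apply: cvg_big => [|k _]; [exact: add_continuous|exact: parseval].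
apply: ler_cvg_to hF ht _; apply: nearW => n; rewrite /F exchange_big/=.
apply: ler_sum => m _; rewrite -subr_ge0.
under eq_bigr do rewrite (formC ipP) normc_conj.
by rewrite -cholesky_diagE; exact: (Re_form_ge0 (cholesky_form N)).
Qed.

End cholesky.

(* Cholesky decomposition along an orthonormal basis replaces the spectral theorem. *)
Lemma positive_op_decomposition T M e (t : R) : bounded_by T M ->
  (forall u, 0 <= ip (T u) u) -> orthonormal_basis e ->
  (fun n => \sum_(k < n) Re (ip (T (e k)) (e k))) @ \oo --> t ->
  exists2 g : nat -> V, forall N, \sum_(k < N) 'N (g k) ^+ 2 <= t &
    forall u v, (fun n => normc (\sum_(k < n) ip u (g k) * ip (g k) v - ip (T u) v))
      @ \oo --> (0 : R).
Proof.
move=> bT T0 be ht; exists (cholesky_vec T e) => [N|u v].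
  exact: (cholesky_vec_summable bT T0 be N ht).
exact: (cholesky_expansion bT T0 be u v).
Qed.

End positive_operators.

(** * Calculus of complex limits and series *)

Section complex_limits.
Context (R : realType).
Local Open Scope complex_scope.
Implicit Types (u v : nat -> R[i]) (l m : R[i]).
Local Notation cvg u l := ((fun n => normc (u n - l)) @ \oo --> (0 : R)).

Lemma cvg_normcD u v l m : cvg u l -> cvg v m -> cvg (fun n => u n + v n) (l + m).
Proof.
move=> ul vm; apply: cvg_ReIm.
  by under eq_fun do rewrite ReD; rewrite ReD; apply: cvgD; exact: cvg_Re.
by under eq_fun do rewrite ImD; rewrite ImD; apply: cvgD; exact: cvg_Im.
Qed.

Lemma cvg_normcB u v l m : cvg u l -> cvg v m -> cvg (fun n => u n - v n) (l - m).
Proof.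
move=> ul vm; apply: cvg_normcD => //.
by under eq_fun do rewrite -opprD normcN.
Qed.

Lemma cvg_normcM u v l m : cvg u l -> cvg v m -> cvg (fun n => u n * v n) (l * m).
Proof.
move=> ul vm; apply: cvg_ReIm.
  under eq_fun do rewrite ReM; rewrite ReM.
  by apply: cvgB; apply: cvgM; by [exact: cvg_Re|exact: cvg_Im].
under eq_fun do rewrite ImM; rewrite ImM.
by apply: cvgD; apply: cvgM; by [exact: cvg_Re|exact: cvg_Im].
Qed.

Lemma cvg_normcJ u l : cvg u l -> cvg (fun n => (u n)^*%C) l^*%C.
Proof.
apply: cvg_trans; apply: near_eq_cvg; apply: nearW => n /=.
by rewrite -rmorphB normc_conj.
Qed.

Lemma cvg_normc_cst l : cvg (fun=> l) l.
Proof. by under eq_fun do rewrite subrr ComplexField.Normc.normc0; exact: cvg_cst. Qed.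

Lemma cvg_normc_sum (I : Type) (r : seq I) (P : pred I) (F : I -> nat -> R[i]) (L : I -> R[i]) :
  (forall i, P i -> cvg (F i) (L i)) ->
  cvg (fun n => \sum_(i <- r | P i) F i n) (\sum_(i <- r | P i) L i).
Proof.
move=> FL; elim: r => [|i r IH].
  rewrite big_nil; under eq_fun do rewrite big_nil.
  exact: cvg_normc_cst.
rewrite big_cons; under eq_fun do rewrite big_cons.
by case: ifPn => // Pi; apply: cvg_normcD => //; exact: FL.
Qed.

Lemma cvg_homo_ltn (k : nat -> nat) : {homo k : m n / (m < n)%N} -> k @ \oo --> \oo.
Proof.
move=> kh; have le_k n : (n <= k n)%N.
  by elim: n => // n IH; exact: leq_ltn_trans IH (kh _ _ (ltnSn n)).
by move=> A [N _ NA]; exists N => // n /= Nn; apply: NA; exact: leq_trans (le_k n).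
Qed.

Lemma nonneg_series_cvg (b : nat -> R) B : (forall k, 0 <= b k) ->
  (forall n, \sum_(k < n) b k <= B) -> cvgn (series b).
Proof.
move=> b0 bB; apply: nondecreasing_is_cvgn.
  by apply/nondecreasing_seqP => n; rewrite /series/= big_nat_recr//= lerDl.
by exists B => _ [n _ <-]; rewrite /series/= big_mkord.
Qed.

Lemma complex_series_cvg (c : nat -> R[i]) (b : nat -> R) B :
  (forall k, normc (c k) <= b k) -> (forall n, \sum_(k < n) b k <= B) ->
  exists s, cvg (fun n => \sum_(k < n) c k) s.
Proof.
move=> cb bB.
have b0 k : 0 <= b k by exact: le_trans (normc_ge0 _) (cb k).
have cvb := nonneg_series_cvg b0 bB.
have h (p : R[i] -> R) : (forall x, `|p x| <= normc x) -> cvgn (series (fun k => p (c k))).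
  move=> pc; apply: normed_cvg; apply: (series_le_cvg _ b0 _ cvb) => k.
    exact: normr_ge0.
  exact: le_trans (pc _) (cb k).
have hr := h _ (@ler_normRe _); have hi := h _ (@ler_normIm _).
exists (limn (series (fun k => Re (c k))) +i* limn (series (fun k => Im (c k)))).
apply: cvg_ReIm.
  apply: cvg_trans hr; apply: near_eq_cvg; apply: nearW => n.
  by rewrite /series/= big_mkord Re_sum.
apply: cvg_trans hi; apply: near_eq_cvg; apply: nearW => n.
by rewrite /series/= big_mkord (big_morph _ (@ImD R) erefl).
Qed.

End complex_limits.

(** * Traces of products with a decomposed operator *)

Section trace_formula.
Context (R : realType) (V : lmodType R[i]) (ip : V -> V -> R[i]).
Local Open Scope complex_scope.
Implicit Types (u v w : V) (a : R[i]).
Local Notation cvg u l := ((fun n => normc (u n - l)) @ \oo --> (0 : R)).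

Hypothesis ipP : psd_form ip.
Hypothesis ip_eq0 : forall u, ip u u = 0 -> u = 0.

Local Notation "'N u" := (ip_norm ip u) (at level 10, u at level 8).
Local Notation proj := (ip_proj ip).
Let ip_norm_ge0 u : 0 <= 'N u. Proof. exact: ip_norm_ge0. Qed.
Hint Resolve ip_norm_ge0 : core.

Variables (T A : V -> V) (g : nat -> V) (t M : R).
Hypothesis g_t : forall N, \sum_(k < N) 'N (g k) ^+ 2 <= t.
Hypothesis Tg : forall u v, cvg (fun n => \sum_(k < n) ip u (g k) * ip (g k) v) (ip (T u) v).
Hypothesis bA : bounded_by ip A M.

Let ler_ipA u v : normc (ip (A u) v) <= M * ('N u * 'N v).
Proof.
have [_ _ AM] := bA.
by rewrite (le_trans (ip_CauchySchwarz ipP _ _))// mulrA ler_wpM2r.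
Qed.

Lemma trace_series_cvg : exists s, cvg (fun n => \sum_(k < n) ip (A (g k)) (g k)) s.
Proof.
have [_ M0 _] := bA.
apply: (@complex_series_cvg R (fun k => ip (A (g k)) (g k))
  (fun k => M * 'N (g k) ^+ 2) (M * t)) => [k|n].
  by rewrite expr2 ler_ipA.
by rewrite -mulr_sumr ler_wpM2l.
Qed.

(** Expanding [T] in the partial trace over j < m and summing over j first gives the series of <A
    P_m g_k, g_k>, where P_m is [proj e m]. Its distance to the series of <A g_k, g_k> is at most M
    times the sum of |P_m g_k - g_k| |g_k|: the terms with k < K vanish as m grows, and the others
    are at most |g_k|^2, uniformly in m. *)
Lemma trace_formula s e : cvg (fun n => \sum_(k < n) ip (A (g k)) (g k)) s ->
  orthonormal_basis ip e -> cvg (fun m => \sum_(j < m) ip (T (A (e j))) (e j)) s.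
Proof.
move=> hs be; have [oe _] := be; have [lA M0 AM] := bA.
pose a m k := ip (A (proj e m (g k))) (g k).
have tr m : cvg (fun n => \sum_(k < n) a m k) (\sum_(j < m) ip (T (A (e j))) (e j)).
  have h := cvg_normc_sum (index_enum 'I_m) (P := xpredT)
    (fun j _ => Tg (A (e j)) (e j)).
  apply: cvg_trans h; apply: near_eq_cvg; apply: nearW => n /=.
  rewrite exchange_big/=; congr (normc (_ - _)); apply: eq_bigr => k _.
  rewrite /a /ip_proj linear_map_sum// (form_suml ipP); apply: eq_bigr => j _.
  by rewrite linear_mapZ// (formZl ipP) mulrC.
pose b k := 'N (g k) ^+ 2.
have b0 k : 0 <= b k by exact: sqr_ge0.
have cb := nonneg_series_cvg b0 g_t.
apply/cvgr0Pnorm_lt => eps eps0.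
(* Head and tail contribute at most [M * d] each; adding 1 keeps the denominator positive for
   [M = 0]. *)
pose d := eps / (2 * M + 1) / 2.
have d0 : 0 < d by rewrite !divr_gt0// ltr_pwDr// mulr_ge0.
have [K HK] : exists K, forall n, (K <= n)%N -> \sum_(K <= k < n) b k <= d.
  have /cvgrPdist_lt /(_ (d / 2)) := cb; rewrite divr_gt0// => /(_ isT)[K _ HK].
  exists K => n Kn.
  have <- : series b n - series b K = \sum_(K <= k < n) b k by rewrite sub_series_geq.
  have := HK K (leqnn K); have := HK n Kn; rewrite /= !ltr_norml.
  by move=> /andP[? ?] /andP[? ?]; lra.
have hsum : (fun m => \sum_(k < K) 'N (proj e m (g k) - g k) * 'N (g k)) @ \oo --> (0 : R).
  rewrite -[X in _ --> X](_ : \sum_(k < K) (0 : R) = _); last by rewrite big1.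
  apply: cvg_big => [|k _]; first exact: add_continuous.
  rewrite -[0](mul0r ('N (g k))); apply: cvgM; last exact: cvg_cst.
  exact: cvg_proj.
have /cvgr0Pnorm_lt /(_ d d0) := hsum; apply: filterS => m hm.
rewrite ger0_norm ?normc_ge0//.
apply: (@le_lt_trans _ _ (M * (d + d))); last first.
  have M1 : 0 < 2 * M + 1 by rewrite ltr_pwDr// mulr_ge0.
  rewrite (_ : M * (d + d) = eps * (M / (2 * M + 1))); last by rewrite /d; field; rewrite gt_eqF.
  by rewrite gtr_pMr// ltr_pdivrMr// mul1r; lra.
have hdiff := cvg_normc (cvg_normcB (tr m) hs).
apply: (cvgr_to_le hdiff); exists K => // n /= Kn.
rewrite -sumrB (le_trans (ler_normc_sum _ _ _))//.
apply: (@le_trans _ _ (\sum_(k < n) M * ('N (proj e m (g k) - g k) * 'N (g k)))).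
  by apply: ler_sum => k _; rewrite /a -(formBl ipP) -linear_mapB.
rewrite -mulr_sumr ler_wpM2l//.
rewrite -(big_mkord xpredT (fun k => 'N (proj e m (g k) - g k) * 'N (g k))).
rewrite (big_cat_nat (leq0n K) Kn)/= lerD//.
  rewrite big_mkord; apply: ltW; apply: le_lt_trans hm; exact: ler_norm.
apply: le_trans (HK n Kn); apply: ler_sum => k _.
rewrite /b expr2 ler_wpM2r// (ip_norm_distrC ipP).
exact: ler_ip_norm_sub_proj.
Qed.

End trace_formula.

(** * Weak compactness and compact operators *)

Section compact_operators.
Context (R : realType) (V : lmodType R[i]) (ip : V -> V -> R[i]).
Local Open Scope complex_scope.
Implicit Types (u v w : V) (a : R[i]).
Local Notation cvg u l := ((fun n => normc (u n - l)) @ \oo --> (0 : R)).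

Hypothesis ipP : psd_form ip.
Hypothesis ip_eq0 : forall u, ip u u = 0 -> u = 0.

Local Notation "'N u" := (ip_norm ip u) (at level 10, u at level 8).
Local Notation proj := (ip_proj ip).
Let ip_norm_ge0 u : 0 <= 'N u. Proof. exact: ip_norm_ge0. Qed.
Hint Resolve ip_norm_ge0 : core.

Variable (e : nat -> V).
Hypothesis be : orthonormal_basis ip e.

Hypothesis ip_complete : forall u_ : nat -> V,
  (forall eps : R, 0 < eps -> exists N, forall m n,
    (N <= m)%N -> (N <= n)%N -> 'N (u_ m - u_ n) < eps) ->
  exists u, (fun n => 'N (u_ n - u)) @ \oo --> (0 : R).

Definition weak_cvg (f_ : nat -> V) f := forall v, cvg (fun n => ip (f_ n) v) (ip f v).

(** |f|^2 is the limit of <f_n, f>, whose modulus is at most |f|. *)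
Lemma weak_cvg_norm_le1 f_ f : (forall n, 'N (f_ n) <= 1) -> weak_cvg f_ f -> 'N f <= 1.
Proof.
move=> f1 wf; have [f0|f0] := leP ('N f) 0; first exact: le_trans f0 _.
rewrite -(ler_pM2r f0) -expr2 mul1r.
have -> : 'N f ^+ 2 = normc (ip f f).
  by rewrite (ip_normE ipP) normc_real ger0_norm// sqr_ge0.
apply: (cvgr_to_le (cvg_normc (wf f))); apply: nearW => n.
by rewrite (le_trans (ip_CauchySchwarz ipP _ _))// ler_piMl.
Qed.

(** Replacing [v] by a projection costs at most (1 + |f|) |v - P_N v|, uniformly in n, and leaves a
    finite sum of coefficients. *)
Lemma weak_cvg_basis f_ f : (forall n, 'N (f_ n) <= 1) ->
  (forall k, cvg (fun n => ip (f_ n) (e k)) (ip f (e k))) -> weak_cvg f_ f.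
Proof.
move=> f1 fe v; have [oe he] := be.
apply/cvgr0Pnorm_lt => eps eps0.
have d0 : 0 < eps / 2 / (1 + 'N f) by rewrite !divr_gt0// ltr_pwDl.
have /cvgr0Pnorm_lt /(_ _ d0)[N _ HN] := he v.
have {HN} := HN N (leqnn N); rewrite ger0_norm// => HN.
have h : cvg (fun n => ip (f_ n) (proj e N v)) (ip f (proj e N v)).
  rewrite /ip_proj (form_sumr ipP); under eq_fun do rewrite (form_sumr ipP).
  apply: cvg_normc_sum => k _; rewrite (formZr ipP); under eq_fun do rewrite (formZr ipP).
  by apply: cvg_normcM => //; exact: cvg_normc_cst.
have e2 : 0 < eps / 2 by rewrite divr_gt0.
have /cvgr0Pnorm_lt /(_ _ e2) := h; apply: filterS => n.
rewrite !ger0_norm ?normc_ge0// => hn.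
have -> : ip (f_ n) v - ip f v = (ip (f_ n) (proj e N v) - ip f (proj e N v)) +
    ip (f_ n - f) (v - proj e N v).
  by rewrite (formBl ipP) !(formBr ipP); ring.
rewrite (le_lt_trans (le_normcD _ _))// [ltRHS]splitr ltr_leD//.
rewrite (le_trans (ip_CauchySchwarz ipP _ _))//.
apply: (@le_trans _ _ ((1 + 'N f) * (eps / 2 / (1 + 'N f)))).
  apply: ler_pM => //; last exact: ltW.
  by rewrite (le_trans (ler_ip_normB ipP _ _))// lerD2r.
by rewrite mulrC divfK// gt_eqF// ltr_pwDl.
Qed.

(** The real and imaginary parts of the coefficients <f_n, e_k> lie in a product of intervals, which
    is compact by Tychonoff. This yields a cluster point [c] rather than a subsequence; the latter
    is extracted by asking at stage j for an index beyond the previous one at which the first j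
    coefficients are within 1/(j+1) of [c]. *)
Lemma weak_compactness (f_ : nat -> V) : (forall n, 'N (f_ n) <= 1) ->
  exists2 k : nat -> nat, {homo k : m n / (m < n)%N} &
    exists f, weak_cvg (f_ \o k) f.
Proof.
move=> f1; have [oe he] := be.
pose part (b : bool) (z : R[i]) := if b then Re z else Im z.
have part_le b z : `|part b z| <= normc z by case: b; [exact: ler_normRe|exact: ler_normIm].
pose x n : prod_topology (fun=> R : topologicalType) :=
  fun i : nat * bool => part i.2 (ip (f_ n) (e i.1)).
have bound n k : normc (ip (f_ n) (e k)) <= 1.
  rewrite (le_trans (ip_CauchySchwarz ipP _ _))//.
  have -> : 'N (e k) = 1 by rewrite /ip_norm oe eqxx sqrtr1.
  by rewrite mulr1.
have cK := @tychonoff (nat * bool)%type (fun=> R : topologicalType) (fun=> `[-1, 1]%classic)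
  (fun=> @segment_compact R (-1) 1).
have PF : ProperFilter (x @ \oo) by exact: fmap_proper_filter.
have [|c [_ cl]] := cK _ PF.
  exists 0%N => // n _ i /=; rewrite in_itv/= -ler_norml.
  exact: le_trans (part_le _ _) (bound _ _).
have ext j m0 : exists n, (m0 < n)%N /\ forall k b, (k < j)%N ->
    `|x n (k, b) - c (k, b)| < j.+1%:R^-1.
  pose B := [set y : prod_topology (fun=> R : topologicalType) |
    forall k b, (k < j)%N -> `|y (k, b) - c (k, b)| < j.+1%:R^-1].
  have nB : nbhs c B.
    have nB1 k b : nbhs c [set y : prod_topology (fun=> R : topologicalType) |
        `|y (k, b) - c (k, b)| < j.+1%:R^-1].
      have nr : nbhs (c (k, b) : R) [set r : R | `|r - c (k, b)| < j.+1%:R^-1].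
        apply/nbhs_ballP; exists j.+1%:R^-1; first by rewrite /= invr_gt0 ltr0n.
        by move=> r /=; rewrite /ball/= distrC.
      exact: (@proj_continuous _ (fun=> R : topologicalType) (k, b) c _ nr).
    have FF := @nbhs_filter (prod_topology (fun=> R : topologicalType)) c.
    have := filter_forall FF (fun i : 'I_j * bool => nB1 (nat_of_ord i.1) i.2).
    apply: (@filterS _ _ FF) => y hy k b kj; exact: (hy (Ordinal kj, b)).
  have nA : (x @ \oo) (x @` [set n | (m0 < n)%N]).
    by exists m0.+1 => // n /= mn; exists n.
  by have [y [[n /= mn <-] By]] := cl _ _ nA nB; exists n.
have /choice[phi hphi] : forall p : nat * nat, exists n, (p.2 < n)%N /\
    forall k b, (k < p.1)%N -> `|x n (k, b) - c (k, b)| < p.1.+1%:R^-1.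
  by case=> j m0; exact: ext.
pose s := fix s n := if n is m.+1 then phi (m.+1, s m) else phi (0%N, 0%N).
have sS n : (s n < s n.+1)%N by have [] := hphi (n.+1, s n).
have sx n k b : (k < n)%N -> `|x (s n) (k, b) - c (k, b)| < n.+1%:R^-1.
  by case: n => // n kn; have [_ /(_ k b)] := hphi (n.+1, s n); exact.
have cvx k b : (fun n => x (s n) (k, b)) @ \oo --> c (k, b).
  apply/subr_cvg0/norm_cvg0P; apply: squeeze_cvgr (@cvg_harmonic R); last exact: cvg_cst.
  exists k.+1 => // n /= kn; rewrite normr_ge0/= ltW//; exact: sx.
pose C k := c (k, true) +i* c (k, false).
have cvC k : cvg (fun n => ip (f_ (s n)) (e k)) (C k).
  by apply: cvg_ReIm; [exact: (cvx k true)|exact: (cvx k false)].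
(* Bessel's inequality for the [f_ (s n)] survives in the limit, so that the [C k] are the
   coefficients of a vector. *)
have C1 N : \sum_(k < N) normc (C k) ^+ 2 <= 1.
  have h : (fun n => \sum_(k < N) (normc (ip (f_ (s n)) (e k)) * normc (ip (f_ (s n)) (e k))))
      @ \oo --> \sum_(k < N) (normc (C k) * normc (C k)).
    apply: cvg_big => [|k _]; first exact: add_continuous.
    by apply: cvgM; exact: cvg_normc.
  apply: (cvgr_to_le h); apply: nearW => n.
  by rewrite (le_trans (bessel ipP N (f_ (s n)) oe))// exprn_ile1.
have [f hf fE] := riesz_fischer ipP ip_complete (c := C) oe C1.
exists s; first exact: (homo_ltn ltn_trans sS).
exists f; apply: weak_cvg_basis => [n|k]; first exact: f1.
by rewrite fE; exact: cvC.
Qed.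

Definition seq_compact (T : V -> V) := forall u_ : nat -> V,
  (exists M : R, forall n, 'N (u_ n) <= M) ->
  exists2 k : nat -> nat, {homo k : m n / (m < n)%N} &
    exists v, (fun n => 'N (T (u_ (k n)) - v)) @ \oo --> (0 : R).

Variables (T : V -> V) (M : R).
Hypotheses (bT : bounded_by ip T M) (cT : seq_compact T).

(** Otherwise unit vectors w_N exist with |T v_N| > eps for v_N = w_N - P_N w_N. Compactness gives a
    subsequence along which T v_N converges in norm to some z. With the adjoint vector z' of z, <T
    v_N, z> = <w_N, z' - P_N z'> tends to 0, so z = 0, a contradiction. *)
Lemma compact_proj_approx eps : 0 < eps ->
  exists N, forall u, 'N (T (u - proj e N u)) <= eps * 'N u.
Proof.
move=> eps0; apply: contrapT => /forallNP H.
have [oe he] := be; have [lT M0 TM] := bT.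
have /choice[u_ hu] : forall N, exists u, eps * 'N u < 'N (T (u - proj e N u)).
  by move=> N; have /existsNP[u /negP] := H N; rewrite -ltNge => hu; exists u.
have u0 N : 0 < 'N (u_ N).
  rewrite lt0r ip_norm_ge0 andbT; apply/negP => /eqP uN0.
  have := hu N; rewrite (ip_norm_eq0 ipP ip_eq0 uN0) /ip_proj.
  rewrite big1 => [|k _]; last by rewrite (form0l ipP) scale0r.
  by rewrite subrr linear_map0// (ip_norm0 ipP) mulr0 ltxx.
pose w_ N := ('N (u_ N))^-1%:C *: u_ N.
have w1 N : 'N (w_ N) = 1.
  rewrite (ip_normZ ipP) normc_real ger0_norm ?invr_ge0// mulVf// gt_eqF//.
pose v_ N := w_ N - proj e N (w_ N).
have vE N : v_ N = ('N (u_ N))^-1%:C *: (u_ N - proj e N (u_ N)).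
  rewrite /v_ scalerBr; congr (_ - _); rewrite /ip_proj scaler_sumr; apply: eq_bigr => k _.
  by rewrite /w_ (formZl ipP) scalerA.
have Tv N : eps < 'N (T (v_ N)).
  rewrite vE linear_mapZ// (ip_normZ ipP) normc_real ger0_norm ?invr_ge0//.
  by rewrite mulrC ltr_pdivlMr.
have [|k kh [z hz]]  := @cT v_.
  by exists 1 => N; rewrite /v_ (le_trans (ler_ip_norm_sub_proj ipP _ _ _))// w1.
have z0 : z = 0.
  apply: ip_eq0.
  have [z' hz'] := adjoint_exists ipP be bT ip_complete z.
  apply: (@cvg_normc0_unique _ (fun n => ip (T (v_ (k n))) z)).
    exact: cvg_ipl.
  have h : (fun n => 'N (z' - proj e (k n) z')) @ \oo --> (0 : R).
    exact: (cvg_comp _ _ (cvg_homo_ltn kh) (he z')).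
  apply: squeeze_cvgr h; last exact: cvg_cst.
  apply: nearW => n; rewrite normc_ge0/= subr0 hz' /v_ (formBl ipP) (ip_projC ipP) -(formBr ipP).
  by rewrite (le_trans (ip_CauchySchwarz ipP _ _))// w1 mul1r.
have : eps <= 0.
  move: hz; rewrite z0 => hz; apply: (cvgr_to_ge hz); apply: nearW => n.
  by rewrite subr0 ltW.
by rewrite leNgt eps0.
Qed.

(** With [T] replaced by T P_N, the form is a finite sum of products <f_n, e_k> <T e_k, f_n>, to
    which weak convergence applies; the two replacements cost eps / 3 each. *)
Lemma compact_form_cvg f_ f : (forall n, 'N (f_ n) <= 1) -> weak_cvg f_ f ->
  cvg (fun n => ip (T (f_ n)) (f_ n)) (ip (T f) f).
Proof.
move=> f1 wf; have [lT M0 TM] := bT.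
have f1' := weak_cvg_norm_le1 f1 wf.
apply/cvgr0Pnorm_lt => eps eps0.
have d0 : 0 < eps / 3 by rewrite divr_gt0.
have [N HN] := compact_proj_approx d0.
have h : cvg (fun n => ip (T (proj e N (f_ n))) (f_ n)) (ip (T (proj e N f)) f).
  rewrite /ip_proj linear_map_sum// (form_suml ipP).
  under eq_fun do rewrite linear_map_sum// (form_suml ipP).
  apply: cvg_normc_sum => k _; rewrite linear_mapZ// (formZl ipP) (formC ipP f).
  under eq_fun do rewrite linear_mapZ// (formZl ipP) (formC ipP (f_ _)).
  by apply: cvg_normcM; [exact: wf|apply: cvg_normcJ; exact: wf].
have small u : 'N u <= 1 -> normc (ip (T (u - proj e N u)) u) <= eps / 3.
  move=> u1; rewrite (le_trans (ip_CauchySchwarz ipP _ _))//.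
  rewrite (le_trans (ler_pM _ _ (HN u) u1))// mulr1 ler_piMr// ltW//.
have /cvgr0Pnorm_lt /(_ _ d0) := h; apply: filterS => n.
rewrite !ger0_norm ?normc_ge0// => hn.
have -> : ip (T (f_ n)) (f_ n) - ip (T f) f = ip (T (f_ n - proj e N (f_ n))) (f_ n) +
    (ip (T (proj e N (f_ n))) (f_ n) - ip (T (proj e N f)) f) -
    ip (T (f - proj e N f)) f.
  by rewrite !(linear_mapB _ _ lT) !(formBl ipP); ring.
rewrite (le_lt_trans (le_normcD _ _))// normcN.
have := small f f1'; have := small _ (f1 n).
have := le_normcD (ip (T (f_ n - proj e N (f_ n))) (f_ n))
  (ip (T (proj e N (f_ n))) (f_ n) - ip (T (proj e N f)) f).
by move=> *; lra.
Qed.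

End compact_operators.

(** * The Hilbert space L^2(R^d) *)

Section L2_inner_product.
Context (R : realType) (d : nat).
Local Open Scope complex_scope.
Local Open Scope quotient_scope.
Local Notation C := R[i].
Local Notation Rd := (d.-tuple R).
Local Notation leb := (lebesgue_tuple R d).
Implicit Types (f g h : sqfun R d) (u v w : L2 R d) (F G : Rd -> C).

Definition cintegrable F :=
  leb.-integrable setT (EFin \o (fun y => Re (F y))) /\
  leb.-integrable setT (EFin \o (fun y => Im (F y))).

Lemma cintegralD F G : cintegrable F -> cintegrable G ->
  cintegral (fun y => F y + G y) = cintegral F + cintegral G.
Proof.
move=> [Fr Fi] [Gr Gi]; apply: eq_ReIm => /=.
  by rewrite -RintegralD//; apply: eq_Rintegral => y _; rewrite ReD.
by rewrite -RintegralD//; apply: eq_Rintegral => y _; rewrite ImD.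
Qed.

Lemma integrable_mull (a : R) (p : Rd -> R) : leb.-integrable setT (EFin \o p) ->
  leb.-integrable setT (EFin \o (fun y => a * p y)).
Proof. by move=> ip; apply: eq_integrable (integrableZl measurableT a ip). Qed.

Lemma cintegrableZ (a : C) F : cintegrable F -> cintegrable (fun y => a * F y).
Proof.
move=> [Fr Fi]; split.
  apply: (@eq_integrable _ _ _ _ _ measurableT _ _ _
    (integrableB measurableT (integrable_mull (Re a) Fr) (integrable_mull (Im a) Fi))).
  by move=> y _; rewrite /= ReM.
apply: (@eq_integrable _ _ _ _ _ measurableT _ _ _
  (integrableD measurableT (integrable_mull (Re a) Fi) (integrable_mull (Im a) Fr))).
by move=> y _; rewrite /= ImM.
Qed.

Lemma cintegralZ (a : C) F : cintegrable F ->
  cintegral (fun y => a * F y) = a * cintegral F.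
Proof.
move=> [Fr Fi]; apply: eq_ReIm; rewrite ?ReM ?ImM/=; rewrite -!RintegralZl//.
  rewrite -RintegralB//; first by apply: eq_Rintegral => y _; rewrite ReM.
    exact: integrable_mull.
  exact: integrable_mull.
rewrite -RintegralD//; first by apply: eq_Rintegral => y _; rewrite ImM.
  exact: integrable_mull.
exact: integrable_mull.
Qed.

Lemma cintegralJ F : cintegrable F -> cintegral (fun y => (F y)^*%C) = (cintegral F)^*%C.
Proof.
move=> [Fr Fi]; apply: eq_ReIm; rewrite ?ReJ ?ImJ/=.
  by apply: eq_Rintegral => y _; rewrite ReJ.
rewrite -[RHS]mulN1r -RintegralZl//; apply: eq_Rintegral => y _.
by rewrite ImJ mulN1r.
Qed.

Lemma sqfun_measurable f : cmeasurable f.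
Proof. by case/sqintP: (sqfunP f). Qed.

Lemma sqfun_integrable f : leb.-integrable setT (EFin \o (fun y => normc (f y) ^+ 2)).
Proof.
have /sqintP[mf fi] := sqfunP f; apply/integrableP; split.
  exact: (measurable_EFinP _ _).2 (cmeasurable_normc2 mf).
by under eq_integral do rewrite /= ger0_norm ?sqr_ge0//.
Qed.

Lemma sqfun_mul_integrable f g : cintegrable (fun y => f y * (g y)^*%C).
Proof.
have [mr mi] := cmeasurableM (sqfun_measurable f) (cmeasurable_conj (sqfun_measurable g)).
have h (p : C -> R) : measurable_fun setT (fun y => p (f y * (g y)^*%C)) ->
    (forall x, `|p x| <= normc x) ->
    leb.-integrable setT (EFin \o (fun y => p (f y * (g y)^*%C))).
  move=> mp pc.
  apply: (le_integrable measurableT _ _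
    (integrableD measurableT (sqfun_integrable f) (sqfun_integrable g))) => /=.
    exact/measurable_EFinP.
  move=> y _; rewrite /= lee_fin [leRHS]ger0_norm ?addr_ge0 ?sqr_ge0//.
  rewrite (le_trans (pc _))// ComplexField.Normc.normcM normc_conj.
  set a := normc _; set b := normc _.
  have a0 : 0 <= a by exact: normc_ge0.
  have b0 : 0 <= b by exact: normc_ge0.
  by have := sqr_ge0 (a - b); have := mulr_ge0 a0 b0; rewrite sqrrB; lra.
by split; apply: h => // x; [exact: ler_normRe|exact: ler_normIm].
Qed.

(** Any representatives may be used, in particular the explicit ones of shifted or reflected
    functions. *)
Lemma inner_pi f g :
  inner (\pi_(L2 R d) f) (\pi_(L2 R d) g) = cintegral (fun y => f y * (g y)^*%C).
Proof.
have cm f' g' : cmeasurable (fun y => f' y * (g' y)^*%C) := cmeasurableM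
  (sqfun_measurable f') (cmeasurable_conj (sqfun_measurable g')).
apply: eq_cintegral_ae; [exact: cm|exact: cm|].
by apply: filterS2 (L2_reprP f) (L2_reprP g) => y -> ->.
Qed.

Lemma pi_L2_linear (a : C) f g :
  a *: \pi_(L2 R d) f + \pi_(L2 R d) g = \pi_(L2 R d) (a *: f + g) :> L2 R d.
Proof. by rewrite -pi_L2_add -pi_L2_scale. Qed.

Lemma innerC u v : inner v u = (inner u v)^*%C.
Proof.
rewrite -cintegralJ; last exact: sqfun_mul_integrable.
rewrite /inner; congr cintegral; apply/funext => y.
by rewrite rmorphM/= conjcK mulrC.
Qed.

Lemma inner_linearl (a : C) u v w : inner (a *: u + v) w = a * inner u w + inner v w.
Proof.
rewrite -[u]reprK -[v]reprK -[w]reprK pi_L2_linear !inner_pi.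
rewrite -cintegralZ; last exact: sqfun_mul_integrable.
rewrite -cintegralD; [|exact/cintegrableZ/sqfun_mul_integrable|exact: sqfun_mul_integrable].
by congr cintegral; apply/funext => y; rewrite mulrA -mulrDl.
Qed.

Lemma inner_selfE u : inner u u = (\int[leb]_y (normc (repr u y) ^+ 2))%:C.
Proof.
apply: eq_ReIm => /=; first by apply: eq_Rintegral => y _; rewrite mulJc.
by under eq_Rintegral do rewrite mulJc/=; rewrite /Rintegral integral0.
Qed.

Lemma inner_form : psd_form (@inner R d).
Proof.
split; first exact: inner_linearl.
  move=> a u v w; rewrite (innerC (a *: u + v)) (innerC u) (innerC v) inner_linearl.
  by rewrite rmorphD rmorphM.
move=> u; rewrite inner_selfE ler0c; apply: Rintegral_ge0 => y _; exact: sqr_ge0.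
Qed.

Lemma norm2E u : norm2 u = ip_norm (@inner R d) u.
Proof. by rewrite /norm2 /ip_norm inner_selfE. Qed.

Lemma norm2_pi_sqr f :
  (norm2 (\pi_(L2 R d) f) ^+ 2)%:E = (\int[leb]_y (normc (f y) ^+ 2)%:E)%E.
Proof.
have fin : (\int[leb]_y (normc (f y) ^+ 2)%:E)%E \is a fin_num.
  by apply: integrable_fin_num => //; exact: sqfun_integrable.
rewrite norm2E (ip_norm2 inner_form) inner_pi/=.
rewrite -[RHS]fineK//; congr (fine _)%:E; apply: eq_integral => y _.
by rewrite mulJc.
Qed.

Lemma inner_eq0 u : inner u u = 0 -> u = 0.
Proof.
rewrite -[u]reprK; move: (repr u) => f f0.
have := norm2_pi_sqr f; rewrite norm2E (ip_norm2 inner_form) f0/= => /esym I0.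
apply/eqP/L2_eqP.
have mf : measurable_fun setT (EFin \o (fun y => normc (f y) ^+ 2)).
  exact: measurable_int (sqfun_integrable f).
have /(ae_eq_integral_abs leb measurableT mf) :
    (\int[leb]_y `|(EFin \o (fun y => normc (f y) ^+ 2)%R) y|)%E = 0%E.
  under eq_integral do rewrite /= ger0_norm ?sqr_ge0//; exact: I0.
apply: filterS => y /(_ I)/= [] /eqP; rewrite sqrf_eq0 => /eqP fy0.
exact: ComplexField.Normc.eq0_normc.
Qed.

End L2_inner_product.
Arguments inner_form {R d}.

(** * Completeness of L^2 *)

Section L2_completeness.
Context (R : realType) (d : nat).
Local Open Scope complex_scope.
Local Open Scope quotient_scope.
Local Notation C := R[i].
Local Notation Rd := (d.-tuple R).
Local Notation leb := (lebesgue_tuple R d).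
Local Notation "'N u" := (ip_norm (@inner R d) u) (at level 10, u at level 8).
Implicit Types (f g h : sqfun R d) (u v w : L2 R d) (F G : Rd -> C).

Lemma sum_expr_le2 (q : R) n : 0 <= q <= 2^-1 -> \sum_(k < n) q ^+ k <= 2.
Proof.
move=> /andP[q0 q2]; suff : \sum_(k < n) q ^+ k <= 2 - 2 * q ^+ n.
  by move=> /le_trans; apply; rewrite gerBl mulr_ge0// exprn_ge0.
elim: n => [|n IH]; first by rewrite big_ord0 expr0 mulr1 subrr.
rewrite big_ord_recr/= exprS.
have : q * q ^+ n <= 2^-1 * q ^+ n by rewrite ler_wpM2r// exprn_ge0.
by move: IH; set x := q ^+ n; set s := \sum_(_ < _) _; lra.
Qed.

Lemma norm_pi_sub_sqr f g : (('N (\pi_(L2 R d) f - \pi_(L2 R d) g) ^+ 2)%:E =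
  \int[leb]_y (normc (f y - g y) ^+ 2)%:E)%E.
Proof.
have -> : \pi_(L2 R d) f - \pi_(L2 R d) g = \pi_(L2 R d) (f - g) :> L2 R d.
  by rewrite -[LHS]/(L2_add _ (L2_opp _)) pi_L2_opp pi_L2_add.
by rewrite -norm2E norm2_pi_sqr.
Qed.

Lemma measurable_normc_sub2 F G : cmeasurable F -> cmeasurable G ->
  measurable_fun setT (fun y => (normc (F y - G y) ^+ 2)%:E).
Proof.
move=> [Fr Fi] [Gr Gi]; apply/measurable_EFinP.
apply: (@cmeasurable_normc2 R d (fun y => F y - G y : R[i]^o)); split.
  by under eq_fun do rewrite ReD ReN; exact: measurable_funB.
by under eq_fun do rewrite ImD ImN; exact: measurable_funB.
Qed.

(** The sum [G] of the 4^k |f_(k+1) - f_k|^2 has integral at most the sum of the 4^-k, hence is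
    finite almost everywhere. Where it is finite, with value B, the increments are at most sqrt(B)
    2^-k and the sequence converges. The weight 4^k leaves a geometric factor on both sides. *)
Lemma ae_cvg_of_fast_cauchy (f : nat -> sqfun R d) :
  (forall k, \int[leb]_y (normc (f k.+1 y - f k y) ^+ 2)%:E <= (16^-1 ^+ k)%:E)%E ->
  exists E, [/\ measurable E, {ae leb, forall y, E y} &
    forall y, E y -> exists l : C, (fun n => normc (f n y - l)) @ \oo --> (0 : R)].
Proof.
move=> fast.
pose t k y : \bar R := (4 ^+ k * normc (f k.+1 y - f k y) ^+ 2)%:E.
have t0 k y : (0 <= t k y)%E by rewrite lee_fin mulr_ge0 ?sqr_ge0 ?exprn_ge0 ?ler0n.
have mt k : measurable_fun setT (t k).
  apply/measurable_EFinP; apply: measurable_funM => //; apply/measurable_EFinP.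
  by apply: measurable_normc_sub2; exact: sqfun_measurable.
pose G y := (\sum_(0 <= k <oo) t k y)%E.
have mG : measurable_fun setT G.
  apply: (@emeasurable_fun_cvg _ _ _ _ (fun n y => (\sum_(0 <= k < n) t k y)%E)) => [n|y _].
    exact: emeasurable_sum.
  by apply: is_cvg_nneseries => k _ _; exact: t0.
have G0 y : (0 <= G y)%E by apply: nneseries_ge0 => k _ _; exact: t0.
have IG : (\int[leb]_y G y < +oo)%E.
  rewrite /G integral_nneseries//.
  apply: (@le_lt_trans _ _ 2%:E); last exact: ltry.
  apply: lime_le; first by apply: is_cvg_nneseries => k _ _; exact: integral_ge0.
  apply: nearW => n; rewrite big_mkord.
  apply: (@le_trans _ _ (\sum_(k < n) ((4^-1 : R) ^+ k)%:E)%E); last first.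
    by rewrite sumEFin lee_fin; apply: sum_expr_le2; lra.
  apply: lee_sum => k _; rewrite /t; under eq_integral do rewrite EFinM.
  have mq : measurable_fun setT (fun y => (normc (f k.+1 y - f k y) ^+ 2)%:E).
    by apply: measurable_normc_sub2; exact: sqfun_measurable.
  have q0 y : setT y -> (0 <= (normc (f k.+1 y - f k y) ^+ 2)%:E)%E.
    by move=> _; rewrite lee_fin sqr_ge0.
  rewrite (ge0_integralZl_EFin leb measurableT q0 mq) ?exprn_ge0//.
  apply: (@le_trans _ _ ((4 ^+ k)%:E * (16^-1 ^+ k)%:E)%E).
    by rewrite lee_wpmul2l// lee_fin exprn_ge0.
  rewrite -EFinM lee_fin -exprMn (_ : 4 * 16^-1 = 4^-1)//; by field.
exists [set y | (G y < +oo)%E]; split.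
- rewrite -[X in measurable X]setTI; exact: emeasurable_fun_infty_o.
- have iG : leb.-integrable setT G.
    by apply/integrableP; split=> //; under eq_integral do rewrite gee0_abs//.
  apply: filterS (integrable_ae measurableT iG) => y /(_ I) /=.
  by rewrite fin_numElt => /andP[].
move=> y /= Gy; have Gfin : G y \is a fin_num by rewrite ge0_fin_numE.
pose B := fine (G y).
have B0 : 0 <= B by exact: fine_ge0.
have tB k : 4 ^+ k * normc (f k.+1 y - f k y) ^+ 2 <= B.
  rewrite -lee_fin -[leLHS]/(t k y) fineK//.
  apply: (@le_trans _ _ (\sum_(0 <= j < k.+1) t j y)%E).
    by rewrite big_nat_recr//= leeDr// sume_ge0.
  by apply: nneseries_lim_ge => j _ _.
have cb k : normc (f k.+1 y - f k y) <= Num.sqrt B * 2^-1 ^+ k.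
  rewrite -(@ler_pXn2r _ 2)// ?nnegrE ?normc_ge0 ?mulr_ge0 ?sqrtr_ge0 ?exprn_ge0 ?invr_ge0//.
  rewrite exprMn sqr_sqrtr// -exprM mulnC exprM.
  rewrite (_ : 2^-1 ^+ 2 = 4^-1 :> R); last by field.
  by rewrite exprVn ler_pdivlMr ?exprn_gt0// mulrC.
have [|s hs] := complex_series_cvg cb (B := Num.sqrt B * 2).
  by move=> n; rewrite -mulr_sumr ler_wpM2l ?sqrtr_ge0// sum_expr_le2//; lra.
exists (f 0%N y + s); apply: cvg_trans hs; apply: near_eq_cvg; apply: nearW => n /=.
congr (normc _); rewrite opprD addrA; congr (_ - _).
rewrite -(big_mkord xpredT (fun k => f k.+1 y - f k y)).
by rewrite (telescope_sumr (fun k => f k y))//.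
Qed.

(** Setting the functions to 0 off the set of convergence gives a limit at every point, hence a
    Borel measurable one. Fatou's lemma carries the Cauchy bounds over to it. *)
Lemma L2_fast_cauchy_cvg (f : nat -> sqfun R d) :
  (forall j k, (k <= j)%N ->
    \int[leb]_y (normc (f j y - f k y) ^+ 2)%:E <= (16^-1 ^+ k)%:E)%E ->
  exists g, forall k, (\int[leb]_y (normc (g y - f k y) ^+ 2)%:E <= (16^-1 ^+ k)%:E)%E.
Proof.
move=> fast; have [E [mE aeE cvE]] := ae_cvg_of_fast_cauchy (fun k => fast k.+1 k (leqnSn k)).
pose h k y : C := (\1_E y)%:C * f k y.
have hE k y : E y -> h k y = f k y.
  by move=> Ey; rewrite /h indicE mem_set// mul1r.
have hNE k y : ~ E y -> h k y = 0.
  by move=> Ey; rewrite /h indicE memNset// mul0r.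
have mh k : cmeasurable (h k).
  apply: (@cmeasurableM _ _ (fun y => (\1_E y)%:C)); last exact: sqfun_measurable.
  by split => //=; exact: measurable_indic.
have /choice[L hL] : forall y, exists l : C, (fun n => normc (h n y - l)) @ \oo --> (0 : R).
  move=> y; have [Ey|NEy] := pselect (E y).
    have [l hl] := cvE y Ey; exists l.
    by under eq_fun do rewrite hE//.
  exists 0; under eq_fun do rewrite hNE// subr0 ComplexField.Normc.normc0.
  exact: cvg_cst.
have mL : cmeasurable (L : Rd -> C^o).
  split.
    apply: (@measurable_fun_cvg _ _ _ _ (fun n y => Re (h n y))) => [m|y _].
      exact: (mh m).1.
    exact: cvg_Re.
  apply: (@measurable_fun_cvg _ _ _ _ (fun n y => Im (h n y))) => [m|y _].
    exact: (mh m).2.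
  exact: cvg_Im.
have bound k : (\int[leb]_y (normc (L y - h k y) ^+ 2)%:E <= (16^-1 ^+ k)%:E)%E.
  pose q j y := (normc (h (j + k)%N y - h k y) ^+ 2)%:E.
  have lq y : limn_einf (q^~ y) = (normc (L y - h k y) ^+ 2)%:E.
    apply: (cvg_limn_einf_sup _).1.
    apply: cvg_EFin; first exact: nearW.
    have hs : (fun j => normc (h (j + k)%N y - L y)) @ \oo --> (0 : R).
      by rewrite (cvg_shiftn k (fun j => normc (h j y - L y))); exact: hL.
    have := cvg_normc (cvg_normcB hs (cvg_normc_cst (h k y))).
    by move=> H; rewrite expr2; apply: cvg_trans (cvgM H H); apply: near_eq_cvg; apply: nearW.
  under eq_integral do rewrite -lq.
  apply: le_trans (fatou leb measurableT _ _) _.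
  - by move=> n; apply: measurable_normc_sub2.
  - by move=> n y _; rewrite lee_fin sqr_ge0.
  rewrite limn_einf_lim; apply: lime_le; first exact: is_cvg_einfs.
  apply: nearW => n; apply: (@le_trans _ _ (\int[leb]_y q n y)%E).
    by apply: ereal_inf_lbound; exists n => //=.
  apply: le_trans (fast (n + k)%N k (leq_addl _ _)).
  apply: ge0_le_integral => //.
  - by move=> y _; rewrite lee_fin sqr_ge0.
  - exact: measurable_normc_sub2.
  - by apply: measurable_normc_sub2; exact: sqfun_measurable.
  move=> y _; rewrite lee_fin; have [Ey|NEy] := pselect (E y); first by rewrite !hE.
  by rewrite !hNE// subrr ComplexField.Normc.normc0 expr0n/= sqr_ge0.
have h0_sq : (h 0%N : Rd -> C^o) \in @sqint R d.
  apply/sqintP; split => //; apply: le_lt_trans (integrableP _ _ _ (sqfun_integrable (f 0%N))).2.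
  apply: ge0_le_integral => //.
  - by move=> y _; rewrite lee_fin sqr_ge0.
  - exact: (measurable_EFinP _ _).2 (cmeasurable_normc2 (mh 0%N)).
  - by apply: measurableT_comp => //; exact: (measurable_int _ (sqfun_integrable (f 0%N))).
  move=> y _; rewrite /= lee_fin ger0_norm ?sqr_ge0//.
  have [Ey|NEy] := pselect (E y); first by rewrite !hE.
  by rewrite !hNE// ComplexField.Normc.normc0 expr0n/= sqr_ge0.
(* [L] is square integrable as the sum of [L - h 0], by the bound for [k = 0], and [h 0]. *)
have Lh_sq : (L - h 0%N : Rd -> C^o) \in @sqint R d.
  apply/sqintP; split.
    split.
      rewrite (_ : (fun y => _) = (fun y => Re (L y) - Re (h 0%N y))); last first.
        by apply/funext => y; rewrite -ReN -ReD.
      by apply: measurable_funB; [exact: mL.1|exact: (mh 0%N).1].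
    rewrite (_ : (fun y => _) = (fun y => Im (L y) - Im (h 0%N y))); last first.
      by apply/funext => y; rewrite -ImN -ImD.
    by apply: measurable_funB; [exact: mL.2|exact: (mh 0%N).2].
  by apply: le_lt_trans (bound 0%N) _; exact: ltry.
have L_sq : (L : Rd -> C^o) \in @sqint R d.
  have -> : (L : Rd -> C^o) = (L - h 0%N : Rd -> C^o) + h 0%N.
    by apply/funext => y; exact: esym (subrK (h 0%N y) (L y)).
  exact: rpredD.
exists (SqFun L_sq) => k; apply: le_trans (bound k).
rewrite le_eqVlt; apply/orP; left; apply/eqP; apply: ge0_ae_eq_integral => //.
- by apply: measurable_normc_sub2; exact: sqfun_measurable.
- exact: measurable_normc_sub2.
- by move=> y _; rewrite lee_fin sqr_ge0.
- by move=> y _; rewrite lee_fin sqr_ge0.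
by apply: filterS aeE => y Ey _ /=; rewrite hE.
Qed.

Lemma L2_complete (u_ : nat -> L2 R d) :
  (forall eps : R, 0 < eps -> exists N, forall m n,
    (N <= m)%N -> (N <= n)%N -> 'N (u_ m - u_ n) < eps) ->
  exists u, (fun n => 'N (u_ n - u)) @ \oo --> (0 : R).
Proof.
move=> cauchy.
have q0 k : 0 < (4^-1 : R) ^+ k by rewrite exprn_gt0// invr_gt0.
have /choice[N hN] : forall k, exists N, forall m n,
    (N <= m)%N -> (N <= n)%N -> 'N (u_ m - u_ n) < 4^-1 ^+ k.
  by move=> k; exact: cauchy.
(* The sum ensures [N k <= n j] for all [k <= j]; [n] need not be strictly increasing. *)
pose n k := (\sum_(j < k.+1) N j)%N.
have Nn j k : (k <= j)%N -> (N k <= n j)%N.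
  by move=> kj; rewrite /n (bigD1 (Ordinal (kj : (k < j.+1)%N)))//= leq_addr.
have sq k (x : R) : 0 <= x -> x <= 4^-1 ^+ k -> x ^+ 2 <= 16^-1 ^+ k.
  move=> x0 xk; rewrite (_ : 16^-1 = 4^-1 ^+ 2 :> R); last by field.
  by rewrite -exprM mulnC exprM lerXn2r ?nnegrE// ltW.
have [|g hg] := @L2_fast_cauchy_cvg (fun k => repr (u_ (n k))).
  move=> j k kj; rewrite -norm_pi_sub_sqr !reprK lee_fin sq ?ip_norm_ge0// ltW//.
  by apply: hN; exact: Nn.
exists (\pi_(L2 R d) g).
have close k : 'N (\pi_(L2 R d) g - u_ (n k)) <= 4^-1 ^+ k.
  have := hg k; rewrite -norm_pi_sub_sqr reprK lee_fin.
  rewrite (_ : 16^-1 = 4^-1 ^+ 2 :> R); last by field.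
  by rewrite -exprM mulnC exprM ler_pXn2r// ?nnegrE ?ip_norm_ge0// ltW.
apply/cvgr0Pnorm_lt => eps eps0.
have [k hk] : exists k, (4^-1 : R) ^+ k < eps / 2.
  have : (fun k => (4^-1 : R) ^+ k) @ \oo --> (0 : R).
    by apply: cvg_expr; rewrite ger0_norm ?invr_ge0// invf_lt1// ltr1n.
  move=> /cvgr0Pnorm_lt /(_ (eps / 2)); rewrite divr_gt0// => /(_ isT)[k _ Hk].
  by exists k; have := Hk k (leqnn k); rewrite ger0_norm// ltW.
exists (N k) => // m /= Nm; rewrite ger0_norm ?ip_norm_ge0//.
have -> : u_ m - \pi_(L2 R d) g = (u_ m - u_ (n k)) + (u_ (n k) - \pi_(L2 R d) g).
  by rewrite addrA subrK.
rewrite [ltRHS]splitr (le_lt_trans (ler_ip_normD inner_form _ _))//; apply: ltrD.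
  by apply: lt_trans hk; apply: hN => //; exact: Nn.
by apply: le_lt_trans hk; rewrite (ip_norm_distrC inner_form).
Qed.

End L2_completeness.

(** * Rational boxes *)

Section boxes.
Context (R : realType).
Local Notation leb d := (lebesgue_tuple R d).

Definition box d (I : 'I_d -> set R) : set (d.-tuple R) :=
  [set y | forall i, I i (tnth y i)].

Lemma measurable_box d (I : 'I_d -> set R) : (forall i, measurable (I i)) ->
  measurable (box I).
Proof.
move=> mI; rewrite (_ : box I = \bigcap_(i in [set: 'I_d]) (fun y => tnth y i) @^-1` I i).
  apply: fin_bigcap_measurable => // i _; rewrite -[X in measurable X]setTI.
  exact: measurable_tnth.
by apply/seteqP; split => y /= h i; [move=> _; exact: h|exact: h].
Qed.

Lemma lebesgue_box d (I : 'I_d -> set R) : (forall i, measurable (I i)) ->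
  (leb d (box I) = \prod_(i < d) lebesgue_measure (I i))%E.
Proof.
elim: d I => [|d IH] I mI.
  rewrite big_ord0 /= diracE mem_set//; by case.
rewrite big_ord_recl -(IH (I \o lift ord0)) => [|i]; last exact: mI.
rewrite /= /lebesgue_step /pushforward.
rewrite (_ : @tcons R d @^-1` box I = I ord0 `*` box (I \o lift ord0)).
  have mb : measurable (box (I \o lift ord0)) by apply: measurable_box => i; exact: mI.
  by rewrite product_measure1E => [//||//]; exact: mI.
apply/seteqP; split => -[x y] /=; rewrite /box/=.
  by move=> h; split => [|i];
    [have := h ord0; rewrite tnth0|have := h (lift ord0 i); rewrite tnthS].
move=> [h0 h] i; have [j ->|->] := unliftP ord0 i; last by rewrite tnth0.
by rewrite tnthS; exact: h.
Qed.

Definition rbox d (q : d.-tuple (rat * rat)) : set (d.-tuple R) :=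
  box (fun i => `](ratr (tnth q i).1 : R), ratr (tnth q i).2]%classic).

Lemma measurable_rbox d (q : d.-tuple (rat * rat)) : measurable (rbox q).
Proof. exact: (measurable_box (fun i => measurable_itv _)). Qed.

Lemma lebesgue_rbox_lty d (q : d.-tuple (rat * rat)) : (leb d (rbox q) < +oo)%E.
Proof.
rewrite lebesgue_box => [|i]; last exact: measurable_itv.
have : (\prod_(i < d) lebesgue_measure `](ratr (tnth q i).1 : R), ratr (tnth q i).2]%classic)%E
    \is a fin_num.
  elim/big_ind : _ => //; first by move=> x y xf yf; rewrite fin_numM.
  move=> i _; rewrite lebesgue_measure_itv/=; case: ifPn => // _.
by rewrite ge0_fin_numE// prode_ge0.
Qed.

Lemma rbox_setI d : setI_closed (range (@rbox d)).
Proof.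
move=> _ _ [q _ <-] [r _ <-].
exists [tuple (Num.max (tnth q i).1 (tnth r i).1, Num.min (tnth q i).2 (tnth r i).2) | i < d] => //.
have rmax (a b : rat) : ratr (Num.max a b) = Num.max (ratr a) (ratr b) :> R.
  by case: (leP a b) => h; [rewrite max_r ?ler_rat|rewrite max_l ?ler_rat// ltW].
have rmin (a b : rat) : ratr (Num.min a b) = Num.min (ratr a) (ratr b) :> R.
  by case: (leP a b) => h; [rewrite min_l ?ler_rat|rewrite min_r ?ler_rat// ltW].
apply/seteqP; split => y /=; rewrite /rbox /box/=.
  move=> h; split=> i; have := h i; rewrite tnth_mktuple /= !in_itv/= rmax rmin.
    by rewrite gt_max le_min => /andP[/andP[-> _] /andP[-> _]].
  by rewrite gt_max le_min => /andP[/andP[_ ->] /andP[_ ->]].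
move=> [hq hr] i; have := hq i; have := hr i; rewrite tnth_mktuple /= !in_itv/= rmax rmin.
by rewrite gt_max le_min => /andP[-> ->] /andP[-> ->].
Qed.

Lemma rbox_cover d : \bigcup_k rbox [tuple ((- k%:R : rat), (k%:R : rat)) | i < d] = setT.
Proof.
apply/seteqP; split => // y _.
pose M := \sum_(i < d) `|tnth y i|.
have [k hk] : exists k : nat, M < k%:R.
  by exists (Num.trunc M).+1; exact: truncnS_gt.
exists k => // i; rewrite tnth_mktuple /= in_itv/= raddfN/= ratr_nat.
have : `|tnth y i| <= M by rewrite /M (bigD1 i)//= lerDl sumr_ge0.
by move=> /le_lt_trans /(_ hk); rewrite ltr_norml => /andP[-> /ltW ->].
Qed.

(** It is enough that the identity is measurable from the sigma-algebra generated by the boxes,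
    which is checked on coordinates and open half-lines. *)
Lemma measurable_rbox_generated d (A : set (d.-tuple R)) : measurable A ->
  <<s range (@rbox d) >> A.
Proof.
move=> mA; pose T' := g_sigma_algebraType (range (@rbox d)).
have mid : measurable_fun setT (idfun : T' -> d.-tuple R).
  apply/measurable_fun_tnthP => i.
  apply: (measurability _ (RGenOInfty.measurableE R)) => _ [_ [x ->] <-].
  rewrite setTI.
  (* The half-space y_i > x is the union of the boxes with i-th side (q, k] for rational q > x and
     all other sides (-k, k]. *)
  pose F (p : rat * nat) : set T' := if (x < ratr p.1 :> R) then
    rbox [tuple if j == i then (p.1, p.2%:R) else (- p.2%:R, p.2%:R) | j < d] else set0.
  rewrite (_ : _ @^-1` _ = \bigcup_p F p); last first.
    apply/seteqP; split => y /=; rewrite in_itv/= andbT.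
      move=> xy; have [q] := rat_in_itvoo xy; rewrite in_itv/= => /andP[xq qy].
      have [k _ hk] : (\bigcup_k rbox [tuple ((- k%:R : rat), (k%:R : rat)) | i < d]) y.
        by rewrite rbox_cover.
      exists (q, k) => //; rewrite /F/= xq => j; have := hk j; rewrite !tnth_mktuple/= !in_itv/=.
      by case: eqP => //= -> /andP[_ ->]; rewrite qy.
    move=> [[q k] _]; rewrite /F/=; case: ifPn => // xq /(_ i).
    by rewrite tnth_mktuple eqxx/= in_itv/= => /andP[/(lt_trans xq)].
  apply: countable_bigcupT_measurable => //= -[q k]; rewrite /F /=.
  by case: ifPn => // xq; apply: sub_sigma_algebra; eexists.
by have := mid measurableT A mA; rewrite setTI preimage_id.
Qed.

End boxes.

(** * Totality of box indicators and an orthonormal basis of L^2 *)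

Section rbox_total.
Context (R : realType) (d : nat).
Local Notation Rd := (d.-tuple R).
Local Notation leb := (lebesgue_tuple R d).

Lemma density_measure (h : Rd -> \bar R) : measurable_fun setT h ->
  (forall y, (0 <= h y)%E) ->
  exists m : {measure set Rd -> \bar R}, forall A, m A = (\int[leb]_(y in A) h y)%E.
Proof.
move=> mh h0; pose m A := (\int[leb]_(y in A) h y)%E.
have m0 : m set0 = 0%E by exact: integral_set0.
have m_ge0 A : (0 <= m A)%E by exact: integral_ge0.
have msa : semi_sigma_additive m.
  move=> F mF tF mUF; rewrite /m ge0_integral_bigcup//.
    by apply: is_cvg_nneseries => n _ _; exact: integral_ge0.
  exact: measurable_funTS.
by exists (HB.pack_for {measure set Rd -> \bar R} m (isMeasure.Build _ _ _ m m0 m_ge0 msa)).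
Qed.

(** The positive and negative parts of [g] are densities of two measures that agree and are finite
    on boxes, hence agree on all Borel sets. On the set where g >= 0 one of them is the whole
    integral of the positive part and the other is 0; so both parts have integral 0. *)
Lemma ae0_of_rbox_integral (g : Rd -> R) : measurable_fun setT g ->
  (forall q, leb.-integrable (rbox q) (EFin \o g)) ->
  (forall q, (\int[leb]_(y in rbox q) (g y)%:E = 0)%E) ->
  {ae leb, forall y, g y = 0}.
Proof.
move=> mg ig Ig.
have mgE : measurable_fun setT (EFin \o g) by exact/measurable_EFinP.
have mp := measurable_funepos mgE; have mn := measurable_funeneg mgE.
have [mup mupE] := density_measure mp (fun y => funepos_ge0 _ y).
have [mun munE] := density_measure mn (fun y => funeneg_ge0 _ y).
have finp q : (mup (rbox q) < +oo)%E.
  rewrite mupE; have := integrable_pos_fin_num (measurable_rbox q) (ig q).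
  by rewrite fin_numElt => /andP[].
have key A : measurable A -> mup A = mun A.
  move=> /measurable_rbox_generated.
  apply: (@g_sigma_algebra_measure_unique _ _ _ (range (@rbox R d)) _
    (fun k => @rbox R d [tuple ((- k%:R : rat), (k%:R : rat)) | i < d]) _
    (@rbox_cover R d) mup mun (@rbox_setI R d)).
  - by move=> _ [q _ <-]; exact: measurable_rbox.
  - by move=> k; eexists.
  - move=> _ [q _ <-]; rewrite mupE munE.
    have fp := integrable_pos_fin_num (measurable_rbox q) (ig q).
    have fn := integrable_neg_fin_num (measurable_rbox q) (ig q).
    have := Ig q; rewrite integralE -(fineK fp) -(fineK fn) -EFinB => -[h].
    by congr (_%:E); apply/eqP; rewrite -subr_eq0 h.
  - by move=> k; exact: finp.
have mA0 : measurable [set y | 0 <= g y].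
  rewrite -[X in measurable X]setTI; exact: measurable_fun_le.
have z (h : Rd -> \bar R) : measurable_fun setT h -> (forall y, 0 <= h y)%E ->
    (\int[leb]_y h y = 0)%E -> {ae leb, forall y, h y = 0%E}.
  move=> mh h0 Ih; have /(ae_eq_integral_abs leb measurableT mh) : (\int[leb]_y `|h y|)%E = 0%E.
    by rewrite -Ih; apply: eq_integral => y _; rewrite gee0_abs.
  by apply: filterS => y /(_ I).
have pA : mup [set y | 0 <= g y] = (\int[leb]_y (EFin \o g)^\+ y)%E.
  rewrite mupE integral_mkcond; apply: eq_integral => y _; rewrite patchE.
  case: ifPn => // /negP; rewrite inE/= => /negP; rewrite -ltNge => gy.
  by rewrite funeposE max_r// lee_fin ltW.
have nA : mun [set y | 0 <= g y] = 0%E.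
  rewrite munE integral_mkcond integral0_eq// => y _; rewrite patchE.
  by case: ifPn => //; rewrite inE/= => gy; rewrite funenegE max_r// -EFinN lee_fin oppr_le0.
have Ip : (\int[leb]_y (EFin \o g)^\+ y = 0)%E by rewrite -pA key.
have In : (\int[leb]_y (EFin \o g)^\- y = 0)%E by rewrite -munE -key// mupE.
apply: filterS2 (z _ mp (funepos_ge0 _) Ip) (z _ mn (funeneg_ge0 _) In) => y gp gn.
by have := congr1 (fun h => h y) (funeposneg (EFin \o g)); rewrite /= gp gn sube0 => -[].
Qed.

Local Open Scope complex_scope.
Local Open Scope quotient_scope.

Lemma mul_indic (A B : set Rd) y : \1_A y * \1_B y = \1_(A `&` B) y :> R.
Proof. by rewrite indicI. Qed.

Lemma sqint_rbox q : (fun y => (\1_(rbox q) y)%:C : R[i]^o) \in @sqint R d.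
Proof.
apply/sqintP; split.
  by split => /=; [apply: measurable_indic; exact: measurable_rbox|exact: measurable_cst].
under eq_integral do rewrite normc_real real_normK ?num_real// expr2 mul_indic setIid.
rewrite (integral_indic _ measurableT (measurable_rbox q)) setIT.
exact: lebesgue_rbox_lty.
Qed.

Definition rbox_L2 q : L2 R d := \pi_(L2 R d) (SqFun (sqint_rbox q)).

(** [p] stands for the real or the imaginary part. *)
Lemma inner_rbox (f : sqfun R d) q (p : R[i] -> R) :
  (forall (a : R) x, p (x * (a%:C)^*%C) = p x * a) ->
  EFin \o (fun y => p (f y * ((\1_(rbox q) y)%:C)^*%C)) = (EFin \o (fun y => p (f y))) \_ (rbox q).
Proof.
move=> pM; apply/funext => y; rewrite /= pM patchE indicE.
by case: ifPn => _; rewrite ?mulr1 ?mulr0.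
Qed.

Lemma integral_rbox (f : sqfun R d) q (p : R[i] -> R) :
  (forall (a : R) x, p (x * (a%:C)^*%C) = p x * a) ->
  (\int[leb]_y (p (f y * ((\1_(rbox q) y)%:C)^*%C)%R)%:E = \int[leb]_(y in rbox q) (p (f y))%:E)%E.
Proof. by move=> pM; rewrite [RHS]integral_mkcond -(inner_rbox f q pM). Qed.

Lemma rbox_L2_total (u : L2 R d) : (forall q, inner u (rbox_L2 q) = 0) -> u = 0.
Proof.
rewrite -[u]reprK; move: (repr u) => f Hf.
have [mr mi] := sqfun_measurable f.
have Re0 (a : R) (x : R[i]) : Re (x * (a%:C)^*%C) = Re x * a.
  by rewrite conjC_real ReM/= mulr0 subr0.
have Im0 (a : R) (x : R[i]) : Im (x * (a%:C)^*%C) = Im x * a.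
  by rewrite conjC_real ImM/= mulr0 add0r.
have H q : [/\ leb.-integrable (rbox q) (EFin \o (fun y => Re (f y))),
    leb.-integrable (rbox q) (EFin \o (fun y => Im (f y))),
    (\int[leb]_(y in rbox q) (Re (f y))%:E = 0)%E & (\int[leb]_(y in rbox q) (Im (f y))%:E = 0)%E].
  have [ir ii] := sqfun_mul_integrable f (SqFun (sqint_rbox q)).
  move: ir ii; rewrite /= (inner_rbox _ _ Re0) (inner_rbox _ _ Im0).
  move=> /(integrable_mkcond _ (measurable_rbox q)) ir
    /(integrable_mkcond _ (measurable_rbox q)) ii.
  have := Hf q; rewrite inner_pi => -[]; rewrite /Rintegral/=.
  rewrite (integral_rbox _ _ Re0) (integral_rbox _ _ Im0) => hr hi.
  split=> //.
  - rewrite -[LHS]fineK; last by have := integrable_fin_num (measurable_rbox q) ir.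
    by rewrite hr.
  - rewrite -[LHS]fineK; last by have := integrable_fin_num (measurable_rbox q) ii.
    by rewrite hi.
apply/eqP/L2_eqP.
have hr : {ae leb, forall y, Re (f y) = 0} by apply: ae0_of_rbox_integral => // q; case: (H q).
have hi : {ae leb, forall y, Im (f y) = 0} by apply: ae0_of_rbox_integral => // q; case: (H q).
by apply: filterS2 hr hi => y r0 i0; exact: eq_ReIm.
Qed.

Hypothesis d_gt0 : (0 < d)%N.

(** Disjoint unit cubes along the first axis: their indicators are the infinite orthonormal system
    that Gram-Schmidt asks for, and [0 < d] provides the axis. *)
Let cube n : d.-tuple (rat * rat) :=
  [tuple if i == Ordinal d_gt0 then (n%:R, n.+1%:R) else (0, 1) | i < d].

Let lebesgue_cube n : leb (rbox (cube n)) = 1%E.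
Proof.
rewrite lebesgue_box => [|i]; last exact: measurable_itv.
rewrite big1// => i _; rewrite tnth_mktuple lebesgue_measure_itv/=.
case: (i == Ordinal d_gt0) => /=; rewrite lte_fin ltr_rat ?ltr_nat ?ltnSn ?ltr01 -EFinB -rmorphB/=.
  by rewrite -natrB// subSnn rmorph1.
by rewrite subr0 rmorph1.
Qed.

Lemma rbox_L2_orthonormal : orthonormal (@inner R d) (fun n => rbox_L2 (cube n)).
Proof.
move=> m n; rewrite /rbox_L2 inner_pi.
have [->|mn] := eqVneq m n.
  apply: eq_ReIm => /=; rewrite /Rintegral.
    under eq_integral do rewrite mul0r subr0 mul_indic setIid.
    rewrite (integral_indic _ measurableT (measurable_rbox (cube n))) setIT.
    by rewrite [X in fine X](lebesgue_cube n).
  under eq_integral do rewrite oppr0 mulr0 mul0r addr0.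
  by rewrite integral0.
apply: eq_ReIm => /=; rewrite /Rintegral.
  under eq_integral do rewrite mul0r subr0 mul_indic.
  rewrite (_ : rbox _ `&` rbox _ = set0).
    by under eq_integral do rewrite indic0; rewrite integral0.
  rewrite -subset0 => y [/(_ (Ordinal d_gt0))+ /(_ (Ordinal d_gt0))] /=.
  rewrite !tnth_mktuple eqxx/= !in_itv/= !ratr_nat => /andP[a b] /andP[a' b'].
  have := lt_le_trans a b'; have := lt_le_trans a' b; rewrite !ltr_nat !ltnS => h1 h2.
  by move: mn; rewrite eqn_leq h1 h2.
under eq_integral do rewrite oppr0 mulr0 mul0r addr0.
by rewrite integral0.
Qed.

Lemma L2_orthonormal_basis : exists e, orthonormal_basis (@inner R d) e.
Proof.
(* An enumeration of the boxes; numbers that code no box give 0, which does not affect totality. *)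
pose D n := if unpickle n is Some q then rbox_L2 q else 0.
apply: (gram_schmidt inner_form (@inner_eq0 R d) (@L2_complete R d) (D := D) _ rbox_L2_orthonormal).
move=> u uD; apply: rbox_L2_total => q.
by have := uD (pickle q); rewrite /D pickleK.
Qed.

End rbox_total.

(** * Time-frequency shifts and Cohen distributions *)

Section time_frequency_operators.
Context (R : realType) (d : nat).
Local Open Scope complex_scope.
Local Open Scope quotient_scope.
Local Notation C := R[i].
Local Notation Rd := (d.-tuple R).
Local Notation leb := (lebesgue_tuple R d).
Local Notation L2 := (L2 R d).
Local Notation "'N u" := (ip_norm (@inner R d) u) (at level 10, u at level 8).
Implicit Types (f g : sqfun R d) (u v w : L2) (z : Rd * Rd) (S : L2 -> L2).

Lemma eq_innerP u v : (forall w, inner u w = inner v w) -> u = v.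
Proof. exact: (eq_ipP inner_form (@inner_eq0 R d)). Qed.

Lemma linear_tfshift z : linear_map (tfshift z).
Proof.
move=> a u v; apply: eq_innerP => w.
by rewrite !(form_linearl inner_form) !tfshift_adjP (form_linearl inner_form).
Qed.

Lemma inner_tfshift_adj z u v : inner (tfshift_adj z u) v = inner u (tfshift z v).
Proof. by rewrite innerC -tfshift_adjP -innerC. Qed.

Lemma linear_tfshift_adj z : linear_map (tfshift_adj z).
Proof.
move=> a u v; apply: eq_innerP => w.
by rewrite !(form_linearl inner_form) !inner_tfshift_adj (form_linearl inner_form).
Qed.

Lemma norm_tfshift z u : 'N (tfshift z u) = 'N u.
Proof.
apply/eqP; rewrite -(@eqrXn2 _ 2)// ?ip_norm_ge0//; apply/eqP/EFin_inj.
rewrite -[in RHS](reprK u) -!norm2E !norm2_pi_sqr.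
have mu := sqfun_measurable (repr u).
rewrite -(ge0_integral_preserving (measurable_tshift z.1) (@lebesgue_tshift _ _ z.1)
  (g := fun y => (normc (repr u y) ^+ 2)%:E)).
- by apply: eq_integral => y _; rewrite /= ComplexField.Normc.normcM normc_expi mul1r.
- exact: (measurable_EFinP _ _).2 (cmeasurable_normc2 mu).
- by move=> y; rewrite lee_fin sqr_ge0.
Qed.

(** As [tfshift] is an isometry, |pi^* u|^2 = <pi pi^* u, u> <= |pi^* u| |u|. *)
Lemma ler_norm_tfshift_adj z u : 'N (tfshift_adj z u) <= 'N u.
Proof.
have [->|h] := eqVneq (tfshift_adj z u) 0; first by rewrite (ip_norm0 inner_form) ip_norm_ge0.
have n0 := ip_norm_gt0 inner_form (@inner_eq0 R d) h.
rewrite -(ler_pM2r n0) -expr2.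
have -> : 'N (tfshift_adj z u) ^+ 2 = normc (inner (tfshift z (tfshift_adj z u)) u).
  by rewrite tfshift_adjP (ip_normE inner_form) normc_real ger0_norm// sqr_ge0.
by rewrite (le_trans (ip_CauchySchwarz inner_form _ _))// norm_tfshift mulrC.
Qed.

Lemma bounded_by_alpha z S M : bounded_by (@inner R d) S M ->
  bounded_by (@inner R d) (alpha z S) M.
Proof.
move=> [lS M0 SM]; split=> // [a u v|u].
  by rewrite /alpha/= linear_tfshift_adj lS linear_tfshift.
by rewrite /alpha/= norm_tfshift (le_trans (SM _))// ler_wpM2l// ler_norm_tfshift_adj.
Qed.

Lemma cohenE S u z : cohen S u z = inner (S (tfshift_adj z u)) (tfshift_adj z u).
Proof. by rewrite /cohen /alpha/= tfshift_adjP. Qed.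

Lemma normc_cohen_le S M u z : bounded_by (@inner R d) S M ->
  normc (cohen S u z) <= M * 'N u ^+ 2.
Proof.
move=> bS; have [lS M0 SM] := bS; rewrite cohenE.
rewrite (le_trans (ip_CauchySchwarz inner_form _ _))// expr2 mulrA.
apply: ler_pM;
  [exact: ip_norm_ge0|exact: ip_norm_ge0| |exact: ler_norm_tfshift_adj].
by rewrite (le_trans (SM _))// ler_wpM2l// ler_norm_tfshift_adj.
Qed.

Lemma cohenZ S M (a : C) u z : bounded_by (@inner R d) S M ->
  cohen S (a *: u) z = (normc a ^+ 2)%:C * cohen S u z.
Proof.
move=> [lS _ _]; rewrite !cohenE linear_mapZ; last exact: linear_tfshift_adj.
by rewrite linear_mapZ// (formZl inner_form) (formZr inner_form) mulrA mulJc.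
Qed.

Lemma cintegral_topp (F : Rd -> C) : cmeasurable F ->
  cintegral (fun y => F (topp y)) = cintegral F.
Proof.
move=> [Fr Fi]; apply: eq_ReIm; rewrite /= /Rintegral; congr fine.
- exact: (integral_preserving (@measurable_topp R d) (@lebesgue_topp R d)
    ((measurable_EFinP _ _).2 Fr)).
- exact: (integral_preserving (@measurable_topp R d) (@lebesgue_topp R d)
    ((measurable_EFinP _ _).2 Fi)).
Qed.

Lemma toppK : involutive (@topp R d).
Proof. by move=> y; apply: eq_from_tnth => i; rewrite !tnth_mktuple opprK. Qed.

Lemma inner_parity u v : inner (parity u) v = inner u (parity v).
Proof.
rewrite /parity -[in LHS](reprK v) -[in RHS](reprK u) !inner_pi -cintegral_topp.
  by congr cintegral; apply/funext => y /=; rewrite toppK.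
exact: (cmeasurableM (sqfun_measurable (SqFun (sqint_parity (repr u))))
  (cmeasurable_conj (sqfun_measurable (repr v)))).
Qed.

Lemma inner_parity2 u v : inner (parity u) (parity v) = inner u v.
Proof.
rewrite -[in RHS](reprK u) -[in RHS](reprK v) !inner_pi -[RHS]cintegral_topp//.
exact: (cmeasurableM (sqfun_measurable (repr u)) (cmeasurable_conj (sqfun_measurable (repr v)))).
Qed.

(** A symmetric isometry is an involution; arguing by inner products avoids a comparison of
    representatives. *)
Lemma parityK : involutive (@parity R d).
Proof. by move=> u; apply: eq_innerP => w; rewrite inner_parity inner_parity2. Qed.

(** [op_conv] reflects its window, and the theorem feeds it [check_op S]; the two reflections cancel
    and leave the trace of [T \o alpha z S]. *)
Lemma check_opK S : check_op (check_op S) = S.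
Proof. by apply/funext => u; rewrite /check_op/= !parityK. Qed.

End time_frequency_operators.

(** * Measurability of Cohen distributions in z *)

Section measurability.
Context (R : realType).
Local Open Scope complex_scope.

Definition measurable_cfun d (T : measurableType d) (F : T -> R[i]) :=
  measurable_fun setT (fun x => Re (F x)) /\ measurable_fun setT (fun x => Im (F x)).

Section closure.
Context d d' (T : measurableType d) (T' : measurableType d').
Implicit Types F G : T -> R[i].

Lemma measurable_cfunD F G : measurable_cfun F -> measurable_cfun G ->
  measurable_cfun (fun x => F x + G x).
Proof.
move=> [Fr Fi] [Gr Gi]; split.
  by under eq_fun do rewrite ReD; exact: measurable_funD.
by under eq_fun do rewrite ImD; exact: measurable_funD.
Qed.

Lemma measurable_cfunM F G : measurable_cfun F -> measurable_cfun G ->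
  measurable_cfun (fun x => F x * G x).
Proof.
move=> [Fr Fi] [Gr Gi]; split.
  by under eq_fun do rewrite ReM; apply: measurable_funB; exact: measurable_funM.
by under eq_fun do rewrite ImM; apply: measurable_funD; exact: measurable_funM.
Qed.

Lemma measurable_cfunJ F : measurable_cfun F -> measurable_cfun (fun x => (F x)^*%C).
Proof.
move=> [Fr Fi]; split; first by under eq_fun do rewrite ReJ.
by under eq_fun do rewrite ImJ; exact: measurable_funN.
Qed.

Lemma measurable_cfun_cst (c : R[i]) : measurable_cfun (fun _ : T => c).
Proof. by split; exact: measurable_cst. Qed.

Lemma measurable_cfun_sum (I : Type) (r : seq I) (F : I -> T -> R[i]) :
  (forall i, measurable_cfun (F i)) -> measurable_cfun (fun x => \sum_(i <- r) F i x).
Proof.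
move=> mF; elim: r => [|i r IH].
  by under eq_fun do rewrite big_nil; exact: measurable_cfun_cst.
by under eq_fun do rewrite big_cons; exact: measurable_cfunD.
Qed.

Lemma measurable_cfun_comp (F : T' -> R[i]) (phi : T -> T') :
  measurable_fun setT phi -> measurable_cfun F -> measurable_cfun (F \o phi).
Proof.
by move=> mphi [Fr Fi]; split; [exact: (measurableT_comp Fr)|exact: (measurableT_comp Fi)].
Qed.

Lemma measurable_cfun_cvg (F_ : nat -> T -> R[i]) F : (forall n, measurable_cfun (F_ n)) ->
  (forall x, (fun n => normc (F_ n x - F x)) @ \oo --> (0 : R)) -> measurable_cfun F.
Proof.
move=> mF FF; split.
  apply: (@measurable_fun_cvg _ _ _ _ (fun n x => Re (F_ n x))) => [n|x _]; first exact: (mF n).1.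
  exact: cvg_Re.
apply: (@measurable_fun_cvg _ _ _ _ (fun n x => Im (F_ n x))) => [n|x _]; first exact: (mF n).2.
exact: cvg_Im.
Qed.

Lemma measurable_cfun_expi (g : T -> R) : measurable_fun setT g ->
  measurable_cfun (fun x => expi (g x)).
Proof.
move=> mg; split.
  by apply: (measurableT_comp _ mg); apply: continuous_measurable_fun; exact: continuous_cos.
by apply: (measurableT_comp _ mg); apply: continuous_measurable_fun; exact: continuous_sin.
Qed.

Lemma measurable_normc F : measurable_cfun F -> measurable_fun setT (fun x => normc (F x)).
Proof.
move=> [Fr Fi].
rewrite (_ : (fun x => _) = Num.sqrt \o (fun x => Re (F x) ^+ 2 + Im (F x) ^+ 2)).
  apply: measurableT_comp; last by apply: measurable_funD; exact: measurable_funX.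
  by apply: continuous_measurable_fun; exact: sqrt_continuous.
apply/funext => x /=; rewrite -normc2E sqrtr_sqr ger0_norm//; exact: normc_ge0.
Qed.

(** Tonelli's theorem treats the positive and the negative part; taking their difference and [fine]
    preserves measurability even where the integrals are infinite. *)
Lemma measurable_param_integral (mu : {sigma_finite_measure set T' -> \bar R})
    (k : T * T' -> R) : measurable_fun setT k ->
  measurable_fun setT (fun x => \int[mu]_y k (x, y)).
Proof.
move=> mk.
have mkE : measurable_fun setT (EFin \o k) by exact/measurable_EFinP.
rewrite (_ : (fun x => _) = fine \o
    (fun x => (fubini_F mu (EFin \o k)^\+ x - fubini_F mu (EFin \o k)^\- x)%E)).
  apply: measurableT_comp => //; apply: emeasurable_funB.
    by apply: measurable_fun_fubini_tonelli_F => [|x];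
      [exact: measurable_funepos|exact: funepos_ge0].
  by apply: measurable_fun_fubini_tonelli_F => [|x];
    [exact: measurable_funeneg|exact: funeneg_ge0].
apply/funext => x; rewrite /= /Rintegral integralE /fubini_F; congr (fine (_ - _)%E).
  by apply: eq_integral => y _; rewrite !funeposE.
by apply: eq_integral => y _; rewrite !funenegE.
Qed.

End closure.
End measurability.

Section measurable_cohen.
Context (R : realType) (d : nat).
Local Open Scope complex_scope.
Local Open Scope quotient_scope.
Local Notation C := R[i].
Local Notation Rd := (d.-tuple R).
Local Notation leb := (lebesgue_tuple R d).
Local Notation L2 := (L2 R d).
Local Notation "'N u" := (ip_norm (@inner R d) u) (at level 10, u at level 8).
Implicit Types (u v w : L2) (z : Rd * Rd) (S : L2 -> L2).

(** With Borel representatives the integrand is jointly measurable in [z] and the integration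
    variable. *)
Lemma measurable_inner_tfshift u v : measurable_cfun (fun z => inner (tfshift z u) v).
Proof.
pose K (q : (Rd * Rd) * Rd) : C :=
  expi (2 * pi * dot q.1.2 q.2) * repr u (tshift q.1.1 q.2) * (repr v q.2)^*%C.
have m2 : measurable_fun setT (fun q : (Rd * Rd) * Rd => q.2) by exact: measurable_snd.
have m12 : measurable_fun setT (fun q : (Rd * Rd) * Rd => q.1.2).
  exact: (measurableT_comp measurable_snd measurable_fst).
have m11 : measurable_fun setT (fun q : (Rd * Rd) * Rd => q.1.1).
  exact: (measurableT_comp measurable_fst measurable_fst).
have mK : measurable_cfun K.
  apply: measurable_cfunM; first apply: measurable_cfunM.
  - apply: measurable_cfun_expi; apply: measurable_funM => //.
    apply: measurable_sum => i; apply: measurable_funM.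
      exact: (measurableT_comp (measurable_tnth i) m12).
    exact: (measurableT_comp (measurable_tnth i) m2).
  - apply: (@measurable_cfun_comp _ _ _ _ _ (repr u : Rd -> C) (fun q => tshift q.1.1 q.2)).
      apply/measurable_fun_tnthP => i.
      rewrite (_ : _ \o _ = (fun q : (Rd * Rd) * Rd => tnth q.2 i - tnth q.1.1 i)).
        apply: measurable_funB.
          exact: (measurableT_comp (measurable_tnth i) m2).
        exact: (measurableT_comp (measurable_tnth i) m11).
      by apply/funext => q /=; rewrite tnth_mktuple.
    exact: sqfun_measurable.
  apply: measurable_cfunJ.
  apply: (@measurable_cfun_comp _ _ _ _ _ (repr v : Rd -> C) _ m2).
  exact: sqfun_measurable.
rewrite (_ : (fun z => _) = (fun z => cintegral (fun y => K (z, y)))).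
  have [Kr Ki] := mK.
  split; first exact: (measurable_param_integral leb Kr).
  exact: (measurable_param_integral leb Ki).
by apply/funext => z; rewrite -[in LHS](reprK v) inner_pi.
Qed.

(** Expanding pi(z)^* u along [e] exhibits Q_S u(z) as a limit of finite sums in which [z] occurs
    only in the coefficients <pi(z)^* u, e_k>, while [S] enters through the constants <S e_j,
    e_k>. *)
Lemma measurable_cohen S M u e : orthonormal_basis (@inner R d) e ->
  bounded_by (@inner R d) S M -> measurable_cfun (fun z => cohen S u z).
Proof.
move=> be bS; have [lS _ _] := bS.
pose c k z := inner (tfshift_adj z u) (e k).
have mc k : measurable_cfun (c k).
  rewrite (_ : c k = (fun z => (inner (tfshift z (e k)) u)^*%C)).
    exact/measurable_cfunJ/measurable_inner_tfshift.
  by apply/funext => z; rewrite tfshift_adjP -innerC.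
apply: (@measurable_cfun_cvg _ _ _ (fun n z => \sum_(j < n) \sum_(k < n)
   (c j z * (c k z)^*%C * inner (S (e j)) (e k)))) => [n|z].
  apply: measurable_cfun_sum => j; apply: measurable_cfun_sum => k.
  apply: measurable_cfunM; last exact: measurable_cfun_cst.
  by apply: measurable_cfunM => //; exact: measurable_cfunJ.
pose g := tfshift_adj z u.
have hp := cvg_proj inner_form g be.
have := cvg_ip inner_form (cvg_bounded_by bS hp) hp.
apply: cvg_trans; apply: near_eq_cvg; apply: nearW => n; rewrite cohenE; congr (normc (_ - _)).
rewrite {1}/ip_proj (linear_map_sum _ _ _ lS) (form_suml inner_form); apply: eq_bigr => j _.
rewrite (linear_mapZ _ _ lS) (formZl inner_form) /ip_proj (form_sumr inner_form) big_distrr/=.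
by apply: eq_bigr => k _; rewrite (formZr inner_form) mulrA.
Qed.

End measurable_cohen.

(** * Density operators and L^p norms *)

Section powR_convexity.
Context (R : realType) (p : R).
Hypothesis p_ge1 : 1 <= p.

(* Young's inequality with one factor [x `^ (p - 1)]. *)
Lemma powR_tangent (x y : R) : 0 <= x -> 0 <= y ->
  x `^ p - y `^ p <= p * x `^ (p - 1) * (x - y).
Proof.
move=> x0 y0; have p0 : 0 < p by exact: lt_le_trans p_ge1.
(* The conjugate exponent [p / (p - 1)] exists only for [p > 1]. *)
have [p1|p_neq1] := eqVneq p 1.
  by rewrite p1 subrr powRr0 !powRr1// !mul1r.
have p1 : 0 < p - 1 by rewrite subr_gt0 lt_neqAle eq_sym p_neq1.
pose q := p / (p - 1).
have q0 : 0 < q by rewrite divr_gt0.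
have pq : p^-1 + q^-1 = 1 by rewrite /q; field; rewrite !gt_eqF.
have := conjugate_powR y0 (powR_ge0 x (p - 1)) p0 q0 pq.
rewrite -powRrM (_ : (p - 1) * q = p); last by rewrite /q; field; rewrite gt_eqF.
rewrite -(ler_pM2l p0) (_ : p * (y `^ p / p + x `^ p / q) = y `^ p + (p - 1) * x `^ p); last first.
  by rewrite /q; field; rewrite !gt_eqF.
have <- := mulr_powRB1 x0 p0; set s := x `^ (p - 1); set t := y `^ p.
by move=> h; lra.
Qed.

(** Summing the tangent inequality at x = sum l_k a_k, with weights of total L <= 1, bounds the
    right side below by x^p + (p - 1) (1 - L) x^p. *)
Lemma jensen_powR n (l a : nat -> R) : (forall k, 0 <= l k) -> (forall k, 0 <= a k) ->
  \sum_(k < n) l k <= 1 ->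
  (\sum_(k < n) l k * a k) `^ p <= \sum_(k < n) l k * a k `^ p.
Proof.
move=> l0 a0; set L := \sum_(k < n) l k => L1.
set x := \sum_(k < n) l k * a k.
have p0 : 0 < p by exact: lt_le_trans p_ge1.
have x0 : 0 <= x by apply: sumr_ge0 => k _; exact: mulr_ge0.
have h : \sum_(k < n) l k * (x `^ p - a k `^ p) <=
    \sum_(k < n) l k * (p * x `^ (p - 1) * (x - a k)).
  by apply: ler_sum => k _; rewrite ler_wpM2l// powR_tangent.
have e1 : \sum_(k < n) l k * (x `^ p - a k `^ p) = L * x `^ p - \sum_(k < n) l k * a k `^ p.
  by rewrite /L big_distrl/= -sumrB; apply: eq_bigr => k _; rewrite mulrBr.
have e2 : \sum_(k < n) l k * (p * x `^ (p - 1) * (x - a k)) = p * x `^ (p - 1) * (L * x - x).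
  rewrite {4}/x /L big_distrl/= -sumrB big_distrr/=; apply: eq_bigr => k _.
  by rewrite -mulrBr mulrCA.
move: h; rewrite e1 e2.
have xp := mulr_powRB1 x0 p0.
have xp0 : 0 <= x `^ p by exact: powR_ge0.
have -> : p * x `^ (p - 1) * (L * x - x) = - (p * (1 - L) * x `^ p) by rewrite -xp; ring.
set s := \sum_(_ < _) _ * _ `^ _ => h.
have : 0 <= (p - 1) * (1 - L) * x `^ p by rewrite !mulr_ge0// subr_ge0.
by move=> h2; lra.
Qed.

(** By the tangent inequality t^p is Lipschitz on [0, B] with constant p B^(p-1), the endpoint 0
    included. *)
Lemma cvg_powR (u : nat -> R) (l : R) : (forall n, 0 <= u n) -> u @ \oo --> l ->
  (fun n => u n `^ p) @ \oo --> l `^ p.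
Proof.
move=> u0 ul; have p0 : 0 < p by exact: lt_le_trans p_ge1.
have l0 : 0 <= l by apply: (cvgr_to_ge ul); apply: nearW.
pose B := l + 1.
have B0 : 0 <= B by rewrite addr_ge0.
have ule : \forall n \near \oo, u n <= B.
  move/cvgrPdist_lt : ul => /(_ 1 ltr01); apply: filterS => n.
  by rewrite ltr_norml /B => /andP[? _]; lra.
have h : (fun n => p * B `^ (p - 1) * `|u n - l|) @ \oo --> (0 : R).
  rewrite -[X in _ --> X](mulr0 (p * B `^ (p - 1))); apply: cvgM; first exact: cvg_cst.
  exact/norm_cvg0P/subr_cvg0.
apply/subr_cvg0/norm_cvg0P; apply: squeeze_cvgr h; last exact: cvg_cst.
apply: filterS ule => n uB; rewrite normr_ge0/=.
have key x y : 0 <= x <= B -> 0 <= y -> x `^ p - y `^ p <= p * B `^ (p - 1) * `|x - y|.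
  move=> /andP[x0 xB] y0; apply: le_trans (powR_tangent x0 y0) _.
  apply: (@le_trans _ _ (p * x `^ (p - 1) * `|x - y|)).
    by rewrite ler_wpM2l ?ler_norm// mulr_ge0 ?powR_ge0// ltW.
  rewrite ler_wpM2r// ler_wpM2l//; first exact: ltW.
  by apply: ge0_ler_powR => //; rewrite subr_ge0.
have lB : 0 <= l <= B by rewrite l0 /B lerDl ler01.
rewrite ler_norml lerNl opprB; apply/andP; split; last by apply: key; rewrite ?u0.
by rewrite distrC key.
Qed.

End powR_convexity.

(** * Traces and density operators on L^2 *)

Section trace_class_L2.
Context (R : realType) (d : nat).
Local Open Scope complex_scope.
Local Notation L2 := (L2 R d).
Local Notation "'N u" := (ip_norm (@inner R d) u) (at level 10, u at level 8).
Local Notation cvg u l := ((fun n => normc (u n - l)) @ \oo --> (0 : R)).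
Implicit Types (u v f : L2) (T S : L2 -> L2).

Lemma onbP (e : nat -> L2) : onb e <-> orthonormal_basis (@inner R d) e.
Proof.
split=> -[oe he]; split => // u; have := he u;
by apply: cvg_trans; apply: near_eq_cvg; apply: nearW => n; rewrite -norm2E.
Qed.

Lemma bounded_opP T : bounded_op T <-> exists M, bounded_by (@inner R d) T M.
Proof.
split=> [[lT [M TM]]|[M [lT M0 TM]]].
  by apply: bounded_by_exists => //; exists M => u; rewrite -!norm2E.
by split => //; exists M => u; rewrite !norm2E.
Qed.

Lemma is_traceP T (t : R[i]) : is_trace T t <-> forall e, orthonormal_basis (@inner R d) e ->
  cvg (fun n => \sum_(k < n) inner (T (e k)) (e k)) t.
Proof.
have E e : (fun n => normc (series (fun k => inner (T (e k)) (e k)) n - t)) =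
    (fun n => normc (\sum_(k < n) inner (T (e k)) (e k) - t)).
  by apply/funext => n; rewrite /series/= big_mkord.
split=> h e; first by move=> /onbP /h /cvg_normcP; rewrite E.
by move=> /onbP /h; rewrite -E => /cvg_normcP.
Qed.

Hypothesis d_gt0 : (0 < d)%N.

(** If there were no orthonormal basis, every number would satisfy [is_trace]; one basis makes the
    trace unique. *)
Lemma trace_eq T t : is_trace T t -> trace T = t.
Proof.
move=> Tt; have [e be] := L2_orthonormal_basis R d_gt0.
have : is_trace T (trace T) by apply: xgetPex; exists t.
move=> /is_traceP /(_ e be) h; move: Tt => /is_traceP /(_ e be).
exact: cvg_normc0_unique.
Qed.

Lemma op_conv_cvg T S M (g : nat -> L2) (t : R) z :
  (forall N, \sum_(k < N) 'N (g k) ^+ 2 <= t) ->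
  (forall u v, cvg (fun n => \sum_(k < n) inner u (g k) * inner (g k) v) (inner (T u) v)) ->
  bounded_by (@inner R d) S M ->
  cvg (fun n => \sum_(k < n) cohen S (g k) z) (op_conv T (check_op S) z).
Proof.
move=> gt Tg bS; have bA := bounded_by_alpha z bS.
have [s hs] := trace_series_cvg inner_form gt bA.
rewrite /op_conv check_opK (@trace_eq _ s)//.
by apply/is_traceP => e be; apply: (trace_formula inner_form gt Tg bA).
Qed.

Lemma density_op_decomposition T : density_op T -> exists2 g : nat -> L2,
  forall N, \sum_(k < N) 'N (g k) ^+ 2 <= 1 &
  forall u v, cvg (fun n => \sum_(k < n) inner u (g k) * inner (g k) v) (inner (T u) v).
Proof.
move=> [[bT _] T0 tr1]; have [M bM] := (bounded_opP T).1 bT.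
have [e be] := L2_orthonormal_basis R d_gt0.
(* The value 1 differs from the default 0 of [xget], so it really is a trace of [T]. *)
have : is_trace T 1.
  rewrite -tr1 /trace; case: xgetP => [t -> //|none].
  have : trace T = 0 by rewrite /trace; case: xgetP => // t _ /none.
  by rewrite tr1 => /eqP; rewrite oner_eq0.
move=> /is_traceP /(_ e be) /cvg_Re ht.
apply: (positive_op_decomposition inner_form (@inner_eq0 R d) bM T0 be (t := 1)).
by apply: cvg_trans ht; apply: near_eq_cvg; apply: nearW => n; rewrite Re_sum.
Qed.

(** A rank-one operator has a decomposition with a single nonzero term, so that [op_conv_cvg] covers
    it as well. *)
Let single f k : L2 := if k is 0%N then f else 0.

Let single_sum (V : nmodType) (F : L2 -> V) f n : F 0 = 0 ->
  \sum_(k < n.+1) F (single f k) = F f.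
Proof. by move=> F0; rewrite big_ord_recl/= big1 ?addr0. Qed.

Lemma op_conv_rank_one S M f z : bounded_by (@inner R d) S M ->
  op_conv (rank_one f) (check_op S) z = cohen S f z.
Proof.
move=> bS; pose g k : L2 := single f k.
have gt N : \sum_(k < N) 'N (g k) ^+ 2 <= 'N f ^+ 2.
  case: N => [|N]; first by rewrite big_ord0 sqr_ge0.
  by rewrite (@single_sum _ (fun u => 'N u ^+ 2))// (ip_norm0 inner_form) expr0n.
have Tg u v : cvg (fun n => \sum_(k < n) inner u (g k) * inner (g k) v) (inner (rank_one f u) v).
  apply: (@cvg_near_cst _ _ (0 : R)); exists 1%N => // -[//|n] _ /=.
  rewrite (@single_sum _ (fun w => inner u w * inner w v)); last first.
    by rewrite (form0r inner_form) mul0r.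
  by rewrite /rank_one (formZl inner_form) subrr ComplexField.Normc.normc0.
apply: (cvg_normc0_unique (op_conv_cvg z gt Tg bS)).
apply: (@cvg_near_cst _ _ (0 : R)); exists 1%N => // -[//|n] _ /=.
rewrite (@single_sum _ (fun w => cohen S w z)) ?subrr ?ComplexField.Normc.normc0//.
have /(_ 0 0) := cohenZ _ _ _ bS.
by rewrite scale0r => ->; rewrite ComplexField.Normc.normc0 expr0n mul0r.
Qed.

Lemma density_rank_one f : 'N f = 1 -> density_op (rank_one f).
Proof.
move=> f1.
have diag u : inner (rank_one f u) u = (normc (inner u f) ^+ 2)%:C.
  by rewrite /rank_one (formZl inner_form) -mulJc -innerC.
have bT : bounded_op (rank_one f).
  apply/bounded_opP; exists 1; split=> // [a u v|u].
    by rewrite /rank_one (form_linearl inner_form) scalerDl scalerA.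
  rewrite /rank_one (ip_normZ inner_form) f1 mulr1 mul1r.
  by rewrite (le_trans (ip_CauchySchwarz inner_form _ _))// f1 mulr1.
have pT : positive_op (rank_one f) by move=> u; rewrite diag ler0c sqr_ge0.
have [e be] := L2_orthonormal_basis R d_gt0.
have tr (e' : nat -> L2) N : \sum_(k < N) inner (rank_one f (e' k)) (e' k) =
    (\sum_(k < N) normc (inner f (e' k)) ^+ 2)%:C.
  by rewrite rmorph_sum/=; apply: eq_bigr => k _; rewrite diag innerC normc_conj.
split=> //.
  (* A positive operator is its own absolute value. *)
  split => //; exists (rank_one f) => //; exists e; first exact/onbP.
  apply: (@le_lt_trans _ _ 1%E); last exact: ltry.
  apply: lime_le.
    by apply: is_cvg_nneseries => k _ _; rewrite diag lee_fin sqr_ge0.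
  apply: nearW => n; rewrite big_mkord sumEFin lee_fin -Re_sum tr/=.
  by rewrite (le_trans (bessel inner_form n f be.1))// f1 expr1n.
apply: trace_eq; apply/is_traceP => e' be'.
apply: cvg_ReIm; under eq_fun do rewrite tr/=; last exact: cvg_cst.
by have := @parseval _ _ _ inner_form e' f be'; rewrite f1 expr1n.
Qed.

End trace_class_L2.

(** * L^p norms over a set of finite measure *)

Section Lp_norms.
Context (R : realType) (d : nat) (p : R) (Omega : set (phase_space R d)).
Local Open Scope complex_scope.
Local Notation Rd := (d.-tuple R).
Local Notation L2 := (L2 R d).
Local Notation mu := (lebesgue_phase R d).
Local Notation "'N u" := (ip_norm (@inner R d) u) (at level 10, u at level 8).
Implicit Types (F : Rd * Rd -> R[i]) (f : L2) (S : L2 -> L2).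
Hypothesis p_ge1 : 1 <= p.
Hypothesis mOmega : measurable Omega.

Let p_gt0 : 0 < p. Proof. exact: lt_le_trans p_ge1. Qed.
Let p_neq0 : p != 0. Proof. by rewrite gt_eqF. Qed.

Lemma measurable_phase (h : Rd * Rd -> R) : measurable_fun setT h ->
  measurable_fun setT (h : phase_space R d -> R).
Proof.
move=> mh _ A mA; rewrite setTI; apply: sub_caratheodory; apply: sub_sigma_algebra.
by have := mh measurableT A mA; rewrite setTI.
Qed.

(** The p-th power of [Lp_on]: convexity and limit theorems apply to it directly. *)
Definition energy F := (\int[mu]_(z in Omega) (normc (F z) `^ p)%:E)%E.

Lemma integrand_ge0 F (z : phase_space R d) : Omega z -> (0 <= (normc (F z) `^ p)%:E)%E.
Proof. by move=> _; rewrite lee_fin powR_ge0. Qed.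

Lemma Lp_onE F : Lp_on p Omega F = (energy F `^ p^-1)%E. Proof. by []. Qed.

Lemma energy_ge0 F : (0 <= energy F)%E.
Proof. by apply: integral_ge0 => z _; rewrite lee_fin powR_ge0. Qed.

Lemma measurable_energy F : measurable_cfun F ->
  measurable_fun Omega (fun z : phase_space R d => (normc (F z) `^ p)%:E).
Proof.
move=> mF; apply: measurable_funTS; apply/measurable_EFinP.
apply: (measurableT_comp (measurable_powR p)).
exact: measurable_phase (measurable_normc mF).
Qed.

Lemma ler_Lp_on F G : (energy F <= energy G)%E -> (Lp_on p Omega F <= Lp_on p Omega G)%E.
Proof.
move=> FG; rewrite !Lp_onE; apply: gt0_ler_poweR => //; rewrite ?invr_ge0 ?(ltW p_gt0)//.
  by rewrite in_itv/= energy_ge0 leey.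
by rewrite in_itv/= energy_ge0 leey.
Qed.

Lemma energyE F : energy F = (Lp_on p Omega F `^ p)%E.
Proof. by rewrite Lp_onE -poweRrM mulVf// poweRe1// energy_ge0. Qed.

Lemma energyZ (c : R) F : 0 <= c -> measurable_cfun F ->
  energy (fun z => c%:C * F z) = ((c `^ p)%:E * energy F)%E.
Proof.
move=> c0 mF.
rewrite /energy -(ge0_integralZl_EFin mu mOmega (integrand_ge0 F) (measurable_energy mF)
  (powR_ge0 c p)).
apply: eq_integral => z _; rewrite -EFinM -powRM//; last exact: normc_ge0.
by rewrite ComplexField.Normc.normcM normc_real ger0_norm.
Qed.

Lemma Lp_onZ (c : R) F : 0 <= c -> measurable_cfun F ->
  Lp_on p Omega (fun z => c%:C * F z) = (c%:E * Lp_on p Omega F)%E.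
Proof.
move=> c0 mF; rewrite !Lp_onE energyZ// poweRM ?energy_ge0 ?lee_fin ?powR_ge0//.
by rewrite poweR_EFin -powRrM mulfV// powRr1.
Qed.

Lemma cohen_quotient_normalize S M e f : orthonormal_basis (@inner R d) e ->
  bounded_by (@inner R d) S M -> f != 0 ->
  cohen_quotient p Omega S f = Lp_on p Omega (cohen S (('N f)^-1%:C *: f)).
Proof.
move=> be bS f0; have n0 := ip_norm_gt0 inner_form (@inner_eq0 R d) f0.
have mf := measurable_cohen f be bS.
have -> : cohen S (('N f)^-1%:C *: f) = (fun z => (('N f ^+ 2)^-1)%:C * cohen S f z).
  apply/funext => z; rewrite (cohenZ _ _ _ bS) normc_real ger0_norm ?invr_ge0 ?(ltW n0)//.
  by rewrite exprVn.
rewrite Lp_onZ//; last by rewrite invr_ge0 exprn_ge0// ltW.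
by rewrite /cohen_quotient norm2E inver expf_eq0/= gt_eqF// muleC.
Qed.

Lemma normalize_norm1 f : f != 0 -> 'N (('N f)^-1%:C *: f) = 1.
Proof.
move=> f0; have n0 := ip_norm_gt0 inner_form (@inner_eq0 R d) f0.
by rewrite (ip_normZ inner_form) normc_real ger0_norm ?invr_ge0 ?(ltW n0)// mulVf// gt_eqF.
Qed.

(** Jensen's inequality for the partial sums passes to the pointwise limit; integrating the
    resulting series term by term leaves at most the sum of the l_k B. The bound on [G k] is
    required only for nonzero weights because a zero g_k has no associated unit vector. *)
Lemma energy_convex (G : nat -> Rd * Rd -> R[i]) F (l : nat -> R) (B : \bar R) :
  (forall k, measurable_cfun (G k)) -> (forall k, 0 <= l k) ->
  (forall n, \sum_(k < n) l k <= 1) ->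
  (forall z, (fun n => normc (\sum_(k < n) (l k)%:C * G k z - F z)) @ \oo --> (0 : R)) ->
  (0 <= B)%E -> (forall k, l k != 0 -> (energy (G k) <= B)%E) ->
  (energy F <= B)%E.
Proof.
move=> mG l0 l1 cF B0 GB.
have mF : measurable_cfun F.
  apply: (measurable_cfun_cvg _ cF) => n; apply: measurable_cfun_sum => k.
  by apply: measurable_cfunM => //; exact: measurable_cfun_cst.
pose q k (z : phase_space R d) : \bar R := ((l k)%:E * (normc (G k z) `^ p)%:E)%E.
have q0 k z : (0 <= q k z)%E by rewrite mule_ge0// lee_fin// powR_ge0.
have mq k : measurable_fun Omega (q k).
  by apply: emeasurable_funM; [exact: measurable_cst|exact: (measurable_energy (mG k))].
have key z : ((normc (F z) `^ p)%:E <= \sum_(0 <= k <oo) q k z)%E.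
  have h := cvg_powR p_ge1 (fun n => normc_ge0 _) (cvg_normc (cF z)).
  have hl : (fun n => (normc (\sum_(k < n) (l k)%:C * G k z) `^ p)%:E) @ \oo -->
      (normc (F z) `^ p)%:E by apply: cvg_EFin; [exact: nearW|exact: h].
  have hr : (fun n => \sum_(0 <= k < n) q k z)%E @ \oo --> (\sum_(0 <= k <oo) q k z)%E.
    by apply: is_cvg_nneseries => k _ _; exact: q0.
  apply: (lee_cvg_to hl hr).
  apply: nearW => n; rewrite big_mkord.
  rewrite (eq_bigr (fun k : 'I_n => (l k * normc (G k z) `^ p)%:E))//.
  rewrite sumEFin lee_fin.
  apply: le_trans (jensen_powR p_ge1 (n := n) l0 (fun k => normc_ge0 (G k z)) (l1 n)).
  apply: ge0_ler_powR; rewrite ?nnegrE ?normc_ge0 ?(ltW p_gt0)//.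
    by apply: sumr_ge0 => k _; rewrite mulr_ge0// normc_ge0.
  apply: le_trans (ler_normc_sum _ _ _) _; apply: ler_sum => k _.
  by rewrite ComplexField.Normc.normcM normc_real ger0_norm.
have mQ : measurable_fun Omega (fun z => \sum_(0 <= k <oo) q k z)%E.
  apply: (@emeasurable_fun_cvg _ _ _ _ (fun n z => (\sum_(0 <= k < n) q k z)%E)) => [n|z _].
    exact: emeasurable_sum.
  by apply: is_cvg_nneseries => k _ _; exact: q0.
apply: (@le_trans _ _ (\int[mu]_(z in Omega) \sum_(0 <= k <oo) q k z)%E).
  rewrite /energy.
  by apply: (ge0_le_integral mu mOmega (integrand_ge0 F) (measurable_energy mF) mQ) => z _;
    exact: key.
rewrite (integral_nneseries mu mOmega mq (fun k z _ => q0 k z)).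
apply: lime_le; first by apply: is_cvg_nneseries => k _ _; apply: integral_ge0 => z _; exact: q0.
apply: nearW => n; rewrite big_mkord.
apply: (@le_trans _ _ (\sum_(k < n) (l k)%:E * B)%E).
  apply: lee_sum => k _.
  rewrite (ge0_integralZl_EFin mu mOmega (integrand_ge0 (G k)) (measurable_energy (mG k)) (l0 k)).
  have [->|lk] := eqVneq (l k) 0; first by rewrite !mul0e.
  by rewrite lee_wpmul2l ?lee_fin//; exact: GB.
rewrite -ge0_sume_distrl; last by move=> k _; rewrite lee_fin.
by rewrite sumEFin -[leRHS]mul1e lee_wpmul2r// lee_fin.
Qed.

Hypothesis Omega_fin : (mu Omega < +oo)%E.

Lemma ler_energy_cohen S M f : bounded_by (@inner R d) S M ->
  (forall z, normc (cohen S f z) <= M) ->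
  measurable_cfun (cohen S f) -> (energy (cohen S f) <= (M `^ p)%:E * mu Omega)%E.
Proof.
move=> [_ M0 _] fM mf; rewrite -(integral_cst mu mOmega).
rewrite /energy.
apply: (ge0_le_integral mu mOmega (integrand_ge0 (cohen S f)) (measurable_energy mf)).
  exact: measurable_cst.
move=> z _; rewrite lee_fin; apply: ge0_ler_powR (fM z); first exact: ltW.
  by rewrite nnegrE; exact: normc_ge0.
by rewrite nnegrE.
Qed.

(** Dominated convergence: the constant M^p is integrable on a set of finite measure. *)
Lemma cvg_energy (F_ : nat -> Rd * Rd -> R[i]) F M : (forall n, measurable_cfun (F_ n)) ->
  (forall n z, normc (F_ n z) <= M) ->
  (forall z, (fun n => normc (F_ n z - F z)) @ \oo --> (0 : R)) ->
  (fun n => energy (F_ n)) @ \oo --> energy F.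
Proof.
move=> mF_ FM FF; have mF := measurable_cfun_cvg mF_ FF.
have M0 : 0 <= M by exact: le_trans (normc_ge0 _) (FM 0%N ([tuple 0 | _ < d], [tuple 0 | _ < d])).
have [] := @dominated_convergence _ _ _ mu Omega mOmega
  (fun n (z : phase_space R d) => (normc (F_ n z) `^ p)%:E)
  (fun z => (normc (F z) `^ p)%:E) (cst (M `^ p)%:E).
- by move=> n; exact: measurable_energy.
- exact: measurable_energy.
- apply: aeW => z _; apply: cvg_EFin; first exact: nearW.
  by apply: cvg_powR => // [n|]; [exact: normc_ge0|exact: cvg_normc].
- apply/integrableP; split; first exact: measurable_cst.
  rewrite (eq_integral (cst (M `^ p)%:E)).
    by rewrite (integral_cst mu mOmega) lte_mul_pinfty// lee_fin powR_ge0.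
  by move=> z _; rewrite /= ger0_norm ?powR_ge0.
- apply: aeW => z n _; rewrite /= lee_fin ger0_norm ?powR_ge0//.
  apply: ge0_ler_powR (FM n z); first exact: ltW.
    by rewrite nnegrE; exact: normc_ge0.
  by rewrite nnegrE.
by move=> _ _.
Qed.

End Lp_norms.

(** * Comparison of the suprema and attainment *)

Section suprema.
Context (R : realType) (d : nat) (p : R) (Omega : set (phase_space R d)).
Local Open Scope complex_scope.
Local Notation L2 := (L2 R d).
Local Notation mu := (lebesgue_phase R d).
Local Notation "'N u" := (ip_norm (@inner R d) u) (at level 10, u at level 8).
Implicit Types (f h u : L2).
Hypothesis d_gt0 : (0 < d)%N.
Hypothesis p_ge1 : 1 <= p.
Hypothesis mOmega : measurable Omega.
Hypothesis Omega_fin : (mu Omega < +oo)%E.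
Variables (S : L2 -> L2) (M : R).
Hypothesis bS : bounded_by (@inner R d) S M.

Let p_gt0 : 0 < p. Proof. exact: lt_le_trans p_ge1. Qed.

Local Notation supQ := (ereal_sup [set cohen_quotient p Omega S f | f in [set f : L2 | f != 0]]).
Local Notation Lp := (Lp_on p Omega).
Local Notation normalize := (normalize (@inner R d)).

Let measurable_cohenS u : measurable_cfun (cohen S u).
Proof. by have [e be] := L2_orthonormal_basis R d_gt0; exact: (measurable_cohen u be bS). Qed.


Let normalizeK u : u = ('N u)%:C *: normalize u.
Proof.
rewrite /normalize scalerA -rmorphM/=; have [u0|u0] := eqVneq ('N u) 0.
  by rewrite u0 mul0r scale0r (ip_norm_eq0 inner_form (@inner_eq0 R d) u0).
by rewrite divff// scale1r.
Qed.

Let quotient_normalize f : f != 0 ->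
  cohen_quotient p Omega S f = Lp (cohen S (normalize f)).
Proof.
have [e be] := L2_orthonormal_basis R d_gt0.
exact: (cohen_quotient_normalize p_ge1 mOmega be bS).
Qed.

Let cohen_normalize u z :
  cohen S u z = ('N u ^+ 2)%:C * cohen S (normalize u) z.
Proof.
rewrite {1}(normalizeK u) (cohenZ _ _ _ bS) normc_real.
by rewrite ger0_norm// ip_norm_ge0.
Qed.

Lemma Lp_on_cohen_normalize u :
  Lp (cohen S u) = (('N u ^+ 2)%:E * Lp (cohen S (normalize u)))%E.
Proof.
rewrite -(Lp_onZ p_ge1 mOmega (sqr_ge0 _) (measurable_cohenS _)); congr Lp_on.
by apply/funext => z; exact: cohen_normalize.
Qed.

Lemma quotient_le_sup f : f != 0 -> (cohen_quotient p Omega S f <= supQ)%E.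
Proof. by move=> f0; apply: ereal_sup_ubound; exists f. Qed.

Lemma exists_unit_L2 : exists u, 'N u = 1.
Proof.
have [e [oe _]] := L2_orthonormal_basis R d_gt0; exists (e 0%N).
by rewrite /ip_norm oe eqxx sqrtr1.
Qed.

Let unit_neq0 u : 'N u = 1 -> u != 0.
Proof.
by apply: contra_eq_neq => ->; rewrite (ip_norm0 inner_form) eq_sym oner_eq0.
Qed.

(** A supremum over the empty set would be [-oo], so a nonzero vector is needed. *)
Lemma sup_quotient_ge0 : (0 <= supQ)%E.
Proof.
have [u /unit_neq0 u0] := exists_unit_L2.
by apply: le_trans (quotient_le_sup u0); rewrite (quotient_normalize u0) Lp_onE poweR_ge0.
Qed.

Lemma Lp_on_op_conv_le T : density_op T -> (Lp (op_conv T (check_op S)) <= supQ)%E.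
Proof.
move=> /(density_op_decomposition d_gt0)[g g1 Tg].
suff h : (energy p Omega (op_conv T (check_op S)) <= supQ `^ p)%E.
  rewrite Lp_onE -[leRHS](poweRe1 sup_quotient_ge0) -(@mulfV _ p) ?gt_eqF// poweRrM.
  apply: gt0_ler_poweR h; first by rewrite invr_ge0 ltW.
    by rewrite in_itv/= energy_ge0 leey.
  by rewrite in_itv/= poweR_ge0 leey.
apply: (energy_convex p_ge1 mOmega (G := fun k => cohen S (normalize (g k)))
  (l := fun k => 'N (g k) ^+ 2)) => //.
- by move=> k; exact: sqr_ge0.
- move=> z; have := op_conv_cvg d_gt0 z g1 Tg bS.
  apply: cvg_trans; apply: near_eq_cvg; apply: nearW => n; congr (normc (_ - _)).
  by apply: eq_bigr => k _; exact: cohen_normalize.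
- exact: poweR_ge0.
move=> k; rewrite sqrf_eq0 => gk; rewrite (energyE _ p_ge1).
have gk0 : g k != 0 by apply: contra_neq gk => ->; exact: (ip_norm0 inner_form).
apply: gt0_ler_poweR; first exact: ltW.
- by rewrite in_itv/= Lp_onE poweR_ge0 leey.
- by rewrite in_itv/= sup_quotient_ge0 leey.
by rewrite -(quotient_normalize gk0); exact: quotient_le_sup.
Qed.

Lemma Lp_on_rank_one f : f != 0 -> density_op (rank_one (normalize f)) /\
  Lp (op_conv (rank_one (normalize f)) (check_op S)) = cohen_quotient p Omega S f.
Proof.
move=> f0; split; first exact/(density_rank_one d_gt0)/normalize_norm1.
have -> : op_conv (rank_one (normalize f)) (check_op S) = cohen S (normalize f).
  by apply/funext => z; exact: (op_conv_rank_one d_gt0 _ _ bS).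
exact/esym/quotient_normalize.
Qed.

Lemma normc_cohen_unit u z : 'N u = 1 -> normc (cohen S u z) <= M.
Proof. by move=> u1; have := normc_cohen_le u z bS; rewrite u1 expr1n mulr1. Qed.

(* A maximizing sequence of unit vectors has a weak cluster point, which
   maximizes the energy although its norm may be smaller than 1. *)
Lemma compact_energy_max : seq_compact (@inner R d) S -> exists2 f, 'N f <= 1 &
  forall u, 'N u = 1 -> (energy p Omega (cohen S u) <= energy p Omega (cohen S f))%E.
Proof.
move=> cS; have [e be] := L2_orthonormal_basis R d_gt0.
pose J u := energy p Omega (cohen S u).
pose b := ereal_sup [set J u | u in [set u | 'N u = 1]].
have Jb u : 'N u = 1 -> (J u <= b)%E by move=> u1; apply: ereal_sup_ubound; exists u.
have bfin : b \is a fin_num.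
  have [u u1] := exists_unit_L2.
  rewrite ge0_fin_numE; last by apply: le_trans (Jb _ u1); exact: energy_ge0.
  apply: (@le_lt_trans _ _ ((M `^ p)%:E * mu Omega)%E).
    apply: ge_ereal_sup => _ [v v1 <-].
    exact: (ler_energy_cohen p_ge1 mOmega bS (fun z => normc_cohen_unit z v1)).
  by rewrite lte_mul_pinfty// lee_fin powR_ge0.
have /choice[f_ hf_] : forall n : nat, exists u, 'N u = 1 /\ (b - n.+1%:R^-1%:E < J u)%E.
  move=> n; have n0 : 0 < (n.+1%:R^-1 : R) by rewrite invr_gt0.
  by have [_ [u u1 <-] hu] := ub_ereal_sup_adherent n0 bfin; exists u.
have f1 n : 'N (f_ n) = 1 by case: (hf_ n).
have [|k kh [f wf]] := weak_compactness inner_form be (@L2_complete R d) (f_ := f_).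
  by move=> n; rewrite f1.
exists f => [|u u1].
  by apply: (weak_cvg_norm_le1 inner_form (f_ := f_ \o k)) => // n; rewrite /= f1.
have cvJ : (fun n => J (f_ (k n))) @ \oo --> J f.
  apply: (cvg_energy p_ge1 mOmega Omega_fin (M := M)) => [n|n z|z].
  - exact: measurable_cohenS.
  - exact: normc_cohen_unit.
  rewrite cohenE; under eq_fun do rewrite cohenE.
  (* For each fixed [z], the vectors pi(z)^* f_(k n) converge weakly to pi(z)^* f and stay in the
     unit ball. *)
  apply: (compact_form_cvg inner_form (@inner_eq0 R d) be (@L2_complete R d) bS cS
    (f_ := fun n => tfshift_adj z (f_ (k n)))) => [n|v].
    by rewrite (le_trans (ler_norm_tfshift_adj _ _))// f1.
  by rewrite inner_tfshift_adj; under eq_fun do rewrite inner_tfshift_adj; exact: wf.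
apply: le_trans (Jb _ u1) _; apply/lee_addgt0Pr => eps eps0.
rewrite -leeBlDr//; apply: (cvge_to_ge cvJ).
apply: filterS (near_infty_natSinv_lt (PosNum eps0)) => n /= hn.
have [_ /ltW] := hf_ (k n); apply: le_trans.
rewrite EFinN; apply: leeB => //; rewrite lee_fin
  (le_trans _ (ltW hn))// lef_pV2 ?posrE// ler_nat ltnS.
(* A strictly increasing [k] satisfies [n <= k n], so the subsequence is at least as close to the
   supremum. *)
by elim: n {hn} => // n IH; exact: leq_ltn_trans IH (kh _ _ (ltnSn n)).
Qed.

Lemma compact_attained : seq_compact (@inner R d) S ->
  exists2 f, f != 0 & cohen_quotient p Omega S f = supQ.
Proof.
move=> /compact_energy_max[f f1 fmax].
have supf : (supQ <= Lp (cohen S f))%E.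
  apply: ge_ereal_sup => _ [u u0 <-]; rewrite (quotient_normalize u0).
  by apply: (ler_Lp_on p_ge1); apply: fmax; exact: normalize_norm1.
(* Since |f| <= 1, dividing by |f|^2 can only increase the norm of Q_S f; so a nonzero [f] attains
   the supremum. *)
have [f0|f0] := eqVneq f 0; last first.
  exists f; first exact: f0.
  apply/eqP; rewrite eq_le (quotient_le_sup f0)/=; apply: le_trans supf _.
  rewrite Lp_on_cohen_normalize (quotient_normalize f0) -[leRHS]mul1e.
  apply: lee_wpmul2r; first by rewrite Lp_onE poweR_ge0.
  by rewrite lee_fin exprn_ile1// ip_norm_ge0.
(* If the weak limit is 0, the supremum is at most 0, all quotients vanish and any nonzero vector is
   a maximizer. *)
have [u /unit_neq0 u0] := exists_unit_L2; exists u; first exact: u0.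
apply/eqP; rewrite eq_le (quotient_le_sup u0)/=; apply: le_trans supf _.
rewrite Lp_on_cohen_normalize f0 (ip_norm0 inner_form) expr0n mul0e.
by rewrite (quotient_normalize u0) Lp_onE poweR_ge0.
Qed.

End suprema.

Theorem proposition1p3 (R : realType) (d : nat) (d_gt0 : (0 < d)%N)
    (p : R) (p_ge1 : 1 <= p)
    (Omega : set (phase_space R d)) (mOmega : measurable Omega)
    (Omega_gt0 : (0 < lebesgue_phase R d Omega)%E)
    (Omega_fin : (lebesgue_phase R d Omega < +oo)%E)
    (S : L2 R d -> L2 R d) (bS : bounded_op S) :
  let supD := ereal_sup
    [set Lp_on p Omega (op_conv T (check_op S)) | T in @density_op R d] in
  let supQ := ereal_sup
    [set cohen_quotient p Omega S f | f in [set f : L2 R d | f != 0]] in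
  let attainedQ := exists2 f : L2 R d,
    f != 0 & cohen_quotient p Omega S f = supQ in
  [/\ supD = supQ,
      attainedQ -> exists2 f : L2 R d, density_op (rank_one f) &
        Lp_on p Omega (op_conv (rank_one f) (check_op S)) = supD
    & compact_op S -> attainedQ].
Proof.
move=> supD supQ attainedQ; have [M bM] := (bounded_opP S).1 bS.
have DQ : supD = supQ.
  apply/eqP; rewrite eq_le; apply/andP; split.
    apply: ge_ereal_sup => _ [T DT <-].
    exact: (Lp_on_op_conv_le d_gt0 p_ge1 mOmega bM).
  apply: ge_ereal_sup => _ [f f0 <-]; apply: ereal_sup_ubound.
  have [Df <-] := Lp_on_rank_one d_gt0 p_ge1 mOmega bM f0.
  by eexists; first exact: Df.
split=> //.
  move=> [f f0 fQ]; have [Df Lf] := Lp_on_rank_one d_gt0 p_ge1 mOmega bM f0.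
  by eexists; first exact: Df; rewrite Lf fQ DQ.
move=> [_ cS]; apply: (compact_attained d_gt0 p_ge1 mOmega Omega_fin bM) => u_ [B uB].
have [|k kh [v hv]] := cS u_; first by exists B => n; rewrite norm2E.
exists k => //; exists v; apply: cvg_trans hv; apply: near_eq_cvg; apply: nearW => n.
by rewrite norm2E.
Qed.
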